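(* For every $r\in\mathbb{N}$ there exists a constant $c(r)>0$ such that for every function $f\in W^r[-1,1]$ and every integer $n\ge r-1$ there is an algebraic polynomial $p_n$ of degree at most $n$ satisfying, for all $x\in[-1,1]$, $$|f(x)-p_n(x)|\le K_r\Big(\frac{\sqrt{1-x^2}}{n+1}\Big)^r+c(r)\,\frac{(\sqrt{1-x^2})^{\,r-1}}{(n+1)^{r+1}}.$$ Moreover, the constant $K_r$ cannot be replaced by any smaller constant (i.e. for any $K<K_r$ and any constant $C$ the analogous statement with $K$ in place of $K_r$ and $C$ in place of $c(r)$ fails), and any admissible constant $c(r)$ satisfies $c(r)\ge c\,e^{r}$ for all $r\in\mathbb{N}$, with an absolute constant $c>0$.
   Context: $W^r[-1,1]$ ($r\in\mathbb{N}$) is the class of functions $f$ on $[-1,1]$ such that $f^{(r-1)}$ is absolutely continuous and $|f^{(r)}(x)|\le 1$ for almost every $x$. The Favard-type constant is $K_r=\frac{4}{\pi}\sum_{\nu=0}^{\infty}\frac{(-1)^{\nu(r+1)}}{(2\nu+1)^{r+1}}$. *)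

(* Defs.v *)
From Stdlib Require Import Reals Lra Lia List ClassicalEpsilon.
Import ListNotations.
Open Scope R_scope.

Definition inI (x : R) : Prop := -1 <= x <= 1.

Definition cont_on_I (g : R -> R) : Prop :=
  forall x, inI x -> forall eps, eps > 0 -> exists d, d > 0 /\
    forall y, inI y -> Rabs (y - x) < d -> Rabs (g y - g x) < eps.

Fixpoint chain (lo : R) (l : list (R * R)) (hi : R) : Prop :=
  match l with
  | [] => lo <= hi
  | (a, b) :: t => lo <= a /\ a <= b /\ chain b t hi
  end.

Definition total_len (l : list (R * R)) : R :=
  fold_right (fun p s => snd p - fst p + s) 0 l.

Definition total_var (g : R -> R) (l : list (R * R)) : R :=
  fold_right (fun p s => Rabs (g (snd p) - g (fst p)) + s) 0 l.

Definition AC_on_I (g : R -> R) : Prop :=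
  forall eps, eps > 0 -> exists d, d > 0 /\
    forall l, chain (-1) l 1 -> total_len l < d -> total_var g l < eps.

Definition null_set (S : R -> Prop) : Prop :=
  forall eps, eps > 0 -> exists a b : nat -> R,
    (forall k, a k <= b k) /\
    (forall x, S x -> exists k, a k < x < b k) /\
    (forall N, sum_f_R0 (fun k => b k - a k) N < eps).

(* W^r[-1,1]: F k plays the role of f^(k), k = 0..r-1; f^(k) is the derivative
   of f^(k-1) on (-1,1) and continuous on [-1,1] (hence also the one-sided
   derivative at the endpoints); f^(r-1) is absolutely continuous on [-1,1]
   and |f^(r)(x)| <= 1 for almost every x (i.e. the set of x in (-1,1) at which
   f^(r-1) is not differentiable with derivative of modulus <= 1 is null). *)
Definition W (r : nat) (f : R -> R) : Prop :=
  exists F : nat -> R -> R,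
    (forall x, inI x -> F 0%nat x = f x) /\
    (forall k, (k <= r - 1)%nat -> cont_on_I (F k)) /\
    (forall k x, (k < r - 1)%nat -> -1 < x < 1 ->
        derivable_pt_lim (F k) x (F (S k) x)) /\
    AC_on_I (F (r - 1)%nat) /\
    null_set (fun x => -1 < x < 1 /\
        ~ (exists l, derivable_pt_lim (F (r - 1)%nat) x l /\ Rabs l <= 1)).

(* K_r = 4/pi * sum_{nu>=0} (-1)^(nu(r+1)) / (2nu+1)^(r+1)  (the series converges). *)
Definition Kr_term (r : nat) (nu : nat) : R :=
  (-1) ^ (nu * (r + 1)) / (INR (2 * nu + 1)) ^ (r + 1).

Definition Kr (r : nat) : R :=
  4 / PI * epsilon (inhabits 0) (fun l => infinite_sum (Kr_term r) l).

Definition poly_eval (a : nat -> R) (n : nat) (x : R) : R :=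
  sum_f_R0 (fun k => a k * x ^ k) n.

Definition admissible (r : nat) (K C : R) : Prop :=
  forall f, W r f -> forall n : nat, (r - 1 <= n)%nat ->
    exists a : nat -> R, forall x, inI x ->
      Rabs (f x - poly_eval a n x) <=
        K * (sqrt (1 - x ^ 2) / INR (n + 1)) ^ r
        + C * (sqrt (1 - x ^ 2)) ^ (r - 1) / INR (n + 1) ^ (r + 1).

(* Main.v *)
(** Upper estimate. A function of [W^r] is first replaced by a polynomial [f] with [|f^(r)| <= 1]: by absolute continuity [f^(r-1)] is
    1-Lipschitz, its Bernstein polynomials stay 1-Lipschitz, and the small difference is matched at the endpoints by a Hermite interpolant of
    degree [r - 1]. For a polynomial [f], subtract a Hermite interpolant so that [f1 = f - q] vanishes to order [r] at both endpoints, and put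
    [g t = f1 (cos t) / sin t ^ r]. Then [g^(r) t = (-1)^r f^(r) (cos t) + R t], where [R] has increments at [t] bounded by
    [C |v - t| / |sin t|]. The first part is approximated by a trigonometric polynomial of degree below [M = n - r + 1] with error [Kr r / M^r]
    (Favard), the second one with error [C / (M^(r+1) |sin t|)] (Jackson); multiplication by [sin t ^ r] gives a polynomial of degree [n] in
    [cos t].

    Favard's theorem is obtained from the representation of [1 / k^r] as a limit of nonnegative combinations of geometric sequences [q^k]: for
    the kernels [sum_k q^k cos (k x)] and [sum_k q^k sin (k x)] the best approximation is explicit, and its error has the sign of [cos (M x)],
    respectively of [sin (M x)].

    Sharpness is tested near [0] on a dilation of an approximate Euler spline, with alternating sums over Chebyshev nodes. For the
    constant, take [f = x^r / r!] and [n = r - 1]: the weight forces the error polynomial to be a multiple of [(x^2 - 1)^(r / 2)] (integer division). *)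

From Stdlib Require Import Reals Lra Lia Arith List ClassicalEpsilon Classical.
From Coquelicot Require Import Coquelicot.
Require Import Defs.
Import ListNotations.
Open Scope R_scope.

(** * Spans, polynomials and trigonometric polynomials *)

(** Approximating [f (cos t)] directly would leave the weight inside the error. Dividing by
    [sin t ^ r] beforehand and multiplying back afterwards puts it outside, at the price of a
    remainder that is singular at the zeros of [sin]. The loss [1 / |sin t|] is exactly the gap
    between the weights of the two terms of the estimate, so Jackson's theorem is needed in a local
    form: one polynomial, whose error at [t] is governed by the modulus at [t] alone. Passing from
    [M] to [n + 1] costs a relative error of order [1 / n], which the second term absorbs; the
    finitely many [n] with [n + 1 < 2 r] are treated apart. Starting from polynomials keeps [f^(r)]
    continuous, so that only finite Fourier sums and Riemann integrals of continuous functions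
    occur. For the same reason the sign of the cosine, whose Fourier coefficients produce [Kr r], is
    replaced by trigonometric polynomials. For sharpness, the weights [(1 - x ^ 2) ^ d] concentrate
    the alternating sum near 0, with [d] a small fraction of the degree. The exponential growth of
    [c(r)] is that of [r ^ (r + 1) / r!]. *)

Lemma Rinv_bounds x : 1 <= x -> 0 < / x <= 1.
Proof.
  intros H. split; [apply Rinv_0_lt_compat; lra|]. rewrite <- Rinv_1. apply Rinv_le_contravar; lra.
Qed.

(** Half-open sums: the empty sum is available, and an index range splits at [n] without an
    offset. *)
Fixpoint sm (f : nat -> R) (n : nat) : R :=
  match n with O => 0 | S k => sm f k + f k end.

Lemma sm_ext f g n : (forall i, (i < n)%nat -> f i = g i) -> sm f n = sm g n.
Proof.
  induction n as [|n IH]; simpl; intros H; [easy|].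
  rewrite IH, H; auto with arith.
Qed.

Lemma sm_plus f g n : sm (fun i => f i + g i) n = sm f n + sm g n.
Proof. induction n; simpl; [|rewrite IHn]; ring. Qed.

Lemma sm_scal c f n : sm (fun i => c * f i) n = c * sm f n.
Proof. induction n; simpl; [|rewrite IHn]; ring. Qed.

Lemma sm_zero f n : (forall i, (i < n)%nat -> f i = 0) -> sm f n = 0.
Proof.
  induction n as [|n IH]; simpl; intros H; [easy|].
  rewrite IH, H; auto with arith; ring.
Qed.

Lemma sm_le f g n : (forall i, (i < n)%nat -> f i <= g i) -> sm f n <= sm g n.
Proof.
  induction n as [|n IH]; simpl; intros H; [lra|].
  apply Rplus_le_compat; auto with arith.
Qed.

Lemma sm_abs f n : Rabs (sm f n) <= sm (fun i => Rabs (f i)) n.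
Proof.
  induction n; simpl; [rewrite Rabs_R0; lra|].
  eapply Rle_trans; [apply Rabs_triang|]; lra.
Qed.

Lemma sm_minus f g n : sm (fun i => f i - g i) n = sm f n - sm g n.
Proof. induction n; simpl; [|rewrite IHn]; ring. Qed.

Lemma sm_const c n : sm (fun _ => c) n = INR n * c.
Proof. induction n; [simpl; ring|]. rewrite S_INR; simpl sm; rewrite IHn; ring. Qed.

Lemma sm_shift f n : sm f (S n) = f 0%nat + sm (fun i => f (S i)) n.
Proof.
  induction n; [simpl; ring|].
  change (sm f (S (S n))) with (sm f (S n) + f (S n)); rewrite IHn; simpl; ring.
Qed.

Lemma sm_f_R0 f n : sum_f_R0 f n = sm f (S n).
Proof. induction n; simpl; [ring|]. rewrite IHn; simpl; ring. Qed.

Lemma sm_add f n m : sm f (n + m) = sm f n + sm (fun i => f (n + i)%nat) m.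
Proof.
  induction m; simpl; [rewrite Nat.add_0_r; ring|].
  rewrite Nat.add_succ_r; simpl; rewrite IHm; ring.
Qed.

Lemma sm_nonneg f n : (forall i, (i < n)%nat -> 0 <= f i) -> 0 <= sm f n.
Proof.
  intros H. replace 0 with (sm (fun _ => 0) n) by (rewrite sm_const; ring).
  now apply sm_le.
Qed.

Lemma sm_term_le f n k : (forall i, (i < n)%nat -> 0 <= f i) -> (k < n)%nat -> f k <= sm f n.
Proof.
  induction n as [|n IH]; simpl; intros H Hk; [lia|].
  assert (0 <= sm f n) by (apply sm_nonneg; auto).
  assert (0 <= f n) by auto.
  destruct (Nat.eq_dec k n); [subst; lra|].
  assert (f k <= sm f n) by (apply IH; [auto|lia]). lra.
Qed.

(** Closure under pointwise equality stands in for functional extensionality. Every linear statement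
    about polynomials or trigonometric polynomials of bounded degree becomes an induction over five
    cases. *)
Inductive span (G : (R -> R) -> Prop) : (R -> R) -> Prop :=
| span_gen f : G f -> span G f
| span_zero : span G (fun _ => 0)
| span_plus f g : span G f -> span G g -> span G (fun x => f x + g x)
| span_scal c f : span G f -> span G (fun x => c * f x)
| span_ext f g : span G f -> (forall x, f x = g x) -> span G g.

Lemma span_opp G f : span G f -> span G (fun x => - f x).
Proof. intros H. eapply span_ext; [apply (span_scal G (-1) _ H)|intros; simpl; ring]. Qed.

Lemma span_minus G f g : span G f -> span G g -> span G (fun x => f x - g x).
Proof. intros H K. eapply span_ext; [apply (span_plus _ _ _ H (span_opp _ _ K))|intros; simpl; ring]. Qed.

Lemma span_sm G (F : nat -> R -> R) n :
  (forall i, (i < n)%nat -> span G (F i)) -> span G (fun x => sm (fun i => F i x) n).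
Proof.
  induction n as [|n IH]; simpl; intros H; [apply span_zero|].
  apply span_plus; auto.
Qed.

Lemma span_sub (G H : (R -> R) -> Prop) f :
  (forall g, G g -> span H g) -> span G f -> span H f.
Proof.
  intros GH S; induction S; auto.
  - apply span_zero.
  - now apply span_plus.
  - now apply span_scal.
  - eapply span_ext; eauto.
Qed.

Lemma span_mult (G1 G2 G3 : (R -> R) -> Prop) f g :
  (forall u v, G1 u -> G2 v -> span G3 (fun x => u x * v x)) ->
  span G1 f -> span G2 g -> span G3 (fun x => f x * g x).
Proof.
  intros HG Hf Hg; induction Hf as [u Hu| |u v Hu IHu Hv IHv|c u Hu IHu|u v Hu IHu E].
  - induction Hg as [v Hv| |v w Hv IHv Hw IHw|c v Hv IHv|v w Hv IHv E].
    + auto.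
    + eapply span_ext; [apply span_zero|intros; simpl; ring].
    + eapply span_ext; [apply (span_plus _ _ _ IHv IHw)|intros; simpl; ring].
    + eapply span_ext; [apply (span_scal _ c _ IHv)|intros; simpl; ring].
    + eapply span_ext; [apply IHv|intros; simpl; now rewrite E].
  - eapply span_ext; [apply span_zero|intros; simpl; ring].
  - eapply span_ext; [apply (span_plus _ _ _ IHu IHv)|intros; simpl; ring].
  - eapply span_ext; [apply (span_scal _ c _ IHu)|intros; simpl; ring].
  - eapply span_ext; [apply IHu|intros; simpl; now rewrite E].
Qed.

Lemma span_comp (G H : (R -> R) -> Prop) (h : R -> R) f :
  (forall g, G g -> span H (fun x => g (h x))) -> span G f -> span H (fun x => f (h x)).
Proof.
  intros GH S; induction S as [u Hu| |u v Hu IHu Hv IHv|c u Hu IHu|u v Hu IHu E].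
  - auto.
  - apply span_zero.
  - apply (span_plus _ _ _ IHu IHv).
  - apply (span_scal _ c _ IHu).
  - eapply span_ext; [apply IHu|intros; simpl; apply E].
Qed.

Definition poly (n : nat) := span (fun f => exists k, (k <= n)%nat /\ f = fun x => x ^ k).
Definition ctrig (n : nat) := span (fun f => exists k, (k <= n)%nat /\ f = fun t => cos (INR k * t)).
Definition trig (n : nat) := span (fun f => exists k, (k <= n)%nat /\
  (f = (fun t => cos (INR k * t)) \/ f = (fun t => sin (INR k * t)))).

Lemma poly_mono n m f : (n <= m)%nat -> poly n f -> poly m f.
Proof.
  intros L; apply span_sub; intros g [k [Hk ->]]; apply span_gen; exists k; split; [lia|easy].
Qed.

Lemma trig_mono n m f : (n <= m)%nat -> trig n f -> trig m f.
Proof.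
  intros L; apply span_sub; intros g [k [Hk Hg]]; apply span_gen; exists k; split; [lia|easy].
Qed.

Lemma ctrig_mono n m f : (n <= m)%nat -> ctrig n f -> ctrig m f.
Proof.
  intros L; apply span_sub; intros g [k [Hk Hg]]; apply span_gen; exists k; split; [lia|easy].
Qed.

Lemma poly_pow k n : (k <= n)%nat -> poly n (fun x => x ^ k).
Proof. intros; apply span_gen; eauto. Qed.

Lemma poly_const n c : poly n (fun _ => c).
Proof. eapply span_ext; [apply (span_scal _ c), (poly_pow 0); lia|intros; simpl; ring]. Qed.

Lemma poly_id n : (1 <= n)%nat -> poly n (fun x => x).
Proof. intros; eapply span_ext; [apply (poly_pow 1); lia|intros; simpl; ring]. Qed.

Lemma poly_mult n m p f g : poly n f -> poly m g -> (n + m <= p)%nat -> poly p (fun x => f x * g x).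
Proof.
  intros Hf Hg L; revert Hf Hg; apply span_mult.
  intros u v [k [Hk ->]] [l [Hl ->]].
  eapply span_ext; [apply (poly_pow (k + l)); lia|intros; simpl; now rewrite pow_add].
Qed.

Lemma poly_powf n f k m : poly n f -> (n * k <= m)%nat -> poly m (fun x => f x ^ k).
Proof.
  intros H; revert m; induction k; intros m L; [apply (poly_const m 1)|].
  simpl. apply (poly_mult n (n * k)); [auto|apply IHk; lia|lia].
Qed.

Lemma poly_eval_poly n f : (exists a, forall x, f x = poly_eval a n x) <-> poly n f.
Proof.
  split.
  - intros [a Ha]. apply span_ext with (fun x => sm (fun k => a k * x ^ k) (S n)).
    + apply span_sm; intros i Hi. apply span_scal, poly_pow; lia.
    + intros x; rewrite Ha; unfold poly_eval; now rewrite sm_f_R0.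
  - intros H; induction H as [u [k [Hk ->]]| |u v Hu [a IHu] Hv [b IHv]|c u Hu [a IHu]|u v Hu [a IHu] E].
    + exists (fun i => if Nat.eq_dec i k then 1 else 0); intros x; unfold poly_eval.
      rewrite sm_f_R0.
      assert (K : forall m, sm (fun i => (if Nat.eq_dec i k then 1 else 0) * x ^ i) m =
         if le_lt_dec m k then 0 else x ^ k).
      { induction m; [destruct (le_lt_dec 0 k); [easy|lia]|].
        cbn [sm]; rewrite IHm. destruct (Nat.eq_dec m k), (le_lt_dec m k), (le_lt_dec (S m) k); subst; try lia; ring. }
      rewrite K. destruct (le_lt_dec (S n) k); [lia|easy].
    + exists (fun _ => 0); intros x; unfold poly_eval; rewrite sm_f_R0, sm_zero; intros; ring.
    + exists (fun i => a i + b i); intros x. rewrite IHu, IHv; unfold poly_eval; rewrite !sm_f_R0, <- sm_plus.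
      apply sm_ext; intros; ring.
    + exists (fun i => c * a i); intros x. rewrite IHu; unfold poly_eval; rewrite !sm_f_R0, <- sm_scal.
      apply sm_ext; intros; ring.
    + exists a; intros; now rewrite <- E.
Qed.

Lemma trig_cos k n : (k <= n)%nat -> trig n (fun t => cos (INR k * t)).
Proof. intros; apply span_gen; eauto. Qed.

Lemma trig_sin k n : (k <= n)%nat -> trig n (fun t => sin (INR k * t)).
Proof. intros; apply span_gen; eauto. Qed.

Lemma trig_const n c : trig n (fun _ => c).
Proof.
  eapply span_ext; [apply (span_scal _ c), (trig_cos 0); lia|intros; simpl].
  rewrite Rmult_0_l, cos_0; ring.
Qed.

Lemma ctrig_cos k n : (k <= n)%nat -> ctrig n (fun t => cos (INR k * t)).
Proof. intros; apply span_gen; eauto. Qed.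

Lemma ctrig_const n c : ctrig n (fun _ => c).
Proof.
  eapply span_ext; [apply (span_scal _ c), (ctrig_cos 0); lia|intros; simpl].
  rewrite Rmult_0_l, cos_0; ring.
Qed.

Lemma ctrig_trig n f : ctrig n f -> trig n f.
Proof. apply span_sub; intros g [k [Hk ->]]; now apply trig_cos. Qed.

Lemma ctrig_cosdiff k l n : (k <= n)%nat -> (l <= n)%nat -> ctrig n (fun t => cos (INR k * t - INR l * t)).
Proof.
  intros Hk Hl. destruct (le_lt_dec l k).
  - eapply span_ext; [apply (ctrig_cos (k - l)); lia|intros; simpl].
    rewrite minus_INR by lia; f_equal; ring.
  - eapply span_ext; [apply (ctrig_cos (l - k)); lia|intros; simpl].
    rewrite minus_INR by lia. rewrite <- cos_neg; f_equal; ring.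
Qed.

Lemma trig_sindiff k l n : (k <= n)%nat -> (l <= n)%nat -> trig n (fun t => sin (INR k * t - INR l * t)).
Proof.
  intros Hk Hl. destruct (le_lt_dec l k).
  - eapply span_ext; [apply (trig_sin (k - l)); lia|intros; simpl].
    rewrite minus_INR by lia; f_equal; ring.
  - eapply span_ext; [apply (span_opp _ _ (trig_sin (l - k) n ltac:(lia)))|intros; simpl].
    rewrite minus_INR by lia. rewrite <- sin_neg; f_equal; ring.
Qed.

Lemma ctrig_mult n m p f g : ctrig n f -> ctrig m g -> (n + m <= p)%nat -> ctrig p (fun x => f x * g x).
Proof.
  intros Hf Hg L; revert Hf Hg; apply span_mult.
  intros u v [k [Hk ->]] [l [Hl ->]].
  eapply span_ext; [apply (span_scal _ (/2)), span_plus;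
    [apply (ctrig_cos (k + l) p); lia|apply (ctrig_cosdiff k l p); lia]|intros; simpl].
  rewrite plus_INR, Rmult_plus_distr_r, cos_plus, cos_minus; field.
Qed.

Lemma trig_mult n m p f g : trig n f -> trig m g -> (n + m <= p)%nat -> trig p (fun x => f x * g x).
Proof.
  intros Hf Hg L; revert Hf Hg; apply span_mult.
  intros u v [k [Hk Hu]] [l [Hl Hv]].
  assert (C1 := trig_cos (k + l) p ltac:(lia)).
  assert (C2 := ctrig_trig _ _ (ctrig_cosdiff k l p ltac:(lia) ltac:(lia))).
  assert (S1 := trig_sin (k + l) p ltac:(lia)).
  assert (S2 := trig_sindiff k l p ltac:(lia) ltac:(lia)).
  destruct Hu as [-> | ->], Hv as [-> | ->].
  - eapply span_ext; [apply (span_scal _ (/2)), (span_plus _ _ _ C1 C2)|intros; simpl].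
    rewrite plus_INR, Rmult_plus_distr_r, cos_plus, cos_minus; field.
  - eapply span_ext; [apply (span_scal _ (/2)), (span_minus _ _ _ S1 S2)|intros; simpl].
    rewrite plus_INR, Rmult_plus_distr_r, sin_plus, sin_minus; field.
  - eapply span_ext; [apply (span_scal _ (/2)), (span_plus _ _ _ S1 S2)|intros; simpl].
    rewrite plus_INR, Rmult_plus_distr_r, sin_plus, sin_minus; field.
  - eapply span_ext; [apply (span_scal _ (/2)), (span_minus _ _ _ C2 C1)|intros; simpl].
    rewrite plus_INR, Rmult_plus_distr_r, cos_plus, cos_minus; field.
Qed.

Lemma trig_powf n f k m : trig n f -> (n * k <= m)%nat -> trig m (fun x => f x ^ k).
Proof.
  intros H; revert m; induction k; intros m L; [apply (trig_const m 1)|].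
  simpl. apply (trig_mult n (n * k)); [auto|apply IHk; lia|lia].
Qed.

Lemma trig_sin1 : trig 1 sin.
Proof. eapply span_ext; [apply (trig_sin 1); lia|intros; simpl; f_equal; ring]. Qed.

Lemma ctrig_cos1 : ctrig 1 cos.
Proof. eapply span_ext; [apply (ctrig_cos 1); lia|intros; simpl; f_equal; ring]. Qed.

Lemma ctrig_powcos k : ctrig k (fun t => cos t ^ k).
Proof.
  induction k; [apply (ctrig_const 0 1)|]. simpl.
  apply (ctrig_mult 1 k); [apply ctrig_cos1|auto|lia].
Qed.

Lemma poly_cos_ctrig n f : poly n f -> ctrig n (fun t => f (cos t)).
Proof.
  apply span_comp; intros g [k [Hk ->]]. eapply ctrig_mono; [apply Hk|apply ctrig_powcos].
Qed.

Lemma chebyshev k : exists T, poly k T /\ forall t, cos (INR k * t) = T (cos t).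
Proof.
  (* Two consecutive degrees are carried, because the recurrence [cos ((k + 2) t) = 2 cos t cos ((k
     + 1) t) - cos (k t)] uses both. *)
  cut ((exists T, poly k T /\ forall t, cos (INR k * t) = T (cos t)) /\
       (exists T, poly (S k) T /\ forall t, cos (INR (S k) * t) = T (cos t))); [tauto|].
  induction k as [|k [[T [HT ET]] [U [HU EU]]]].
  - split.
    + exists (fun _ => 1); split; [apply poly_const|intros; simpl; now rewrite Rmult_0_l, cos_0].
    + exists (fun x => x); split; [apply poly_id; lia|intros; simpl; f_equal; ring].
  - split; [eauto|].
    exists (fun x => 2 * (x * U x) - T x); split.
    + apply span_minus; [apply span_scal, (poly_mult 1 (S k)); [apply poly_id; lia|auto|lia]|].
      eapply poly_mono; [|apply HT]; lia.
    + intros t. rewrite <- EU, <- ET.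
      replace (INR (S (S k)) * t) with (INR (S k) * t + t) by (rewrite !S_INR; ring).
      replace (INR k * t) with (INR (S k) * t - t) by (rewrite !S_INR; ring).
      rewrite cos_plus, cos_minus; ring.
Qed.

Lemma ctrig_poly_cos n g : ctrig n g -> exists p, poly n p /\ forall t, g t = p (cos t).
Proof.
  intros H; induction H as [u [k [Hk ->]]| |u v Hu [a [IHu Ea]] Hv [b [IHv Eb]]|c u Hu [a [IHu Ea]]|u v Hu [a [IHu Ea]] E].
  - destruct (chebyshev k) as [T [HT ET]]; exists T; split; [eapply poly_mono; eauto|auto].
  - exists (fun _ => 0); split; [apply poly_const|easy].
  - exists (fun x => a x + b x); split; [now apply span_plus|intros; now rewrite Ea, Eb].
  - exists (fun x => c * a x); split; [now apply span_scal|intros; now rewrite Ea].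
  - exists a; split; [auto|intros; now rewrite <- E].
Qed.

(** Functions of [cos t] are even, so their trigonometric approximants may be replaced by their even
    parts, which are polynomials in [cos t] of the same degree. *)
Lemma trig_even_part n f : trig n f -> ctrig n (fun t => (f t + f (- t)) / 2).
Proof.
  intros H; induction H as [u [k [Hk [-> | ->]]]| |u v Hu IHu Hv IHv|c u Hu IHu|u v Hu IHu E].
  - eapply span_ext; [apply (ctrig_cos k n Hk)|intros x; simpl].
    replace (INR k * - x) with (- (INR k * x)) by ring. rewrite cos_neg; field.
  - eapply span_ext; [apply span_zero|intros x; simpl].
    replace (INR k * - x) with (- (INR k * x)) by ring. rewrite sin_neg; field.
  - eapply span_ext; [apply span_zero|intros; simpl; field].
  - eapply span_ext; [apply (span_plus _ _ _ IHu IHv)|intros; simpl; field].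
  - eapply span_ext; [apply (span_scal _ c _ IHu)|intros; simpl; field].
  - eapply span_ext; [apply IHu|intros; simpl; now rewrite !E].
Qed.

(** * Smooth functions and chains of derivatives *)

Definition smooth (f : R -> R) : Prop :=
  forall k x, is_derive (Derive_n f k) x (Derive_n f (S k) x).

(** [Derive] is total and has an arbitrary value where no derivative exists. Formulas for [Derive_n]
    are therefore obtained by exhibiting a sequence of functions, each proved to be the derivative
    of the one before. *)
Lemma chain_Derive_n (F : nat -> R -> R) :
  (forall k x, is_derive (F k) x (F (S k) x)) -> forall k x, Derive_n (F O) k x = F k x.
Proof.
  intros H; induction k; intros x; [easy|].
  simpl. rewrite (Derive_ext _ (F k)); [|apply IHk]. apply is_derive_unique, H.
Qed.

Lemma chain_smooth (F : nat -> R -> R) :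
  (forall k x, is_derive (F k) x (F (S k) x)) -> smooth (F O).
Proof.
  intros H k x. rewrite (chain_Derive_n F H (S k)).
  eapply is_derive_ext; [|apply H]. intros t; now rewrite chain_Derive_n.
Qed.

Lemma smooth_ext f g : smooth f -> (forall x, f x = g x) -> smooth g.
Proof.
  intros H E k x. rewrite <- (Derive_n_ext f g (S k) x E).
  eapply is_derive_ext; [|apply H]. intros t; now apply Derive_n_ext.
Qed.

Lemma Derive_n_S f k x : Derive_n f (S k) x = Derive_n (Derive f) k x.
Proof.
  revert x; induction k; intros x; [easy|].
  change (Derive (Derive_n f (S k)) x = Derive (Derive_n (Derive f) k) x).
  apply Derive_ext, IHk.
Qed.

Section Closed.
Variable P : (R -> R) -> Prop.
Hypothesis HP : forall f, P f -> exists g, P g /\ forall x, is_derive f x (g x).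
Hypothesis Pext : forall f g, P f -> (forall x, f x = g x) -> P g.

Lemma closed_Derive f : P f -> P (Derive f).
Proof.
  intros H; destruct (HP f H) as [g [Pg D]]. apply (Pext g); [auto|].
  intros x; symmetry; now apply is_derive_unique.
Qed.

Lemma closed_Derive_n f k : P f -> P (Derive_n f k).
Proof.
  intros H; induction k; [exact H|]. simpl. apply closed_Derive; auto.
Qed.

Lemma closed_smooth f : P f -> smooth f.
Proof.
  intros H k x. destruct (HP _ (closed_Derive_n f k H)) as [g [Pg D]].
  simpl. rewrite (is_derive_unique _ _ _ (D x)). apply D.
Qed.
End Closed.

Lemma is_derive_val (f : R -> R) x l l' : is_derive f x l -> l = l' -> is_derive f x l'.
Proof. now intros H <-. Qed.

Lemma span_derive (G H : (R -> R) -> Prop) f :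
  (forall g, G g -> exists d, span H d /\ forall x, is_derive g x (d x)) ->
  span G f -> exists d, span H d /\ forall x, is_derive f x (d x).
Proof.
  intros GH S; induction S as [u Hu| |u v Hu [a [IHu Ea]] Hv [b [IHv Eb]]|c u Hu [a [IHu Ea]]|u v Hu [a [IHu Ea]] E].
  - auto.
  - exists (fun _ => 0); split; [apply span_zero|intros; apply @is_derive_const].
  - exists (fun x => a x + b x); split; [now apply span_plus|intros; apply @is_derive_plus; auto].
  - exists (fun x => c * a x); split; [now apply span_scal|intros; apply is_derive_scal; auto].
  - exists a; split; [auto|]. intros x; eapply is_derive_ext; [apply E|auto].
Qed.

Lemma poly_derive n f : poly n f -> exists d, poly (n - 1) d /\ forall x, is_derive f x (d x).
Proof.
  apply span_derive. intros g [k [Hk ->]].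
  exists (fun x => INR k * x ^ (k - 1)); split; [apply span_scal, poly_pow; lia|].
  intros x. auto_derive; [easy|]. replace (Init.Nat.pred k) with (k - 1)%nat by lia. ring.
Qed.

Lemma poly_derive' n f : poly n f -> exists d, poly n d /\ forall x, is_derive f x (d x).
Proof.
  intros H; destruct (poly_derive n f H) as [d [Hd E]]; exists d; split; [|auto].
  eapply poly_mono; [|apply Hd]; lia.
Qed.

Lemma trig_derive n f : trig n f -> exists d, trig n d /\ forall x, is_derive f x (d x).
Proof.
  apply span_derive. intros g [k [Hk [-> | ->]]].
  - exists (fun x => - INR k * sin (INR k * x)); split; [apply span_scal, trig_sin; lia|].
    intros x. auto_derive; [easy|ring].
  - exists (fun x => INR k * cos (INR k * x)); split; [apply span_scal, trig_cos; lia|].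
    intros x. auto_derive; [easy|ring].
Qed.

Lemma poly_smooth n f : poly n f -> smooth f.
Proof. apply closed_smooth; [apply poly_derive'|intros; eapply span_ext; eauto]. Qed.

Lemma trig_smooth n f : trig n f -> smooth f.
Proof. apply closed_smooth; [apply trig_derive|intros; eapply span_ext; eauto]. Qed.

Lemma poly_Derive_n n f k : poly n f -> poly n (Derive_n f k).
Proof. apply closed_Derive_n; [apply poly_derive'|intros; eapply span_ext; eauto]. Qed.

Lemma trig_Derive_n n f k : trig n f -> trig n (Derive_n f k).
Proof. apply closed_Derive_n; [apply trig_derive|intros; eapply span_ext; eauto]. Qed.

Lemma smooth_cont f : smooth f -> forall x, continuous f x.
Proof. intros H x. apply (ex_derive_continuous f x). eexists; apply (H 0%nat). Qed.

Lemma Derive_n_plus_smooth f g k x : smooth f -> smooth g ->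
  Derive_n (fun y => f y + g y) k x = Derive_n f k x + Derive_n g k x.
Proof.
  intros Hf Hg. apply (chain_Derive_n (fun k x => Derive_n f k x + Derive_n g k x)).
  intros; apply @is_derive_plus; auto.
Qed.

Lemma Derive_n_scal_smooth c f k x : smooth f ->
  Derive_n (fun y => c * f y) k x = c * Derive_n f k x.
Proof.
  intros Hf. apply (chain_Derive_n (fun k x => c * Derive_n f k x)).
  intros; apply is_derive_scal; auto.
Qed.

Lemma Derive_n_minus_smooth f g k x : smooth f -> smooth g ->
  Derive_n (fun y => f y - g y) k x = Derive_n f k x - Derive_n g k x.
Proof.
  intros Hf Hg. apply (chain_Derive_n (fun k x => Derive_n f k x - Derive_n g k x)).
  intros; apply @is_derive_minus; auto.
Qed.

Lemma trig_cont n f : trig n f -> forall x, continuous f x.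
Proof. intros; eapply smooth_cont, trig_smooth; eauto. Qed.

(** * Integrals over a period *)

Definition cont (f : R -> R) := forall x, continuous f x.

Lemma cont_const c : cont (fun _ => c).
Proof. intros x; apply continuous_const. Qed.
Lemma cont_id : cont (fun x => x).
Proof. intros x; apply continuous_id. Qed.
Lemma cont_plus f g : cont f -> cont g -> cont (fun x => f x + g x).
Proof. intros F G x; apply (continuous_plus f g); auto. Qed.
Lemma cont_minus f g : cont f -> cont g -> cont (fun x => f x - g x).
Proof. intros F G x; apply (continuous_minus f g); auto. Qed.
Lemma cont_opp f : cont f -> cont (fun x => - f x).
Proof. intros F x; apply (continuous_opp f); auto. Qed.
Lemma cont_mult f g : cont f -> cont g -> cont (fun x => f x * g x).
Proof. intros F G x; apply (continuous_mult f g); auto. Qed.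
Lemma cont_comp f g : cont f -> cont g -> cont (fun x => f (g x)).
Proof. intros F G x; apply (continuous_comp g f); auto. Qed.
Lemma cont_abs f : cont f -> cont (fun x => Rabs (f x)).
Proof. intros F x; apply (continuous_comp f Rabs); [auto|apply continuous_Rabs]. Qed.
Lemma cont_cos f : cont f -> cont (fun x => cos (f x)).
Proof. apply (cont_comp cos); intros x; apply continuous_cos. Qed.
Lemma cont_sin f : cont f -> cont (fun x => sin (f x)).
Proof. apply (cont_comp sin); intros x; apply continuous_sin. Qed.
Lemma cont_pow f n : cont f -> cont (fun x => f x ^ n).
Proof. intros F; induction n; simpl; [apply cont_const|now apply cont_mult]. Qed.
Lemma cont_div f g : cont f -> cont g -> (forall x, g x <> 0) -> cont (fun x => f x / g x).
Proof.
  intros F G N; apply cont_mult; [auto|]. intros x.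
  apply (continuous_comp g Rinv); [auto|]. apply continuous_Rinv; auto.
Qed.
Lemma cont_sm (F : nat -> R -> R) n : (forall i, cont (F i)) -> cont (fun x => sm (fun i => F i x) n).
Proof. intros H; induction n; simpl; [apply cont_const|apply cont_plus; auto]. Qed.
Lemma cont_trig n f : trig n f -> cont f.
Proof. intros H x; eapply trig_cont; eauto. Qed.

Ltac ctac := repeat match goal with
  | |- cont (fun x => x) => apply cont_id
  | |- cont (fun _ => ?c) => apply (cont_const c)
  | |- cont (fun x => @?f x + @?g x) => apply (cont_plus f g)
  | |- cont (fun x => @?f x - @?g x) => apply (cont_minus f g)
  | |- cont (fun x => - @?f x) => apply (cont_opp f)
  | |- cont (fun x => @?f x * @?g x) => apply (cont_mult f g)
  | |- cont (fun x => @?f x ^ ?n) => apply (cont_pow f n)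
  | |- cont (fun x => Rabs (@?f x)) => apply (cont_abs f)
  | |- cont (fun x => cos (@?f x)) => apply (cont_cos f)
  | |- cont (fun x => sin (@?f x)) => apply (cont_sin f)
  | |- cont (fun x => sm (fun i => @?F x i) ?n) => apply (cont_sm (fun i x => F x i)); intro
  | H : cont ?f |- cont (fun x => ?f (@?g x)) => apply (cont_comp f g H)
  | H : cont ?f |- cont ?f => exact H
  end.

(* Coquelicot leaves equalities typed in the carrier of a structure, which [ring] and [field] do not see as [R]. *)
Ltac eqR := match goal with |- ?a = ?b => change (@eq R a b) end.

Definition Ip (f : R -> R) : R := RInt f (- PI) PI.

Lemma cont_ex_RInt f a b : cont f -> ex_RInt f a b.
Proof. intros H; apply (ex_RInt_continuous (V := R_CompleteNormedModule)); intros; apply H. Qed.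

Lemma Ip_ext f g : (forall x, f x = g x) -> Ip f = Ip g.
Proof. intros H; apply RInt_ext; auto. Qed.

Lemma Ip_plus f g : cont f -> cont g -> Ip (fun x => f x + g x) = Ip f + Ip g.
Proof. intros; apply (RInt_plus (V := R_CompleteNormedModule)); now apply cont_ex_RInt. Qed.

Lemma Ip_minus f g : cont f -> cont g -> Ip (fun x => f x - g x) = Ip f - Ip g.
Proof. intros; apply (RInt_minus (V := R_CompleteNormedModule)); now apply cont_ex_RInt. Qed.

Lemma Ip_scal c f : cont f -> Ip (fun x => c * f x) = c * Ip f.
Proof. intros; apply (RInt_scal (V := R_CompleteNormedModule)); now apply cont_ex_RInt. Qed.

Lemma Ip_const c : Ip (fun _ => c) = 2 * PI * c.
Proof. unfold Ip; rewrite RInt_const. unfold scal; simpl; unfold mult; simpl; ring. Qed.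

Lemma Ip_sm (F : nat -> R -> R) n : (forall i, cont (F i)) ->
  Ip (fun x => sm (fun i => F i x) n) = sm (fun i => Ip (F i)) n.
Proof.
  intros H; induction n; simpl; [rewrite Ip_const; ring|].
  rewrite Ip_plus, IHn; auto. now apply cont_sm.
Qed.

Lemma Ip_le f g : cont f -> cont g -> (forall x, f x <= g x) -> Ip f <= Ip g.
Proof.
  intros; apply RInt_le; auto using cont_ex_RInt. generalize PI_RGT_0; lra.
Qed.

Lemma Ip_abs f : cont f -> Rabs (Ip f) <= Ip (fun x => Rabs (f x)).
Proof.
  intros; apply abs_RInt_le; auto using cont_ex_RInt. generalize PI_RGT_0; lra.
Qed.

Lemma Ip_nonneg f : cont f -> (forall x, 0 <= f x) -> 0 <= Ip f.
Proof.
  intros C H. replace 0 with (Ip (fun _ => 0)) by (rewrite Ip_const; ring).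
  apply Ip_le; auto. apply cont_const.
Qed.

Lemma Ip_diff_le f g e : cont f -> cont g -> (forall x, Rabs (f x - g x) <= e) ->
  Rabs (Ip f - Ip g) <= 2 * PI * e.
Proof.
  intros F G H. rewrite <- Ip_minus by auto.
  eapply Rle_trans; [apply (Ip_abs (fun x => f x - g x)); ctac|]. rewrite <- Ip_const.
  apply Ip_le; ctac; exact H.
Qed.

Lemma Ip_shift f a : cont f -> (forall x, f (x + 2 * PI) = f x) -> Ip (fun x => f (x + a)) = Ip f.
Proof.
  intros C P. unfold Ip.
  assert (E : forall c d u, RInt (fun x => f (x + u)) c d = RInt f (c + u) (d + u)).
  { intros c d u. replace (c + u) with (1 * c + u) by ring. replace (d + u) with (1 * d + u) by ring.
    rewrite <- (RInt_comp_lin (V := R_CompleteNormedModule)) by now apply cont_ex_RInt.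
    apply RInt_ext; intros x _. unfold scal; simpl; unfold mult; simpl. rewrite !Rmult_1_l. easy. }
  rewrite E.
  rewrite <- (RInt_Chasles (V := R_CompleteNormedModule) f (- PI + a) (- PI)) by now apply cont_ex_RInt.
  rewrite <- (RInt_Chasles (V := R_CompleteNormedModule) f (- PI) PI (PI + a)) by now apply cont_ex_RInt.
  assert (Q : RInt f PI (PI + a) = RInt f (- PI) (- PI + a)).
  { replace PI with (- PI + 2 * PI) at 1 by ring. replace (PI + a) with (- PI + a + 2 * PI) by ring.
    rewrite <- E. apply RInt_ext; intros; apply P. }
  rewrite Q. rewrite <- (opp_RInt_swap f (- PI) (- PI + a)) by now apply cont_ex_RInt.
  unfold plus, opp; simpl. ring.
Qed.

Lemma Ip_reflect f : cont f -> Ip (fun x => f (- x)) = Ip f.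
Proof.
  intros C. assert (C' : cont (fun x => f (- x))) by (ctac).
  assert (E : Ip (fun y => -1 * f (- y)) = RInt f (- - PI) (- PI)).
  { apply (RInt_comp (V := R_CompleteNormedModule) f Ropp (fun _ => -1) (- PI) PI); [auto|].
    intros x _; split; [auto_derive; [easy|ring]|apply cont_const]. }
  rewrite Ip_scal, Ropp_involutive in E by auto.
  rewrite <- (opp_RInt_swap f (- PI) PI) in E by now apply cont_ex_RInt.
  unfold opp in E; simpl in E. fold (Ip f) in E. lra.
Qed.

Lemma Ip_flip f t : cont f -> (forall x, f (x + 2 * PI) = f x) -> Ip (fun v => f (t - v)) = Ip f.
Proof.
  intros C P. rewrite <- (Ip_shift f t) by auto.
  rewrite <- (Ip_reflect (fun x => f (x + t))).
  - apply Ip_ext; intros; f_equal; ring.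
  - ctac.
Qed.

Lemma Ip_cos (z : Z) al : Ip (fun v => cos (al + IZR z * v)) = if Z.eq_dec z 0 then 2 * PI * cos al else 0.
Proof.
  destruct (Z.eq_dec z 0) as [-> | N].
  - rewrite <- Ip_const. apply Ip_ext; intros; f_equal; ring.
  - assert (N' : IZR z <> 0) by (now apply IZR_neq).
    unfold Ip. apply is_RInt_unique.
    replace 0 with (minus (sin (al + IZR z * PI) / IZR z) (sin (al + IZR z * - PI) / IZR z)).
    + apply (is_RInt_derive (fun v => sin (al + IZR z * v) / IZR z)).
      * intros; auto_derive; [easy|field; auto].
      * intros x _; revert x. apply cont_cos; ctac.
    + assert (Z0 : sin (IZR z * PI) = 0) by (apply sin_eq_0_1; now exists z).
      replace (al + IZR z * - PI) with (al - IZR z * PI) by ring.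
      unfold minus, plus, opp; simpl. rewrite sin_plus, sin_minus, Z0. field; auto.
Qed.

Lemma Ip_cos_nat k l al : Ip (fun v => cos (al + (INR k - INR l) * v)) = if Nat.eq_dec k l then 2 * PI * cos al else 0.
Proof.
  rewrite (Ip_ext _ (fun v => cos (al + IZR (Z.of_nat k - Z.of_nat l) * v))).
  - rewrite Ip_cos. destruct (Z.eq_dec _ _), (Nat.eq_dec _ _); try lia; easy.
  - intros; now rewrite minus_IZR, <- !INR_IZR_INZ.
Qed.

Lemma Ip_cos_nat2 k l al : Ip (fun v => cos (al + (INR k + INR l) * v)) =
  if Nat.eq_dec (k + l) 0 then 2 * PI * cos al else 0.
Proof.
  rewrite <- (Ip_cos_nat (k + l) 0 al). apply Ip_ext; intros; rewrite plus_INR; simpl; f_equal; ring.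
Qed.

Lemma Ip_coscos k l al be : Ip (fun v => cos (INR k * v + al) * cos (INR l * v + be)) =
  if Nat.eq_dec k l then (if Nat.eq_dec k 0 then 2 * PI * cos al * cos be else PI * cos (al - be)) else 0.
Proof.
  rewrite (Ip_ext _ (fun v => / 2 * (cos (al - be + (INR k - INR l) * v) + cos (al + be + (INR k + INR l) * v)))).
  - rewrite Ip_scal, Ip_plus, Ip_cos_nat, Ip_cos_nat2 by ctac.
    destruct (Nat.eq_dec k l), (Nat.eq_dec k 0), (Nat.eq_dec (k + l) 0); subst; try lia; try field.
    rewrite cos_plus, cos_minus; field.
  - intros v.
    replace (al - be + (INR k - INR l) * v) with ((INR k * v + al) - (INR l * v + be)) by ring.
    replace (al + be + (INR k + INR l) * v) with ((INR k * v + al) + (INR l * v + be)) by ring.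
    rewrite (cos_plus (INR k * v + al) (INR l * v + be)), cos_minus; field.
Qed.

Lemma sin_as_cos x : sin x = cos (x + - (PI / 2)).
Proof. rewrite <- cos_neg. replace (- (x + - (PI / 2))) with (PI / 2 - x) by ring. now rewrite cos_shift. Qed.

Lemma Ip_orth m n al G : trig m G -> (m < n)%nat -> Ip (fun v => G v * cos (INR n * v + al)) = 0.
Proof.
  intros H L; induction H as [u [k [Hk Hu]]| |u v Hu IHu Hv IHv|c u Hu IHu|u v Hu IHu E].
  - assert (K : exists be, forall v, u v = cos (INR k * v + be)).
    { destruct Hu as [-> | ->]; [exists 0; intros; f_equal; ring|].
      exists (- (PI / 2)); intros; apply sin_as_cos. }
    destruct K as [be K]. rewrite (Ip_ext _ (fun v => cos (INR k * v + be) * cos (INR n * v + al))).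
    + rewrite Ip_coscos. destruct (Nat.eq_dec k n); [lia|easy].
    + intros; now rewrite K.
  - rewrite (Ip_ext _ (fun _ => 0)); [rewrite Ip_const; ring|intros; ring].
  - apply cont_trig in Hu, Hv.
    rewrite (Ip_ext _ (fun x => u x * cos (INR n * x + al) + v x * cos (INR n * x + al))).
    + rewrite Ip_plus, IHu, IHv; [ring|ctac..].
    + intros; ring.
  - apply cont_trig in Hu.
    rewrite (Ip_ext _ (fun x => c * (u x * cos (INR n * x + al)))).
    + rewrite Ip_scal, IHu; [ring|ctac].
    + intros; ring.
  - rewrite <- IHu. apply Ip_ext; intros; now rewrite E.
Qed.

Lemma conv_trig n G h : trig n G -> cont h -> trig n (fun t => Ip (fun v => h v * G (t - v))).
Proof.
  intros H C; induction H as [u [k [Hk Hu]]| |u v Hu IHu Hv IHv|c u Hu IHu|u v Hu IHu E].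
  - assert (A := trig_cos k n Hk). assert (B := trig_sin k n Hk).
    destruct Hu as [-> | ->].
    + eapply span_ext; [apply (span_plus _ _ _ (span_scal _ (Ip (fun v => h v * cos (INR k * v))) _ A)
        (span_scal _ (Ip (fun v => h v * sin (INR k * v))) _ B))|].
      intros t; simpl. rewrite (Rmult_comm _ (cos _)), (Rmult_comm _ (sin (_ * t))).
      rewrite <- !Ip_scal, <- Ip_plus by ctac. apply Ip_ext; intros v.
      rewrite Rmult_minus_distr_l, cos_minus; ring.
    + eapply span_ext; [apply (span_minus _ _ _ (span_scal _ (Ip (fun v => h v * cos (INR k * v))) _ B)
        (span_scal _ (Ip (fun v => h v * sin (INR k * v))) _ A))|].
      intros t; simpl. rewrite (Rmult_comm _ (cos _)), (Rmult_comm _ (sin (_ * t))).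
      rewrite <- !Ip_scal, <- Ip_minus by ctac. apply Ip_ext; intros v.
      rewrite Rmult_minus_distr_l, sin_minus; ring.
  - eapply span_ext; [apply span_zero|]. intros; simpl.
    rewrite (Ip_ext _ (fun _ => 0)); [rewrite Ip_const; ring|intros; ring].
  - eapply span_ext; [apply (span_plus _ _ _ IHu IHv)|]. intros t; simpl.
    apply cont_trig in Hu, Hv. rewrite <- Ip_plus.
    + apply Ip_ext; intros; ring.
    + ctac.
    + ctac.
  - eapply span_ext; [apply (span_scal _ c _ IHu)|]. intros t; simpl.
    apply cont_trig in Hu. rewrite <- Ip_scal.
    + apply Ip_ext; intros; ring.
    + ctac.
  - eapply span_ext; [apply IHu|]. intros t; simpl. apply Ip_ext; intros; now rewrite E.
Qed.

(** * The Favard constants and a smooth sign function *)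

Lemma odd_INR v : INR (2 * v + 1) = 2 * INR v + 1.
Proof. rewrite plus_INR, mult_INR; simpl; ring. Qed.

Lemma odd_ge1 v : 1 <= INR (2 * v + 1).
Proof. rewrite odd_INR; generalize (pos_INR v); lra. Qed.

Lemma abs_pm1 n : Rabs ((-1) ^ n) = 1.
Proof. apply pow_1_abs. Qed.

Lemma Kr_term_0 r : Kr_term r 0 = 1.
Proof. unfold Kr_term. simpl (0 * _)%nat. simpl (2 * 0 + 1)%nat. simpl INR. rewrite pow1. simpl; field. Qed.

Lemma Kr_term_bound r v : (1 <= r)%nat -> Rabs (Kr_term r v) <= / INR (2 * v + 1) ^ 2.
Proof.
  intros Hr. unfold Kr_term. assert (H := odd_ge1 v).
  unfold Rdiv. rewrite Rabs_mult, abs_pm1, Rmult_1_l, Rabs_inv, Rabs_pos_eq by (apply pow_le; lra).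
  apply Rinv_le_contravar; [apply pow_lt; lra|]. apply Rle_pow; [auto|lia].
Qed.

(** Comparison with a telescoping sum, since [(2 y + 1) ^ 2 >= y (y + 1)]. *)
Lemma inv_sq_tail V n : (1 <= V)%nat ->
  sm (fun i => / INR (2 * (V + i) + 1) ^ 2) n <= / INR V - / INR (V + n).
Proof.
  intros HV. induction n; [simpl; rewrite Nat.add_0_r; lra|].
  cbn [sm]. eapply Rle_trans; [apply Rplus_le_compat_r, IHn|].
  rewrite odd_INR, Nat.add_succ_r, S_INR.
  assert (H : 1 <= INR (V + n)) by (apply (le_INR 1); lia).
  set (y := INR (V + n)) in *.
  assert (E : / y - / (y + 1) = / (y * (y + 1))) by (field; lra).
  assert (/ (2 * y + 1) ^ 2 <= / (y * (y + 1))); [|lra].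
  apply Rinv_le_contravar; nra.
Qed.

Lemma inv_sq_tail' V n : (1 <= V)%nat ->
  sm (fun i => / INR (2 * (V + i) + 1) ^ 2) n <= / INR V.
Proof.
  intros HV. eapply Rle_trans; [now apply inv_sq_tail|].
  assert (0 < / INR (V + n)); [|lra]. apply Rinv_0_lt_compat, lt_0_INR; lia.
Qed.

Lemma Kr_partial_dist r V n : (1 <= r)%nat -> (1 <= V)%nat ->
  Rabs (sm (Kr_term r) (V + n) - sm (Kr_term r) V) <= / INR V.
Proof.
  intros Hr HV. rewrite sm_add.
  replace (_ + _ - _) with (sm (fun i => Kr_term r (V + i)) n) by ring.
  eapply Rle_trans; [apply sm_abs|]. eapply Rle_trans; [|apply (inv_sq_tail' V n HV)].
  apply sm_le; intros; now apply Kr_term_bound.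
Qed.

Lemma inv_INR_small e : 0 < e -> exists V, (1 <= V)%nat /\ / INR V < e.
Proof.
  intros He. destruct (archimed_cor1 e He) as [V [H1 H2]]. exists V; split; [lia|auto].
Qed.

(** The [epsilon] in [Kr] says something only once a sum is known to exist; this follows from the
    Cauchy criterion with the tail bound [/ INR V]. *)
Lemma Kr_spec r : (1 <= r)%nat -> infinite_sum (Kr_term r) (Kr r * PI / 4).
Proof.
  intros Hr.
  assert (EX : exists l, infinite_sum (Kr_term r) l).
  { destruct (Rcomplete.R_complete (sum_f_R0 (Kr_term r))) as [l Hl].
    - intros e He. destruct (inv_INR_small (e / 2) ltac:(lra)) as [V [HV He2]].
      exists V; intros n m Hn Hm. unfold Rdist. rewrite !sm_f_R0.
      assert (A1 := Kr_partial_dist r V (S n - V) Hr HV).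
      assert (A2 := Kr_partial_dist r V (S m - V) Hr HV).
      replace (V + (S n - V))%nat with (S n) in A1 by lia.
      replace (V + (S m - V))%nat with (S m) in A2 by lia.
      apply Rabs_def1; apply Rabs_le_between in A1, A2; lra.
    - exists l. intros e He. destruct (Hl e He) as [N HN]. exists N; intros; apply HN; auto. }
  unfold Kr.
  replace (4 / PI * epsilon (inhabits 0) (fun l => infinite_sum (Kr_term r) l) * PI / 4)
    with (epsilon (inhabits 0) (fun l => infinite_sum (Kr_term r) l)).
  - apply epsilon_spec, EX.
  - field. apply PI_neq0.
Qed.

Lemma Kr_approx r V : (1 <= r)%nat -> (1 <= V)%nat ->
  Rabs (Kr r * PI / 4 - sm (Kr_term r) V) <= / INR V.
Proof.
  intros Hr HV. apply le_epsilon; intros e He.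
  destruct (Kr_spec r Hr e He) as [N HN].
  specialize (HN (V + N)%nat ltac:(lia)). unfold Rdist in HN. rewrite sm_f_R0 in HN.
  assert (A1 := Kr_partial_dist r V (S N) Hr HV). rewrite Nat.add_succ_r in A1.
  apply Rabs_le; apply Rabs_le_between in A1; apply Rabs_def2 in HN; lra.
Qed.

Section Square.
Variable x : R.
Let c := cos x.

(** Abel means of the Fourier series of [PI / 4] times the sign of [cos x], truncated after [V]
    terms. The full series sums to half of [atan (2 s cos x / (1 - s ^ 2))]. *)
Definition sgn_part (s : R) (V : nat) : R :=
  sm (fun v => (-1) ^ v * (s ^ (2 * v + 1) / INR (2 * v + 1)) * cos (INR (2 * v + 1) * x)) V.

Let Z (s : R) (V : nat) : R := sm (fun v => (-1) ^ v * s ^ (2 * v) * cos (INR (2 * v + 1) * x)) V.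

Lemma sgn_part_derive V s : is_derive (fun s => sgn_part s V) s (Z s V).
Proof.
  unfold sgn_part, Z. induction V; cbn [sm].
  - apply @is_derive_const.
  - apply @is_derive_plus; [auto|]. clear IHV.
    replace (2 * V + 1)%nat with (S (2 * V)) by lia.
    assert (H : INR (S (2 * V)) <> 0) by (apply not_0_INR; lia).
    generalize dependent (2 * V)%nat. intros n H. set (k := INR (S n)) in *.
    apply (is_derive_ext (fun s => (-1) ^ V * cos (k * x) / k * s ^ (S n))).
    + intros t. eqR. field; exact H.
    + eapply is_derive_val; [apply is_derive_scal, is_derive_pow, @is_derive_id|].
      change (Init.Nat.pred (S n)) with n. fold k. unfold one; simpl. field. exact H.
Qed.

(** A geometric sum of ratio [- s ^ 2 e^(2 i x)] in real form; the factor on the left is the squared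
    modulus of [1 + s ^ 2 e^(2 i x)]. *)
Lemma sgn_part_closed V s : ((1 - s ^ 2) ^ 2 + 4 * s ^ 2 * c ^ 2) * Z s V =
  c * (1 + s ^ 2) - (- s ^ 2) ^ V * (cos ((2 * INR V + 1) * x) + s ^ 2 * cos ((2 * INR V - 1) * x)).
Proof.
  unfold Z. induction V.
  - cbn [sm]. simpl INR. replace ((2 * 0 - 1) * x) with (- ((2 * 0 + 1) * x)) by ring. rewrite cos_neg.
    replace ((2 * 0 + 1) * x) with x by ring. unfold c; ring.
  - cbn [sm]. rewrite Rmult_plus_distr_l, IHV, odd_INR, S_INR.
    replace ((2 * (INR V + 1) + 1) * x) with ((2 * INR V + 1) * x + 2 * x) by ring.
    replace ((2 * (INR V + 1) - 1) * x) with ((2 * INR V + 1) * x) by ring.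
    replace ((2 * INR V - 1) * x) with ((2 * INR V + 1) * x - 2 * x) by ring.
    rewrite cos_plus, cos_minus, cos_2a_cos. fold c.
    replace ((- s ^ 2) ^ S V) with (- s ^ 2 * (- s ^ 2) ^ V) by (simpl; ring).
    replace ((-1) ^ V * s ^ (2 * V)) with ((- s ^ 2) ^ V).
    2:{ rewrite pow_mult, <- Rpow_mult_distr. f_equal; ring. }
    ring.
Qed.

(** The mean value theorem is applied in the Abel parameter, not in [x]: both functions vanish at 0,
    and their derivatives differ by the remainder of a geometric sum. *)
Lemma sgn_part_atan V s : 0 < s < 1 ->
  Rabs (sgn_part s V - / 2 * atan (2 * s * c / (1 - s ^ 2))) <= 2 * s ^ (2 * V) / (1 - s ^ 2) ^ 2.
Proof.
  intros [H0 H1].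
  set (f := fun s => sgn_part s V - / 2 * atan (2 * s * c / (1 - s ^ 2))).
  set (df := fun s => Z s V - c * (1 + s ^ 2) / ((1 - s ^ 2) ^ 2 + 4 * s ^ 2 * c ^ 2)).
  assert (D : forall t, 0 <= t <= s -> is_derive f t (df t)).
  { intros t Ht. unfold f, df. apply @is_derive_minus; [apply sgn_part_derive|].
    assert (t ^ 2 < 1) by nra.
    auto_derive; [nra|]. assert ((1 - t ^ 2) ^ 2 > 0) by (apply pow_lt; lra).
    assert (0 <= t ^ 2 * c ^ 2) by (apply Rmult_le_pos; apply pow2_ge_0).
    rewrite !Rmult_1_r. unfold Rsqr. field. repeat split; simpl in *; nra. }
  assert (Hs2 : s ^ 2 < 1) by nra.
  assert (B : forall t, 0 <= t <= s -> Rabs (df t) <= 2 * s ^ (2 * V) / (1 - s ^ 2) ^ 2).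
  { intros t Ht. assert (Ht2 : t ^ 2 <= s ^ 2) by nra.
    assert (P1 : (1 - s ^ 2) ^ 2 <= (1 - t ^ 2) ^ 2) by (apply pow_incr; lra).
    assert (P2 : 0 < (1 - s ^ 2) ^ 2) by (apply pow_lt; lra).
    assert (P3 : 0 <= t ^ 2 * c ^ 2) by (apply Rmult_le_pos; apply pow2_ge_0).
    set (D0 := (1 - t ^ 2) ^ 2 + 4 * t ^ 2 * c ^ 2) in *.
    assert (P4 : (1 - s ^ 2) ^ 2 <= D0) by (unfold D0; lra).
    assert (E : df t = - ((- t ^ 2) ^ V * (cos ((2 * INR V + 1) * x) + t ^ 2 * cos ((2 * INR V - 1) * x))) / D0).
    { unfold df. fold D0. assert (E := sgn_part_closed V t). fold D0 in E.
      replace (Z t V) with (D0 * Z t V / D0) by (field; lra). rewrite E. field; lra. }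
    rewrite E. unfold Rdiv. rewrite Rabs_mult, Rabs_Ropp, Rabs_inv, Rabs_mult, (Rabs_pos_eq D0) by lra.
    apply Rmult_le_compat.
    - apply Rmult_le_pos; apply Rabs_pos.
    - left; apply Rinv_0_lt_compat; lra.
    - rewrite (Rmult_comm 2 (s ^ (2 * V))). apply Rmult_le_compat; [apply Rabs_pos..| |].
      + rewrite <- RPow_abs, Rabs_Ropp, Rabs_pos_eq by (apply pow2_ge_0).
        rewrite pow_mult. apply pow_incr; split; [apply pow2_ge_0|auto].
      + assert (C1 := COS_bound ((2 * INR V + 1) * x)). assert (C2 := COS_bound ((2 * INR V - 1) * x)).
        assert (0 <= t ^ 2 <= 1) by (split; [apply pow2_ge_0|lra]).
        apply Rabs_le; nra.
    - apply Rinv_le_contravar; lra. }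
  destruct (MVT_gen f 0 s df) as [xi [Hxi E]].
  - intros t Ht; apply D. rewrite Rmin_left, Rmax_right in Ht by lra. lra.
  - intros t Ht; rewrite Rmin_left, Rmax_right in Ht by lra.
    apply derivable_continuous_pt. exists (df t). apply is_derive_Reals, D; lra.
  - rewrite Rmin_left, Rmax_right in Hxi by lra.
    assert (F0 : f 0 = 0).
    { unfold f, sgn_part. rewrite sm_zero.
      - replace (2 * 0 * c / (1 - 0 ^ 2)) with 0 by field. rewrite atan_0; ring.
      - intros i _. rewrite pow_i by lia. field. generalize (odd_ge1 i); lra. }
    fold (f s). rewrite F0, !Rminus_0_r in E. rewrite E, Rabs_mult, (Rabs_pos_eq s) by lra.
    assert (B' := B xi Hxi). assert (0 <= Rabs (df xi)) by apply Rabs_pos. nra.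
Qed.
End Square.

Lemma atan_abs_bound y : Rabs (atan y) <= PI / 2.
Proof. apply Rabs_le. generalize (atan_bound y); lra. Qed.

Lemma atan_le_id z : 0 < z -> atan z <= z.
Proof.
  intros Hz. destruct (MVT_gen atan 0 z (fun t => / (1 + t ^ 2))) as [xi [Hxi E]].
  - intros; auto_derive; [easy|unfold Rsqr; field; nra].
  - intros; apply derivable_continuous_pt, derivable_pt_atan.
  - rewrite atan_0, !Rminus_0_r in E. rewrite E.
    assert (/ (1 + xi ^ 2) <= / 1) by (apply Rinv_le_contravar; [lra|generalize (pow2_ge_0 xi); lra]).
    rewrite Rinv_1 in H. nra.
Qed.

(** The arctangent does not approach the sign uniformly near 0, but the factor [y] makes the bound
    uniform: [PI / 2 - atan z = atan (/ z) <= / z] for positive [z]. *)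
Lemma atan_sgn_bound k y : 0 < k -> Rabs y * (PI / 2) - y * atan (k * y) <= / k.
Proof.
  intros Hk. assert (K : forall y, 0 <= y -> y * (PI / 2) - y * atan (k * y) <= / k).
  { clear y. intros y [Hy | <-].
    - assert (0 < k * y) by nra.
      assert (A := atan_inv (k * y) H).
      assert (atan (/ (k * y)) <= / (k * y)) by (apply atan_le_id, Rinv_0_lt_compat, H).
      replace (y * (PI / 2) - y * atan (k * y)) with (y * (PI / 2 - atan (k * y))) by ring.
      replace (PI / 2 - atan (k * y)) with (atan (/ (k * y))) by lra.
      apply Rle_trans with (y * / (k * y)); [apply Rmult_le_compat_l; lra|].
      right; field; split; lra.
    - assert (0 < / k) by now apply Rinv_0_lt_compat. lra. }
  destruct (Rle_dec 0 y) as [Hy | Hy].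
  - rewrite Rabs_pos_eq by auto. now apply K.
  - rewrite Rabs_left by lra. specialize (K (- y) ltac:(lra)).
    replace (k * - y) with (- (k * y)) in K by ring. rewrite atan_opp in K. lra.
Qed.

(** For [s = 1] this is a Fourier partial sum of the sign of [cos x]; suitable weights [s] remove
    its overshoot. *)
Definition sgn_trig (s : nat -> R) (V : nat) (x : R) : R :=
  4 / PI * sm (fun v => (-1) ^ v * (s v / INR (2 * v + 1)) * cos (INR (2 * v + 1) * x)) V.

Lemma pow_cv_0 s e : 0 <= s < 1 -> 0 < e -> exists N, forall n, (N <= n)%nat -> s ^ n < e.
Proof.
  intros Hs He. destruct (pow_lt_1_zero s (ltac:(rewrite Rabs_pos_eq; lra)) e He) as [N HN].
  exists N; intros n Hn. specialize (HN n Hn). rewrite Rabs_pos_eq in HN; [auto|apply pow_le; lra].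
Qed.

Lemma bernoulli_le d n : 0 <= d <= 1 -> 1 - INR n * d <= (1 - d) ^ n.
Proof.
  intros Hd. induction n; [simpl; lra|]. rewrite S_INR. simpl pow.
  destruct (Rle_dec 0 (1 - INR n * d)).
  - apply Rle_trans with ((1 - d) * (1 - INR n * d)); [|apply Rmult_le_compat_l; lra].
    generalize (pos_INR n); nra.
  - assert (0 <= (1 - d) * (1 - d) ^ n) by (apply Rmult_le_pos; [|apply pow_le]; lra). lra.
Qed.

Lemma PI_gt3 : 3 < PI.
Proof. generalize PI2_3_2; lra. Qed.

Lemma four_over_PI : 0 < 4 / PI <= 2.
Proof. assert (P3 := PI_gt3). split; [apply Rdiv_lt_0_compat; lra|]. apply Rle_div_l; lra. Qed.

(** The weights depend on [e] only. The last clause, valid for all [r] at once, splits the series at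
    [V0]: below it the weights are close to 1, above it the tail of the inverse odd squares is
    small. *)
Lemma sgn_approx e : 0 < e -> exists V s,
  (forall v, 0 <= s v <= 1) /\
  (forall x, Rabs (sgn_trig s V x) <= 1) /\
  (forall x, Rabs (cos x) <= cos x * sgn_trig s V x + e) /\
  (forall r, (1 <= r)%nat -> Rabs (Kr r * PI / 4 - sm (fun v => Kr_term r v * s v) V) <= e).
Proof.
  intros He.
  destruct (inv_INR_small (e / 4) ltac:(lra)) as [V0 [HV0 HV0e]].
  assert (P0 : 1 <= INR V0) by (apply (le_INR 1); auto).
  set (d := Rmin (/ 4) (Rmin (e / 8) (e / (8 * INR V0)))).
  assert (Hd : 0 < d <= / 4 /\ d <= e / 8 /\ INR V0 * d <= e / 8).
  { assert (0 < e / (8 * INR V0)) by (apply Rdiv_lt_0_compat; lra).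
    unfold d; repeat split.
    - apply Rmin_glb_lt; [lra|apply Rmin_glb_lt; lra].
    - apply Rmin_l.
    - eapply Rle_trans; [apply Rmin_r|apply Rmin_l].
    - apply Rle_trans with (INR V0 * (e / (8 * INR V0))).
      + apply Rmult_le_compat_l; [lra|]. eapply Rle_trans; [apply Rmin_r|apply Rmin_r].
      + right; field; lra. }
  destruct Hd as [[d0 d1] [d2 d3]].
  (* Close enough to 1 for two purposes: by Bernoulli the first [V0] powers stay above [1 - d], and
     the slope [k] of the arctangent is at least [/ d]. Only then is the truncation length fixed. *)
  set (q := 1 - d / (2 * INR V0)).
  assert (Hq0 : 0 < d / (2 * INR V0) <= d / 2).
  { split; [apply Rdiv_lt_0_compat; lra|].
    apply Rmult_le_compat_l; [lra|apply Rinv_le_contravar; lra]. }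
  assert (Hq : / 2 < q < 1) by (unfold q; lra).
  assert (HqV : 1 - d <= q ^ (2 * V0)).
  { eapply Rle_trans; [|apply bernoulli_le; lra]. rewrite mult_INR.
    replace (INR 2) with 2 by (simpl; ring). right; field; lra. }
  assert (Hq2 : 0 < 1 - q ^ 2) by nra.
  assert (Hq4 : 0 < (1 - q ^ 2) ^ 2) by (apply pow_lt; lra).
  set (k := 2 * q / (1 - q ^ 2)).
  assert (Hk : 0 < k) by (apply Rdiv_lt_0_compat; lra).
  assert (Hk' : / k <= d).
  { unfold k. rewrite Rinv_div. apply Rle_div_l; [lra|]. unfold q in *. set (y := d / (2 * INR V0)) in *. nra. }
  destruct (pow_cv_0 (q * q) (d * (1 - q ^ 2) ^ 2 / 4) ltac:(nra)) as [N HN].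
  { assert (0 < d * (1 - q ^ 2) ^ 2) by nra. lra. }
  set (V := (V0 + N)%nat).
  assert (HV : forall x, Rabs (sgn_part x q V - / 2 * atan (k * cos x)) <= d / 2).
  { intros x. eapply Rle_trans; [|].
    - replace (k * cos x) with (2 * q * cos x / (1 - q ^ 2)) by (unfold k; field; lra).
      apply sgn_part_atan; lra.
    - apply Rle_div_l; [lra|]. rewrite pow_mult. replace (q ^ 2) with (q * q) at 1 by ring.
      specialize (HN V ltac:(unfold V; lia)). lra. }
  (* The truncated sum may exceed 1 by at most [d]; this factor restores the bound 1. *)
  set (lam := / (1 + d)).
  assert (Hlam : 0 < lam <= 1 /\ lam * (1 + d) = 1).
  { unfold lam; split; [split|field; lra]. { apply Rinv_0_lt_compat; lra. }
    rewrite <- Rinv_1 at 2. apply Rinv_le_contravar; lra. }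
  destruct Hlam as [Hl1 Hl2]. assert (Hl3 : 1 - d <= lam) by nra.
  assert (P3 := PI_gt3).
  assert (P4 := four_over_PI).
  assert (S0 : forall v, 0 < q ^ (2 * v + 1) <= 1).
  { intros v; split; [apply pow_lt; lra|]. rewrite <- (pow1 (2 * v + 1)). apply pow_incr; lra. }
  assert (E : forall x, sgn_trig (fun v => lam * q ^ (2 * v + 1)) V x = lam * (4 / PI * sgn_part x q V)).
  { intros x. unfold sgn_trig, sgn_part. rewrite (Rmult_comm lam), Rmult_assoc. f_equal.
    rewrite (Rmult_comm _ lam), <- sm_scal. apply sm_ext; intros. unfold Rdiv; ring. }
  assert (A : forall x, 4 / PI * (/ 2 * atan (k * cos x)) = 2 / PI * atan (k * cos x)).
  { intros; field; lra. }
  exists V, (fun v => lam * q ^ (2 * v + 1)); repeat split.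
  - specialize (S0 v); nra.
  - specialize (S0 v); nra.
  - intros x. rewrite E, Rabs_mult, (Rabs_pos_eq lam) by lra.
    rewrite <- Hl2. apply Rmult_le_compat_l; [lra|].
    specialize (HV x). assert (B := atan_abs_bound (k * cos x)).
    rewrite Rabs_mult, (Rabs_pos_eq (4 / PI)) by lra.
    apply Rle_trans with (4 / PI * (/ 2 * (PI / 2) + d / 2)).
    + apply Rmult_le_compat_l; [lra|].
      apply Rabs_le_between in HV, B. apply Rabs_le; lra.
    + apply Rle_trans with (1 + 4 / PI * (d / 2)); [right; field; lra|nra].
  - intros x. rewrite E.
    assert (B := atan_sgn_bound k (cos x) Hk). specialize (HV x).
    assert (C1 := COS_bound x).
    assert (Q : Rabs (cos x) - 2 * d <= cos x * (4 / PI * sgn_part x q V)).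
    { set (w := sgn_part x q V - / 2 * atan (k * cos x)) in *.
      replace (sgn_part x q V) with (/ 2 * atan (k * cos x) + w) by (unfold w; ring).
      rewrite Rmult_plus_distr_l, A.
      assert (4 / PI * w * cos x >= - d).
      { assert (Rabs (4 / PI * w * cos x) <= 2 * (d / 2) * 1).
        { rewrite !Rabs_mult, (Rabs_pos_eq (4 / PI)) by lra.
          apply Rmult_le_compat; [apply Rmult_le_pos; [lra|apply Rabs_pos]|apply Rabs_pos| |apply Rabs_le; lra].
          apply Rmult_le_compat; [lra|apply Rabs_pos|lra|auto]. }
        apply Rabs_le_between in H. lra. }
      assert (Rabs (cos x) - cos x * (2 / PI * atan (k * cos x)) <= d).
      { replace (Rabs (cos x) - cos x * (2 / PI * atan (k * cos x)))
          with (2 / PI * (Rabs (cos x) * (PI / 2) - cos x * atan (k * cos x))) by (field; lra).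
        assert (0 < 2 / PI <= 1) by (split; [apply Rdiv_lt_0_compat; lra|apply Rle_div_l; lra]).
        assert (0 < / k) by (now apply Rinv_0_lt_compat). nra. }
      nra. }
    assert (Rabs (cos x) <= 1) by (apply Rabs_le; lra).
    assert (0 <= Rabs (cos x)) by apply Rabs_pos.
    replace (cos x * (lam * (4 / PI * sgn_part x q V))) with (lam * (cos x * (4 / PI * sgn_part x q V))) by ring.
    assert (lam * (Rabs (cos x) - 2 * d) <= lam * (cos x * (4 / PI * sgn_part x q V))) by (apply Rmult_le_compat_l; lra).
    nra.
  - intros r Hr.
    assert (K1 := Kr_approx r V Hr ltac:(unfold V; lia)).
    assert (K2 : Rabs (sm (Kr_term r) V - sm (fun v => Kr_term r v * (lam * q ^ (2 * v + 1))) V) <= e / 4 + / INR V0).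
    { rewrite <- sm_minus, (sm_ext _ (fun v => Kr_term r v * (1 - lam * q ^ (2 * v + 1)))) by (intros; ring).
      eapply Rle_trans; [apply sm_abs|].
      assert (T : forall v, Rabs (Kr_term r v * (1 - lam * q ^ (2 * v + 1))) <= / INR (2 * v + 1) ^ 2 * (1 - lam * q ^ (2 * v + 1))).
      { intros v. rewrite Rabs_mult, (Rabs_pos_eq (1 - _)) by (specialize (S0 v); nra).
        apply Rmult_le_compat_r; [specialize (S0 v); nra|now apply Kr_term_bound]. }
      assert (I0 : forall v, 0 < / INR (2 * v + 1) ^ 2 <= 1).
      { intros v. assert (O := odd_ge1 v). split; [apply Rinv_0_lt_compat, pow_lt; lra|].
        rewrite <- Rinv_1. apply Rinv_le_contravar; [lra|]. apply pow_R1_Rle; auto. }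
      unfold V. rewrite sm_add. apply Rplus_le_compat.
      - apply Rle_trans with (sm (fun _ => 2 * d) V0); [|rewrite sm_const; lra].
        apply sm_le; intros v Hv. eapply Rle_trans; [apply T|].
        assert (q ^ (2 * V0) <= q ^ (2 * v + 1)).
        { replace (2 * V0)%nat with ((2 * v + 1) + (2 * V0 - (2 * v + 1)))%nat by lia.
          rewrite pow_add. specialize (S0 v).
          assert (0 < q ^ (2 * V0 - (2 * v + 1)) <= 1); [|nra].
          split; [apply pow_lt; lra|]. rewrite <- (pow1 (2 * V0 - (2 * v + 1))). apply pow_incr; lra. }
        assert (1 - lam * q ^ (2 * v + 1) <= 2 * d) by nra.
        specialize (I0 v). specialize (S0 v). nra.
      - eapply Rle_trans; [|apply (inv_sq_tail' V0 N HV0)].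
        apply sm_le; intros i Hi. eapply Rle_trans; [apply T|].
        specialize (I0 (V0 + i)%nat). specialize (S0 (V0 + i)%nat).
        rewrite <- (Rmult_1_r (/ INR (2 * (V0 + i) + 1) ^ 2)) at 2. apply Rmult_le_compat_l; nra. }
    assert (/ INR V <= / INR V0).
    { apply Rinv_le_contravar; [lra|]. apply le_INR; unfold V; lia. }
    apply Rabs_le_between in K1, K2. apply Rabs_le; lra.
Qed.

(** * Kernels of geometric sequences *)

Section Kernel.
Variables (q al : R).
Hypothesis Hq : 0 < q < 1.

Definition den (q x : R) : R := 1 - 2 * q * cos x + q ^ 2.
(** Closed form of the series of [q ^ k cos (k x + al)]; [den q x] is the squared modulus of
    [1 - q e^(i x)]. The phases [0] and [- PI / 2] give the cosine and the sine kernel. *)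
Definition ker (q al x : R) : R := (cos al - q * cos (al - x)) / den q x.
Definition ker_sum (q al : R) (L : nat) (x : R) : R := sm (fun k => q ^ k * cos (INR k * x + al)) L.

Lemma den_lower x : (1 - q) ^ 2 <= den q x.
Proof. unfold den. generalize (COS_bound x); nra. Qed.

Lemma den_pos x : 0 < den q x.
Proof. apply Rlt_le_trans with ((1 - q) ^ 2); [apply pow_lt; lra|apply den_lower]. Qed.

Lemma den_sum z L x : den z x * sm (fun k => z ^ k * cos (INR k * x + al)) L =
  cos al - z * cos (al - x) - z ^ L * cos (INR L * x + al) + z ^ S L * cos ((INR L - 1) * x + al).
Proof.
  unfold den. induction L.
  - cbn [sm]. simpl INR. replace ((0 - 1) * x + al) with (al - x) by ring.
    rewrite Rmult_0_l, Rplus_0_l. simpl; ring.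
  - cbn [sm]. rewrite Rmult_plus_distr_l, IHL, S_INR.
    replace ((INR L + 1) * x + al) with (INR L * x + al + x) by ring.
    replace ((INR L + 1 - 1) * x + al) with (INR L * x + al) by ring.
    replace ((INR L - 1) * x + al) with (INR L * x + al - x) by ring.
    rewrite (cos_plus (INR L * x + al) x), (cos_minus (INR L * x + al) x). simpl pow. ring.
Qed.

Lemma den_sum_rev L M x : (L <= M)%nat ->
  den q x * sm (fun k => q ^ (M - k) * cos (INR k * x + al)) L =
  q ^ M * (q ^ 2 * cos al - q * cos (al - x)) - q ^ (M - L) * (q ^ 2 * cos (INR L * x + al) - q * cos ((INR L - 1) * x + al)).
Proof.
  intros HL. unfold den. induction L.
  - cbn [sm]. simpl INR. replace ((0 - 1) * x + al) with (al - x) by ring.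
    rewrite Rmult_0_l, Rplus_0_l, Nat.sub_0_r. simpl; ring.
  - cbn [sm]. rewrite Rmult_plus_distr_l, IHL, S_INR by lia.
    replace (M - L)%nat with (S (M - S L)) by lia.
    replace ((INR L + 1) * x + al) with (INR L * x + al + x) by ring.
    replace ((INR L + 1 - 1) * x + al) with (INR L * x + al) by ring.
    replace ((INR L - 1) * x + al) with (INR L * x + al - x) by ring.
    rewrite (cos_plus (INR L * x + al) x), (cos_minus (INR L * x + al) x). simpl pow. ring.
Qed.

Lemma ker_sum_dist L x : Rabs (ker q al x - ker_sum q al L x) <= q ^ L * (2 / (1 - q) ^ 2).
Proof.
  assert (D0 := den_pos x). assert (D1 := den_lower x).
  assert (Q0 : 0 < (1 - q) ^ 2) by (apply pow_lt; lra).
  assert (Q1 : 0 < q ^ L) by (apply pow_lt; lra).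
  assert (E : ker q al x - ker_sum q al L x =
     q ^ L * (cos (INR L * x + al) - q * cos ((INR L - 1) * x + al)) / den q x).
  { unfold ker, ker_sum.
    replace (sm _ L) with (den q x * sm (fun k => q ^ k * cos (INR k * x + al)) L / den q x) by (field; lra).
    rewrite den_sum. simpl pow. field; lra. }
  rewrite E. unfold Rdiv. rewrite !Rabs_mult, Rabs_inv, (Rabs_pos_eq (q ^ L)), (Rabs_pos_eq (den q x)) by lra.
  rewrite Rmult_assoc. apply Rmult_le_compat_l; [lra|].
  apply Rmult_le_compat; [apply Rabs_pos|left; now apply Rinv_0_lt_compat| |apply Rinv_le_contravar; lra].
  generalize (COS_bound (INR L * x + al)) (COS_bound ((INR L - 1) * x + al)); intros.
  apply Rabs_le; nra.
Qed.

Lemma cont_den : cont (den q).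
Proof. unfold den. ctac. Qed.

Lemma cont_ker : cont (ker q al).
Proof. apply cont_div; [ctac|apply cont_den|intros x; generalize (den_pos x); lra]. Qed.

Lemma cont_ker_sum L : cont (ker_sum q al L).
Proof. unfold ker_sum. ctac. Qed.

Lemma ker_periodic x : ker q al (x + 2 * PI) = ker q al x.
Proof.
  unfold ker, den.
  replace (al - (x + 2 * PI)) with (- (x - al + 2 * INR 1 * PI)) by (simpl; ring).
  rewrite cos_neg, cos_period. replace (x + 2 * PI) with (x + 2 * INR 1 * PI) by (simpl; ring).
  rewrite cos_period, <- (cos_neg (x - al)). now rewrite Ropp_minus_distr.
Qed.

Lemma limit_eq a b c : (exists N, forall L, (N <= L)%nat -> Rabs (a - b) <= q ^ L * c) -> a = b.
Proof.
  intros [N HN]. destruct (Req_dec a b) as [|Hn]; [auto|exfalso].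
  assert (0 < Rabs (a - b)) by (apply Rabs_pos_lt; lra).
  destruct (Rle_dec c 0) as [Hc | Hc].
  - specialize (HN N (le_n N)). assert (0 < q ^ N) by (apply pow_lt; lra). nra.
  - destruct (pow_cv_0 q (Rabs (a - b) / c)) as [N' HN']; [lra|apply Rdiv_lt_0_compat; lra|].
    specialize (HN (N + N')%nat ltac:(lia)). specialize (HN' (N + N')%nat ltac:(lia)).
    apply Rlt_div_r in HN'; lra.
Qed.

(** Convolution with the kernel multiplies frequency [k] by [q ^ k] and shifts its phase. A partial
    sum with more than [k] terms gives this value exactly, and its distance to the kernel tends to 0
    uniformly. *)
Lemma conv_ker k t : Ip (fun v => cos (INR k * v) * ker q al (t - v)) =
  if Nat.eq_dec k 0 then 2 * PI * cos al else PI * q ^ k * cos (INR k * t + al).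
Proof.
  apply limit_eq with (2 * PI * (2 / (1 - q) ^ 2)).
  exists (S k); intros L HL.
  assert (E : Ip (fun v => cos (INR k * v) * ker_sum q al L (t - v)) =
     if Nat.eq_dec k 0 then 2 * PI * cos al else PI * q ^ k * cos (INR k * t + al)).
  { unfold ker_sum.
    rewrite (Ip_ext _ (fun v => sm (fun l => q ^ l * (cos (INR k * v + 0) * cos (INR l * v + - (INR l * t + al)))) L)).
    - rewrite (Ip_sm (fun l v => q ^ l * (cos (INR k * v + 0) * cos (INR l * v + - (INR l * t + al))))) by (intros; ctac).
      set (X := if Nat.eq_dec k 0 then 2 * PI * cos al else PI * q ^ k * cos (INR k * t + al)).
      rewrite (sm_ext _ (fun l => if Nat.eq_dec k l then X else 0)).
      + revert HL; clear -X; induction L; intros HL; [lia|]. cbn [sm].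
        destruct (Nat.eq_dec k L) as [-> | Hn].
        * rewrite sm_zero; [ring|]. intros i Hi. destruct (Nat.eq_dec L i); [lia|easy].
        * rewrite IHL by lia; ring.
      + intros l Hl. rewrite Ip_scal, Ip_coscos by ctac. unfold X.
        destruct (Nat.eq_dec k l) as [-> | Hn]; [|ring].
        destruct (Nat.eq_dec l 0) as [-> | Hn'].
        * simpl INR. rewrite cos_neg, cos_0. replace (0 * t + al) with al by ring. simpl; ring.
        * replace (0 - - (INR l * t + al)) with (INR l * t + al) by ring. ring.
    - intros v. rewrite <- sm_scal. apply sm_ext; intros l _.
      rewrite Rplus_0_r. replace (INR l * (t - v) + al) with (- (INR l * v + - (INR l * t + al))) by ring.
      rewrite cos_neg; ring. }
  rewrite <- E. rewrite <- Rmult_assoc, (Rmult_comm (q ^ L)), Rmult_assoc.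
  assert (C1 := cont_ker). assert (C2 := cont_ker_sum L).
  apply Ip_diff_le; [ctac..|]. intros v. rewrite <- Rmult_minus_distr_l, Rabs_mult.
  rewrite <- (Rmult_1_l (q ^ L * _)). apply Rmult_le_compat; [apply Rabs_pos..| |apply ker_sum_dist].
  apply Rabs_le, COS_bound.
Qed.

Lemma Ip_ker_cos k be : (1 <= k)%nat -> Ip (fun x => ker q al x * cos (INR k * x + be)) = PI * q ^ k * cos (al - be).
Proof.
  intros Hk. assert (K0 : INR k <> 0) by (apply not_0_INR; lia).
  assert (C1 := cont_ker).
  rewrite <- (Ip_flip _ (- be / INR k)).
  - rewrite (Ip_ext _ (fun v => cos (INR k * v) * ker q al (- be / INR k - v))).
    + rewrite conv_ker. destruct (Nat.eq_dec k 0); [lia|]. do 2 f_equal. field; auto.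
    + intros v. rewrite Rmult_comm. f_equal. rewrite <- cos_neg. f_equal. field; auto.
  - ctac.
  - intros x. rewrite ker_periodic. f_equal.
    replace (INR k * (x + 2 * PI) + be) with (INR k * x + be + 2 * INR k * PI) by ring. apply cos_period.
Qed.

Variable M : nat.
Hypothesis HM : (1 <= M)%nat.
Hypothesis Hal : al = 0 \/ al = - (PI / 2).

(* [cos (2 * al)] is [1] for the even kernel and [-1] for the odd one. *)
Let a := / (1 + cos (2 * al) * q ^ (2 * M)).

(** The interpolant of the kernel at the zeros of [cos (M x + al)]. There frequency [2 M - k] folds
    onto [k] with sign [-1] and [2 M + k] with sign [- cos (2 al)]; summing the resulting geometric
    series gives the factor [a]. The last constant corrects frequency 0, which enters both sums. *)
Definition ker_near (x : R) : R :=
  a * (sm (fun k => q ^ k * cos (INR k * x + al)) M - sm (fun k => q ^ (2 * M - k) * cos (INR k * x + al)) M)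
  + (1 - a * (1 - q ^ (2 * M))) / 2.

Definition ker_phi (x : R) : R := a * ((1 - q ^ 2) * q ^ M) / den q x.

Lemma cos_2al : cos (2 * al) = 1 /\ cos al = 1 \/ cos (2 * al) = -1 /\ cos al = 0.
Proof.
  destruct Hal as [-> | ->]; [left|right].
  - rewrite Rmult_0_r, cos_0; auto.
  - replace (2 * - (PI / 2)) with (- PI) by field. rewrite !cos_neg, cos_PI, cos_PI2; auto.
Qed.

Lemma ker_a_pos : 0 < a.
Proof.
  assert (0 < q ^ (2 * M) < 1).
  { split; [apply pow_lt; lra|]. apply pow_lt_1_compat; [lra|lia]. }
  apply Rinv_0_lt_compat. destruct cos_2al as [[-> _] | [-> _]]; lra.
Qed.

(** Since [ker_phi] is positive, the error changes sign exactly with [cos (M x + al)], which is the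
    criterion for best approximation in the mean. The identity is checked after multiplication by
    [den q x], which turns both finite sums into boundary terms. *)
Lemma ker_split x : ker q al x = ker_near x + cos (INR M * x + al) * ker_phi x.
Proof.
  assert (H : 0 < q ^ (2 * M) < 1).
  { split; [apply pow_lt; lra|]. apply pow_lt_1_compat; [lra|lia]. }
  assert (D0 := den_pos x).
  apply Rmult_eq_reg_l with (den q x); [|lra].
  unfold ker, ker_phi, ker_near.
  rewrite !(Rmult_plus_distr_l (den q x)).
  replace (den q x * ((cos al - q * cos (al - x)) / den q x)) with (cos al - q * cos (al - x)) by (field; lra).
  replace (den q x * (cos (INR M * x + al) * (a * ((1 - q ^ 2) * q ^ M) / den q x)))
    with (cos (INR M * x + al) * (a * ((1 - q ^ 2) * q ^ M))) by (field; lra).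
  match goal with |- _ = ?A + ?B + ?C => replace A with
    (a * (den q x * sm (fun k => q ^ k * cos (INR k * x + al)) M - den q x * sm (fun k => q ^ (2 * M - k) * cos (INR k * x + al)) M)) by ring end.
  rewrite den_sum, den_sum_rev by lia. replace (2 * M - M)%nat with M by lia.
  unfold den, a. replace (q ^ (2 * M)) with (q ^ M * q ^ M) in * by (rewrite <- pow_add; f_equal; lia).
  set (Q := q ^ M) in *.
  simpl pow. destruct Hal as [E | E].
  - rewrite E, Rmult_0_r, cos_0 in *. replace (0 - x) with (- x) by ring. rewrite cos_neg.
    fold Q. field. nra.
  - destruct cos_2al as [[_ C1] | [C2 C1]].
    + rewrite E, cos_neg, cos_PI2 in C1; lra.
    + rewrite C1, C2. fold Q. field. nra.
Qed.

Lemma trig_phase k n : (k <= n)%nat -> trig n (fun x => cos (INR k * x + al)).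
Proof.
  intros Hk. eapply span_ext; [apply (span_minus _ _ _ (span_scal _ (cos al) _ (trig_cos k n Hk))
    (span_scal _ (sin al) _ (trig_sin k n Hk)))|]. intros; simpl. rewrite cos_plus; ring.
Qed.

Lemma ker_near_trig : trig (M - 1) ker_near.
Proof.
  unfold ker_near. apply span_plus; [|apply trig_const].
  apply span_scal, span_minus;
    apply (span_sm _ (fun k x => _ * cos (INR k * x + al))); intros; apply span_scal, trig_phase; lia.
Qed.

Lemma ker_phi_pos x : 0 < ker_phi x.
Proof.
  unfold ker_phi. assert (A0 := ker_a_pos). assert (0 < q ^ M) by (apply pow_lt; lra).
  apply Rdiv_lt_0_compat; [|apply den_pos]. assert (0 < 1 - q ^ 2) by nra.
  apply Rmult_lt_0_compat; [auto|nra].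
Qed.

Lemma cont_ker_phi : cont ker_phi.
Proof. apply cont_div; [ctac|apply cont_den|intros x; generalize (den_pos x); lra]. Qed.

Definition good_sgn (s : nat -> R) V e :=
  (forall v, 0 <= s v <= 1) /\
  (forall x, Rabs (sgn_trig s V x) <= 1) /\ (forall x, Rabs (cos x) <= cos x * sgn_trig s V x + e).

(** The modulus of the error is the error times its sign, and the sign is replaced by [sgn_trig] at
    [M x + al] at the cost [e]. Only the frequencies [(2 v + 1) M] occur in that polynomial; they
    are orthogonal to [ker_near], of degree below [M], so only Fourier coefficients of the kernel
    itself survive. *)
Lemma ker_L1 s V e : good_sgn s V e ->
  Ip (fun x => Rabs (cos (INR M * x + al) * ker_phi x)) <=
  4 * sm (fun v => (-1) ^ v * cos (2 * INR v * al) * s v * q ^ ((2 * v + 1) * M) / INR (2 * v + 1)) V + e * Ip ker_phi.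
Proof.
  intros [Hs [_ HS]].
  assert (CN := cont_trig _ _ ker_near_trig). assert (CP := cont_ker_phi). assert (CK := cont_ker).
  assert (CS : cont (sgn_trig s V)) by (unfold sgn_trig; ctac).
  rewrite <- Ip_scal by auto.
  assert (E : Ip (fun x => cos (INR M * x + al) * ker_phi x * sgn_trig s V (INR M * x + al)) =
    4 * sm (fun v => (-1) ^ v * cos (2 * INR v * al) * s v * q ^ ((2 * v + 1) * M) / INR (2 * v + 1)) V).
  { rewrite (Ip_ext _ (fun x => sm (fun v => 4 / PI * ((-1) ^ v * (s v / INR (2 * v + 1))) *
       (ker q al x * cos (INR ((2 * v + 1) * M) * x + INR (2 * v + 1) * al)
        - ker_near x * cos (INR ((2 * v + 1) * M) * x + INR (2 * v + 1) * al))) V)).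
    - rewrite (Ip_sm (fun v x => 4 / PI * ((-1) ^ v * (s v / INR (2 * v + 1))) *
       (ker q al x * cos (INR ((2 * v + 1) * M) * x + INR (2 * v + 1) * al)
        - ker_near x * cos (INR ((2 * v + 1) * M) * x + INR (2 * v + 1) * al)))) by (intros; ctac).
      rewrite <- sm_scal. apply sm_ext; intros v _.
      rewrite Ip_scal, Ip_minus, Ip_ker_cos by (ctac || nia).
      rewrite (Ip_orth (M - 1) ((2 * v + 1) * M)) by (apply ker_near_trig || nia).
      replace (al - INR (2 * v + 1) * al) with (- (2 * INR v * al)) by (rewrite odd_INR; ring).
      rewrite cos_neg. field. generalize PI_neq0 (odd_ge1 v); intros; split; lra.
    - intros x. unfold sgn_trig. rewrite <- !sm_scal. apply sm_ext; intros v _.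
      rewrite (ker_split x). replace (INR ((2 * v + 1) * M) * x + INR (2 * v + 1) * al)
        with (INR (2 * v + 1) * (INR M * x + al)) by (rewrite (mult_INR _ M); ring). ring. }
  rewrite <- E, <- Ip_plus by ctac.
  apply Ip_le; [ctac..|]. intros x. rewrite Rabs_mult, (Rabs_pos_eq (ker_phi x)) by (generalize (ker_phi_pos x); lra).
  specialize (HS (INR M * x + al)). generalize (ker_phi_pos x); intros.
  replace (_ + e * ker_phi x) with ((cos (INR M * x + al) * sgn_trig s V (INR M * x + al) + e) * ker_phi x) by ring.
  apply Rmult_le_compat_r; lra.
Qed.
End Kernel.

(** * The Favard theorem *)

Section Favard.
Variables (al : R) (M K : nat) (a : nat -> R).
Hypothesis HM : (1 <= M)%nat.
Hypothesis Hal : al = 0 \/ al = - (PI / 2).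
Let h (t : R) : R := a 0%nat + sm (fun k => a (S k) * cos (INR (S k) * t)) K.
Hypothesis Hh : forall t, Rabs (h t) <= 1.

Definition favard_sum (m : nat -> R) (s : nat -> R) (V : nat) : R :=
  4 / PI * sm (fun v => (-1) ^ v * cos (2 * INR v * al) * s v * m ((2 * v + 1) * M)%nat / INR (2 * v + 1)) V.

Let target (m : nat -> R) (t : R) : R := sm (fun k => a (S k) * m (S k) * cos (INR (S k) * t + al)) K.

(** [T] and [B] are fixed before the approximate sign. The bound is then linear in [m], so it passes
    to the cone, and the accuracy [e] can be adapted to [B] at the end. *)
Definition favard_for (m : nat -> R) : Prop := exists T B, trig (M - 1) T /\ 0 <= B /\
  forall t s V e, 0 <= e -> good_sgn s V e -> Rabs (target m t - T t) <= favard_sum m s V + e * B.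

Lemma favard_geom q : 0 < q < 1 -> favard_for (fun k => q ^ k).
Proof.
  intros Hq. assert (P3 := PI_gt3).
  assert (TN := ker_near_trig q al M HM).
  assert (CN := cont_trig _ _ TN). assert (CP := cont_ker_phi q al Hq M). assert (CK := cont_ker q al Hq).
  assert (Ch : cont h) by (unfold h; ctac).
  (* The convolution also reproduces the mean [a 0] of [h], which [target] omits; the subtracted
     constant removes it. *)
  exists (fun t => / PI * Ip (fun v => h v * ker_near q al M (t - v)) - 2 * a 0%nat * cos al),
    (/ PI * Ip (ker_phi q al M)).
  repeat split.
  - apply span_minus; [|apply trig_const]. apply span_scal, conv_trig; auto.
  - apply Rmult_le_pos; [left; apply Rinv_0_lt_compat; lra|].
    apply Ip_nonneg; [auto|]. intros; left; now apply ker_phi_pos.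
  - intros t s V e He Hs.
    assert (E : Ip (fun v => h v * ker q al (t - v)) = PI * (2 * a 0%nat * cos al + target (fun k => q ^ k) t)).
    { rewrite (Ip_ext _ (fun v => a 0%nat * (cos (INR 0 * v) * ker q al (t - v)) +
        sm (fun k => a (S k) * (cos (INR (S k) * v) * ker q al (t - v))) K)).
      - rewrite Ip_plus, Ip_scal by ctac.
        rewrite (Ip_sm (fun k v => a (S k) * (cos (INR (S k) * v) * ker q al (t - v)))) by (intros; ctac).
        rewrite conv_ker by auto. cbn [Nat.eq_dec]. unfold target. rewrite Rmult_plus_distr_l, <- sm_scal.
        f_equal; [simpl; ring|]. apply sm_ext; intros k _. rewrite Ip_scal, conv_ker by (auto || ctac).
        destruct (Nat.eq_dec (S k) 0); [lia|]. ring.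
      - intros v. unfold h. rewrite Rmult_plus_distr_r. f_equal.
        + simpl INR. rewrite Rmult_0_l, cos_0; ring.
        + rewrite (Rmult_comm _ (ker q al (t - v))), <- sm_scal. apply sm_ext; intros; ring. }
    set (Er := fun x => cos (INR M * x + al) * ker_phi q al M x).
    assert (CE : cont Er) by (unfold Er; ctac).
    assert (E2 : target (fun k => q ^ k) t - (/ PI * Ip (fun v => h v * ker_near q al M (t - v)) - 2 * a 0%nat * cos al)
       = / PI * Ip (fun v => h v * Er (t - v))).
    { rewrite (Ip_ext (fun v => h v * Er (t - v)) (fun v => h v * ker q al (t - v) - h v * ker_near q al M (t - v))).
      - rewrite Ip_minus, E by ctac. field; lra.
      - intros v. rewrite (ker_split q al Hq M HM Hal). unfold Er; ring. }
    rewrite E2, Rabs_mult, Rabs_pos_eq by (left; apply Rinv_0_lt_compat; lra).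
    assert (PE : forall x, Er (x + 2 * PI) = Er x).
    { intros x. unfold Er, ker_phi, den.
      replace (INR M * (x + 2 * PI) + al) with (INR M * x + al + 2 * INR M * PI) by ring.
      replace (x + 2 * PI) with (x + 2 * INR 1 * PI) by (simpl; ring). now rewrite !cos_period. }
    assert (L : Ip (fun v => Rabs (h v * Er (t - v))) <= Ip (fun x => Rabs (Er x))).
    { rewrite <- (Ip_flip (fun x => Rabs (Er x)) t); [|ctac|intros; now rewrite PE].
      apply Ip_le; [ctac..|]. intros v. rewrite Rabs_mult.
      specialize (Hh v). generalize (Rabs_pos (Er (t - v))). nra. }
    assert (L2 := ker_L1 q al Hq M HM Hal s V e Hs). fold Er in L2.
    assert (L3 := Ip_abs (fun v => h v * Er (t - v)) ltac:(ctac)).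
    apply Rle_trans with (/ PI * (4 * sm (fun v => (-1) ^ v * cos (2 * INR v * al) * s v * q ^ ((2 * v + 1) * M) / INR (2 * v + 1)) V + e * Ip (ker_phi q al M))).
    + apply Rmult_le_compat_l; [left; apply Rinv_0_lt_compat; lra|].
      change (Ip (fun x => Rabs (cos (INR M * x + al) * ker_phi q al M x))) with (Ip (fun x => Rabs (Er x))) in L2. lra.
    + right. unfold favard_sum. field. lra.
Qed.

(* Nonnegative combinations of geometric sequences, the discrete form of completely monotone sequences. *)
Inductive geo_cone : (nat -> R) -> Prop :=
| gc_pow q : 0 < q < 1 -> geo_cone (fun k => q ^ k)
| gc_zero : geo_cone (fun _ => 0)
| gc_plus m n : geo_cone m -> geo_cone n -> geo_cone (fun k => m k + n k)
| gc_scal w m : 0 <= w -> geo_cone m -> geo_cone (fun k => w * m k)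
| gc_ext m n : geo_cone m -> (forall k, m k = n k) -> geo_cone n.

Lemma favard_cone m : geo_cone m -> favard_for m.
Proof.
  intros H; induction H as [q Hq| |m n Hm [T [B [HT [HB IHm]]]] Hn [T' [B' [HT' [HB' IHn]]]]
    |w m Hw Hm [T [B [HT [HB IHm]]]]|m n Hm [T [B [HT [HB IHm]]]] E].
  - now apply favard_geom.
  - exists (fun _ => 0), 0; repeat split; [apply trig_const|lra|].
    intros t s V e He Hs. unfold target, favard_sum. rewrite !sm_zero; [rewrite Rminus_0_r, Rabs_R0; lra| |].
    + intros; unfold Rdiv; ring.
    + intros; ring.
  - exists (fun t => T t + T' t), (B + B'); repeat split; [now apply span_plus|lra|].
    intros t s V e He Hs. specialize (IHm t s V e He Hs). specialize (IHn t s V e He Hs).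
    assert (E1 : target (fun k => m k + n k) t = target m t + target n t).
    { unfold target. rewrite <- sm_plus. apply sm_ext; intros; ring. }
    assert (E2 : favard_sum (fun k => m k + n k) s V = favard_sum m s V + favard_sum n s V).
    { unfold favard_sum. rewrite <- Rmult_plus_distr_l, <- sm_plus. f_equal. apply sm_ext; intros; unfold Rdiv; ring. }
    rewrite E1, E2. replace (target m t + target n t - (T t + T' t)) with ((target m t - T t) + (target n t - T' t)) by ring.
    eapply Rle_trans; [apply Rabs_triang|lra].
  - exists (fun t => w * T t), (w * B); repeat split; [now apply span_scal|nra|].
    intros t s V e He Hs. specialize (IHm t s V e He Hs).
    assert (E1 : target (fun k => w * m k) t = w * target m t).
    { unfold target. rewrite <- sm_scal. apply sm_ext; intros; ring. }
    assert (E2 : favard_sum (fun k => w * m k) s V = w * favard_sum m s V).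
    { unfold favard_sum. rewrite <- Rmult_assoc, (Rmult_comm w), Rmult_assoc, <- (sm_scal w). f_equal. apply sm_ext; intros; unfold Rdiv; ring. }
    rewrite E1, E2, <- Rmult_minus_distr_l, Rabs_mult, (Rabs_pos_eq w) by auto. nra.
  - exists T, B; repeat split; auto. intros t s V e He Hs. specialize (IHm t s V e He Hs).
    replace (target n t) with (target m t) by (apply sm_ext; intros; now rewrite E).
    replace (favard_sum n s V) with (favard_sum m s V); auto.
    unfold favard_sum. f_equal. apply sm_ext; intros; now rewrite E.
Qed.
End Favard.

Lemma geo_cone_mult m n : geo_cone m -> geo_cone n -> geo_cone (fun k => m k * n k).
Proof.
  intros Hm Hn; induction Hm as [q Hq| |u v Hu IHu Hv IHv|w u Hw Hu IHu|u v Hu IHu E].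
  - induction Hn as [p Hp| |u v Hu IHu Hv IHv|w u Hw Hu IHu|u v Hu IHu E].
    + eapply gc_ext; [apply (gc_pow (q * p)); nra|]. intros; simpl; apply Rpow_mult_distr.
    + eapply gc_ext; [apply gc_zero|]. intros; simpl; ring.
    + eapply gc_ext; [apply (gc_plus _ _ IHu IHv)|]. intros; simpl; ring.
    + eapply gc_ext; [apply (gc_scal w _ Hw IHu)|]. intros; simpl; ring.
    + eapply gc_ext; [apply IHu|]. intros; simpl; now rewrite E.
  - eapply gc_ext; [apply gc_zero|]. intros; simpl; ring.
  - eapply gc_ext; [apply (gc_plus _ _ IHu IHv)|]. intros; simpl; ring.
  - eapply gc_ext; [apply (gc_scal w _ Hw IHu)|]. intros; simpl; ring.
  - eapply gc_ext; [apply IHu|]. intros; simpl; now rewrite E.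
Qed.

Lemma geo_cone_sm (F : nat -> nat -> R) J : (forall j, geo_cone (F j)) -> geo_cone (fun k => sm (fun j => F j k) J).
Proof. intros H; induction J; simpl; [apply gc_zero|now apply gc_plus]. Qed.

Lemma sm_geom x J : (1 - x) * sm (fun j => x ^ S j) J = x * (1 - x ^ J).
Proof.
  induction J; [simpl; ring|]. cbn [sm]. rewrite Rmult_plus_distr_l, IHJ. simpl; ring.
Qed.

Lemma exp_pow x n : exp x ^ n = exp (INR n * x).
Proof.
  induction n; [simpl; now rewrite Rmult_0_l, exp_0|].
  rewrite S_INR. simpl pow. rewrite IHn, <- exp_plus. f_equal; ring.
Qed.

(** A truncated right-endpoint Riemann sum, of step [d = e / 2], for the integral of [exp (- k u)]
    over the half-line, whose value is [1 / k]. It is a lower sum because the integrand decreases;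
    discretization and truncation cost [d] each, uniformly in [k]. *)
Lemma geo_cone_inv e : 0 < e -> exists m, geo_cone m /\
  forall k, (1 <= k)%nat -> 0 <= m k <= / INR k /\ / INR k <= m k + e.
Proof.
  intros He. set (d := e / 2). assert (Hd : 0 < d) by (unfold d; lra).
  assert (X : 0 < exp (- d) < 1).
  { split; [apply exp_pos|]. rewrite <- exp_0. apply exp_increasing; lra. }
  destruct (pow_cv_0 (exp (- d)) d ltac:(lra) Hd) as [J HJ].
  exists (fun k => sm (fun j => d * (exp (- d) ^ S j) ^ k) J); split.
  - apply (geo_cone_sm (fun j k => d * (exp (- d) ^ S j) ^ k)). intros j. apply gc_scal; [lra|].
    apply gc_pow. split; [apply pow_lt; lra|]. apply pow_lt_1_compat; [lra|lia].
  - intros k Hk. assert (K1 : 1 <= INR k) by (apply (le_INR 1); auto).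
    set (x := exp (- d) ^ k).
    assert (E : sm (fun j => d * (exp (- d) ^ S j) ^ k) J = d * sm (fun j => x ^ S j) J).
    { rewrite sm_scal. f_equal. apply sm_ext; intros j _. unfold x. rewrite <- !pow_mult. f_equal; lia. }
    rewrite E. clear E.
    assert (Hx : 0 < x < 1). { unfold x; split; [apply pow_lt; lra|]. apply pow_lt_1_compat; [lra|lia]. }
    assert (Hx1 : 1 - INR k * d <= x).
    { unfold x. rewrite exp_pow. generalize (exp_ineq1_le (INR k * - d)). lra. }
    assert (Hx2 : x * (1 + INR k * d) <= 1).
    { unfold x. rewrite exp_pow. replace (INR k * - d) with (- (INR k * d)) by ring.
      rewrite exp_Ropp. generalize (exp_ineq1_le (INR k * d)) (exp_pos (INR k * d)); intros.
      rewrite Rmult_comm. apply Rle_div_l; lra. }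
    assert (HxJ : 0 < x ^ J < 1 /\ x ^ J <= d \/ J = 0%nat).
    { destruct (Nat.eq_dec J 0); [auto|left]. split; [split; [apply pow_lt; lra|apply pow_lt_1_compat; [lra|lia]]|].
      apply Rle_trans with (exp (- d) ^ J).
      - apply pow_incr; split; [lra|]. unfold x. replace k with (1 + (k - 1))%nat by lia. rewrite pow_add, pow_1.
        assert (0 < exp (- d) ^ (k - 1) <= 1); [|nra]. split; [apply pow_lt; lra|].
        rewrite <- (pow1 (k - 1)). apply pow_incr; lra.
      - left. apply HJ; lia. }
    assert (HJ' : 0 <= 1 - x ^ J <= 1 /\ 1 - d <= 1 - x ^ J).
    { destruct HxJ as [HxJ | ->]; [lra|]. simpl. specialize (HJ 0%nat (Nat.le_0_l _)). simpl in HJ. lra. }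
    assert (G := sm_geom x J). set (Sx := sm (fun j => x ^ S j) J) in *.
    assert (ES : Sx = x * (1 - x ^ J) / (1 - x)) by (apply Rmult_eq_reg_l with (1 - x); [rewrite G; field|]; lra).
    assert (S0 : 0 <= Sx). { rewrite ES. apply Rdiv_le_0_compat; [nra|lra]. }
    assert (I : INR k * / INR k = 1) by (field; lra).
    assert (I0 : 0 < / INR k <= 1) by (apply Rinv_bounds; lra).
    assert (B1 : d * x <= (1 - x) * / INR k).
    { apply Rmult_le_reg_l with (INR k); [lra|]. nra. }
    assert (B2 : (1 - x) * (/ INR k - d) <= d * x).
    { assert ((1 - x) * / INR k <= d); [|nra]. apply Rmult_le_reg_l with (INR k); [lra|]. nra. }
    split; [split; [nra|]|].
    + apply Rmult_le_reg_l with (1 - x); [lra|].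
      replace ((1 - x) * (d * Sx)) with (d * ((1 - x) * Sx)) by ring. rewrite G. nra.
    + replace e with (d + d) by (unfold d; field).
      apply Rmult_le_reg_l with (1 - x); [lra|].
      replace ((1 - x) * (d * Sx + (d + d))) with (d * ((1 - x) * Sx) + (1 - x) * (d + d)) by ring. rewrite G.
      assert (d * x * (1 - d) <= d * (x * (1 - x ^ J))).
      { replace (d * (x * (1 - x ^ J))) with (d * x * (1 - x ^ J)) by ring. apply Rmult_le_compat_l; [nra|lra]. }
      assert (d * x * d <= (1 - x) * d); [|nra].
      assert (d * x <= 1 - x); [|nra]. nra.
Qed.

Lemma geo_cone_inv_pow r e : (1 <= r)%nat -> 0 < e -> exists m, geo_cone m /\
  forall k, (1 <= k)%nat -> 0 <= m k <= / INR k ^ r /\ / INR k ^ r <= m k + e.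
Proof.
  intros Hr. revert e; induction r as [|r IH]; [lia|]. intros e He.
  destruct (Nat.eq_dec r 0) as [-> | Hr0].
  - destruct (geo_cone_inv e He) as [m [Hm H]]. exists m; split; [auto|]. intros k Hk. rewrite pow_1. auto.
  - destruct (geo_cone_inv (e / 2) ltac:(lra)) as [m [Hm H]].
    destruct (IH ltac:(lia) (e / 2) ltac:(lra)) as [n [Hn H']].
    exists (fun k => m k * n k); split; [now apply geo_cone_mult|].
    intros k Hk. specialize (H k Hk). specialize (H' k Hk).
    assert (K1 : 1 <= INR k) by (apply (le_INR 1); auto).
    assert (I0 : 0 < / INR k <= 1) by (apply Rinv_bounds; lra).
    assert (I1 : 0 < / INR k ^ r <= 1).
    { split; [apply Rinv_0_lt_compat, pow_lt; lra|]. rewrite <- Rinv_1. apply Rinv_le_contravar; [lra|]. now apply pow_R1_Rle. }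
    replace (/ INR k ^ S r) with (/ INR k * / INR k ^ r).
    + split; [split|]; nra.
    + simpl. rewrite Rinv_mult. ring.
Qed.

Lemma cos_minus_kPI x k : cos (x - INR k * PI) = (-1) ^ k * cos x.
Proof.
  induction k; [simpl; rewrite Rmult_0_l, Rminus_0_r; ring|].
  rewrite S_INR. replace (x - (INR k + 1) * PI) with (x - INR k * PI - PI) by ring.
  rewrite cos_minus, cos_PI, sin_PI, IHk. simpl; ring.
Qed.

Lemma pow_m1_even k : (-1) ^ (2 * k) = 1.
Proof. rewrite pow_mult. replace ((-1) ^ 2) with 1 by ring. apply pow1. Qed.

(** The [r]-th antiderivative of a cosine is, up to sign, a cosine or a sine according to the parity
    of [r]. In both cases the signs produced by [ker_L1] are those in the definition of
    [Kr_term]. *)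
Lemma phase_cases r : exists al sg, (al = 0 \/ al = - (PI / 2)) /\ (sg = 1 \/ sg = -1) /\
  (forall x, cos (x - INR r * (PI / 2)) = sg * cos (x + al)) /\
  (forall v, (-1) ^ v * cos (2 * INR v * al) = (-1) ^ (v * (r + 1))).
Proof.
  assert (PM : forall k, (-1) ^ k = 1 \/ (-1) ^ k = -1).
  { induction k as [|k [IH | IH]]; simpl; [auto|rewrite IH; right; ring|rewrite IH; left; ring]. }
  destruct (Nat.Even_or_Odd r) as [[k ->] | [k ->]].
  - exists 0, ((-1) ^ k); repeat split; auto.
    + intros x. replace (INR (2 * k) * (PI / 2)) with (INR k * PI) by (rewrite mult_INR; simpl; field).
      now rewrite cos_minus_kPI, Rplus_0_r.
    + intros v. rewrite Rmult_0_r, cos_0.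
      replace (v * (2 * k + 1))%nat with (v + 2 * (k * v))%nat by lia. rewrite pow_add, pow_m1_even; ring.
  - exists (- (PI / 2)), ((-1) ^ k); repeat split; auto.
    + intros x. replace (x - INR (2 * k + 1) * (PI / 2)) with (x + - (PI / 2) - INR k * PI).
      * now rewrite cos_minus_kPI.
      * rewrite odd_INR; field.
    + intros v. replace (2 * INR v * - (PI / 2)) with (0 - INR v * PI) by field.
      rewrite cos_minus_kPI, cos_0. replace (v * (2 * k + 1 + 1))%nat with (2 * (v * (k + 1)))%nat by lia.
      rewrite pow_m1_even, Rmult_1_r, <- pow_add. replace (v + v)%nat with (2 * v)%nat by lia. apply pow_m1_even.
Qed.

(** The accuracy [e] is uniform in [k] but would add up over long sums. From [V0] on it is therefore
    replaced by the summable bound that follows from [0 <= m k <= / INR k ^ r]. *)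
Lemma cone_term_dist r M m e v V0 : (1 <= r)%nat -> (1 <= M)%nat -> 0 < e -> (1 <= V0)%nat ->
  (forall k, (1 <= k)%nat -> 0 <= m k <= / INR k ^ r /\ / INR k ^ r <= m k + e) ->
  Rabs (m ((2 * v + 1) * M)%nat - / INR ((2 * v + 1) * M) ^ r) / INR (2 * v + 1) <=
  if le_lt_dec V0 v then / INR (2 * v + 1) ^ 2 else e.
Proof.
  intros Hr HM He HV Hm. specialize (Hm ((2 * v + 1) * M)%nat ltac:(nia)).
  assert (O := odd_ge1 v). assert (M1 : 1 <= INR M) by (apply (le_INR 1); auto).
  assert (I0 : 0 < / INR (2 * v + 1) <= 1) by (apply Rinv_bounds; lra).
  unfold Rdiv. rewrite Rabs_left1 by lra.
  destruct (le_lt_dec V0 v).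
  - apply Rle_trans with (/ INR (2 * v + 1) * / INR (2 * v + 1)); [|right; field; lra].
    apply Rmult_le_compat_r; [lra|].
    apply Rle_trans with (/ INR ((2 * v + 1) * M) ^ r); [lra|].
    apply Rinv_le_contravar; [lra|]. rewrite mult_INR.
    apply Rle_trans with (INR (2 * v + 1) * 1); [lra|].
    apply Rle_trans with ((INR (2 * v + 1) * INR M) ^ 1); [rewrite pow_1; apply Rmult_le_compat_l; lra|].
    apply Rle_pow; [nra|auto].
  - nra.
Qed.

Lemma favard r M K a e : (1 <= r)%nat -> (1 <= M)%nat -> 0 < e ->
  (forall t, Rabs (a 0%nat + sm (fun k => a (S k) * cos (INR (S k) * t)) K) <= 1) ->
  exists T, trig (M - 1) T /\ forall t,
    Rabs (sm (fun k => a (S k) / INR (S k) ^ r * cos (INR (S k) * t - INR r * (PI / 2))) K - T t) <= Kr r / INR M ^ r + e.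
Proof.
  intros Hr HM He Hh.
  destruct (phase_cases r) as [al [sg [Hal [Hsg [Hcos Hsign]]]]].
  set (A := sm (fun k => Rabs (a (S k))) K).
  assert (HA : 0 <= A) by (apply sm_nonneg; intros; apply Rabs_pos).
  destruct (inv_INR_small (e / 10) ltac:(lra)) as [V0 [HV0 HV0e]].
  assert (P0 : 1 <= INR V0) by (apply (le_INR 1); auto).
  (* The accuracy of the cone sequence is multiplied by [A] in the target and by the number [V0] of
     initial terms in the Favard sum. *)
  set (e2 := e / (10 * (A + INR V0))).
  assert (He2 : 0 < e2) by (apply Rdiv_lt_0_compat; lra).
  assert (He2' : e2 * (A + INR V0) = e / 10) by (unfold e2; field; lra).
  destruct (geo_cone_inv_pow r e2 Hr He2) as [m [Hm Hmk]].
  destruct (favard_cone al M K a HM Hal Hh m Hm) as [T [B [HT [HB HTB]]]].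
  exists (fun t => sg * T t); split; [now apply span_scal|].
  (* [B] comes with the cone sequence, so the approximate sign must be chosen last. *)
  set (e3 := e / (10 * (1 + B))).
  assert (He3 : 0 < e3) by (apply Rdiv_lt_0_compat; lra).
  assert (He3' : e3 * (1 + B) = e / 10) by (unfold e3; field; lra).
  destruct (sgn_approx e3 He3) as [V [s [Hs1 [Hs2 [Hs3 HsK]]]]]. specialize (HsK r Hr).
  assert (M1 : 1 <= INR M) by (apply (le_INR 1); auto).
  assert (Mr : 1 <= INR M ^ r) by (now apply pow_R1_Rle).
  assert (P3 := PI_gt3).
  assert (P4 := four_over_PI).
  assert (FS : favard_sum al M m s V <= Kr r / INR M ^ r + 2 * (e3 + (INR V0 * e2 + / INR V0))).
  { assert (D : Rabs (sm (fun v => (-1) ^ v * cos (2 * INR v * al) * s v * m ((2 * v + 1) * M)%nat / INR (2 * v + 1)) V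
        - / INR M ^ r * sm (fun v => Kr_term r v * s v) V) <= INR V0 * e2 + / INR V0).
    { rewrite <- sm_scal.
      rewrite <- sm_minus.
      eapply Rle_trans; [apply sm_abs|].
      apply Rle_trans with (sm (fun v => if le_lt_dec V0 v then / INR (2 * v + 1) ^ 2 else e2) (V0 + V)).
      - rewrite Nat.add_comm, sm_add.
        match goal with |- ?x <= ?y + ?z => assert (0 <= z) end.
        { apply sm_nonneg; intros i _. destruct (le_lt_dec V0 (V + i)); [|lra].
          left; apply Rinv_0_lt_compat, pow_lt. generalize (odd_ge1 (V + i)); lra. }
        match goal with |- ?x <= ?y + ?z => assert (x <= y); [|lra] end.
        apply sm_le; intros v _.
        eapply Rle_trans; [|apply (cone_term_dist r M m e2 v V0); auto].
        assert (O := odd_ge1 v).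
        replace ((-1) ^ v * cos (2 * INR v * al) * s v * m ((2 * v + 1) * M)%nat / INR (2 * v + 1) -
            / INR M ^ r * (Kr_term r v * s v))
          with ((-1) ^ (v * (r + 1)) * s v * ((m ((2 * v + 1) * M)%nat - / INR ((2 * v + 1) * M) ^ r) / INR (2 * v + 1))).
        + unfold Rdiv. rewrite !Rabs_mult, Rabs_inv, abs_pm1, (Rabs_pos_eq (INR (2 * v + 1))) by lra.
          specialize (Hs1 v). rewrite (Rabs_pos_eq (s v)) by lra.
          match goal with |- _ <= ?X => assert (0 <= X) end.
          { apply Rmult_le_pos; [apply Rabs_pos|left; apply Rinv_0_lt_compat; lra]. }
          nra.
        + rewrite Hsign. unfold Kr_term. rewrite mult_INR, Rpow_mult_distr, (pow_add _ r 1), pow_1.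
          field. repeat split; try lra; apply pow_nonzero; lra.
      - rewrite sm_add. apply Rplus_le_compat.
        + rewrite <- (sm_const e2 V0). apply sm_le; intros i Hi. destruct (le_lt_dec V0 i); [lia|lra].
        + eapply Rle_trans; [|apply (inv_sq_tail' V0 V HV0)]. apply sm_le; intros i Hi.
          destruct (le_lt_dec V0 (V0 + i)); [lra|lia]. }
    unfold favard_sum.
    set (X := sm (fun v => (-1) ^ v * cos (2 * INR v * al) * s v * m ((2 * v + 1) * M)%nat / INR (2 * v + 1)) V) in *.
    set (Y := sm (fun v => Kr_term r v * s v) V) in *.
    replace (Kr r / INR M ^ r) with (4 / PI * (/ INR M ^ r * (Kr r * PI / 4))) by (field; lra).
    apply Rabs_le_between in D, HsK.
    assert (I0 : 0 < / INR M ^ r <= 1) by (apply Rinv_bounds; lra).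
    assert (/ INR M ^ r * Y <= / INR M ^ r * (Kr r * PI / 4) + e3).
    { apply Rle_trans with (/ INR M ^ r * (Kr r * PI / 4 + e3)); [apply Rmult_le_compat_l; lra|]. nra. }
    assert (0 < / INR V0) by (apply Rinv_0_lt_compat; lra).
    apply Rle_trans with (4 / PI * (/ INR M ^ r * (Kr r * PI / 4) + (e3 + (INR V0 * e2 + / INR V0)))).
    - apply Rmult_le_compat_l; lra.
    - rewrite Rmult_plus_distr_l. apply Rplus_le_compat_l. apply Rmult_le_compat_r; [|lra]. nra. }
  intros t. specialize (HTB t s V e3 ltac:(lra) (conj Hs1 (conj Hs2 Hs3))).
  set (tg := sm (fun k => a (S k) * m (S k) * cos (INR (S k) * t + al)) K) in *.
  assert (E : Rabs (sm (fun k => a (S k) / INR (S k) ^ r * cos (INR (S k) * t - INR r * (PI / 2))) K - sg * tg) <= A * e2).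
  { unfold tg. rewrite <- sm_scal.
    rewrite <- sm_minus.
    eapply Rle_trans; [apply sm_abs|]. rewrite (Rmult_comm A). unfold A. rewrite <- sm_scal. apply sm_le; intros k _.
    rewrite Hcos. specialize (Hmk (S k) ltac:(lia)).
    replace (a (S k) / INR (S k) ^ r * (sg * cos (INR (S k) * t + al)) - sg * (a (S k) * m (S k) * cos (INR (S k) * t + al)))
      with (sg * cos (INR (S k) * t + al) * (a (S k) * (/ INR (S k) ^ r - m (S k)))) by (unfold Rdiv; ring).
    rewrite !Rabs_mult. assert (Rabs sg = 1) by (destruct Hsg as [-> | ->]; [apply Rabs_R1|rewrite Rabs_left; lra]).
    assert (Rabs (cos (INR (S k) * t + al)) <= 1) by (apply Rabs_le, COS_bound).
    rewrite H, Rmult_1_l, (Rabs_pos_eq (/ INR (S k) ^ r - m (S k))) by lra.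
    generalize (Rabs_pos (a (S k))) (Rabs_pos (cos (INR (S k) * t + al))); intros.
    apply Rle_trans with (1 * (e2 * Rabs (a (S k)))); [|lra].
    apply Rmult_le_compat; [auto|apply Rmult_le_pos; lra|auto|nra]. }
  assert (E' : Rabs (sg * tg - sg * T t) <= Kr r / INR M ^ r + 2 * (e3 + (INR V0 * e2 + / INR V0)) + e3 * B).
  { rewrite <- Rmult_minus_distr_l, Rabs_mult.
    assert (Rabs sg = 1) by (destruct Hsg as [-> | ->]; [apply Rabs_R1|rewrite Rabs_left; lra]).
    rewrite H, Rmult_1_l. lra. }
  assert (0 <= e2 * A) by nra. assert (0 <= e2 * INR V0) by nra. assert (0 <= e3 * B) by nra.
  apply Rabs_le_between in E, E'. apply Rabs_le. nra.
Qed.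

(** * The Jackson theorem with a local modulus *)

Lemma Ip_le_on f g : cont f -> cont g -> (forall x, - PI < x < PI -> f x <= g x) -> Ip f <= Ip g.
Proof.
  intros; apply RInt_le; auto using cont_ex_RInt. generalize PI_RGT_0; lra.
Qed.

Lemma sin_ge_quarter x : 0 <= x <= PI / 2 -> x / 4 <= sin x.
Proof.
  intros Hx. assert (P := PI_4). assert (P3 := PI_gt3).
  destruct (Rle_dec x (PI / 3)) as [H | H].
  - destruct (MVT_gen sin 0 x cos) as [xi [Hxi E]].
    + intros; auto_derive; [easy|ring].
    + intros; apply derivable_continuous_pt, derivable_pt_sin.
    + rewrite Rmin_left, Rmax_right in Hxi by lra. rewrite sin_0, !Rminus_0_r in E. rewrite E.
      assert (cos (PI / 3) <= cos xi) by (apply cos_decr_1; lra).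
      rewrite cos_PI3 in H0. nra.
  - assert (sin (PI / 3) <= sin x) by (apply sin_incr_1; lra).
    rewrite sin_PI3 in H0. assert (1 <= sqrt 3) by (rewrite <- sqrt_1; apply sqrt_le_1_alt; lra). lra.
Qed.

Lemma abs_sin_ge_quarter x : Rabs x <= PI / 2 -> Rabs x / 4 <= Rabs (sin x).
Proof.
  intros H. destruct (Rle_dec 0 x).
  - rewrite Rabs_pos_eq in * by auto. assert (K := sin_ge_quarter x ltac:(lra)).
    rewrite Rabs_pos_eq; lra.
  - rewrite Rabs_left in * by lra. assert (K := sin_ge_quarter (- x) ltac:(lra)).
    rewrite sin_neg in K. rewrite Rabs_left1; lra.
Qed.

Definition dirichlet (l : nat) (x : R) : R := 1 + 2 * sm (fun k => cos (INR (S k) * x)) l.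

Lemma dirichlet_sin l x : dirichlet l x * sin (x / 2) = sin ((INR l + / 2) * x).
Proof.
  unfold dirichlet. induction l.
  - simpl. replace ((0 + / 2) * x) with (x / 2) by field. ring.
  - cbn [sm]. rewrite !Rmult_plus_distr_l, Rmult_plus_distr_r, <- !Rmult_plus_distr_l in *.
    rewrite S_INR.
    replace ((INR l + 1 + / 2) * x) with ((INR l + 1) * x + x / 2) by field.
    replace ((INR l + / 2) * x) with ((INR l + 1) * x - x / 2) in IHl by field.
    rewrite sin_plus. rewrite sin_minus in IHl. lra.
Qed.

Lemma dirichlet_trig l : trig l (dirichlet l).
Proof.
  apply span_plus; [apply trig_const|]. apply span_scal.
  apply (span_sm _ (fun k x => cos (INR (S k) * x))). intros; apply trig_cos; lia.
Qed.

Lemma dirichlet_bound l x : Rabs (dirichlet l x) <= 2 * INR l + 1.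
Proof.
  unfold dirichlet. assert (H := sm_abs (fun k => cos (INR (S k) * x)) l).
  assert (sm (fun k => Rabs (cos (INR (S k) * x))) l <= sm (fun _ => 1) l).
  { apply sm_le; intros; apply Rabs_le, COS_bound. }
  rewrite sm_const in H0. apply Rabs_le. assert (H1 := Rle_trans _ _ _ H H0). apply Rabs_le_between in H1. lra.
Qed.

Lemma dirichlet_decay l x : Rabs x < PI -> Rabs x * Rabs (dirichlet l x) <= 8.
Proof.
  intros Hx. assert (X2 : Rabs (x / 2) = Rabs x / 2).
  { unfold Rdiv. rewrite Rabs_mult, (Rabs_pos_eq (/ 2)); lra. }
  assert (H := abs_sin_ge_quarter (x / 2) ltac:(lra)). rewrite X2 in H.
  assert (E := f_equal Rabs (dirichlet_sin l x)). rewrite Rabs_mult in E.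
  assert (Rabs (sin ((INR l + / 2) * x)) <= 1) by (apply Rabs_le, SIN_bound).
  assert (D0 := Rabs_pos (dirichlet l x)).
  assert (Rabs (dirichlet l x) * (Rabs x / 2 / 4) <= 1); [|lra].
  apply Rle_trans with (Rabs (dirichlet l x) * Rabs (sin (x / 2))); [apply Rmult_le_compat_l; auto|lra].
Qed.

Lemma sm_delta f k L : sm (fun l => if Nat.eq_dec k l then f l else 0) L = if lt_dec k L then f k else 0.
Proof.
  induction L; [destruct (lt_dec k 0); [lia|easy]|].
  cbn [sm]. rewrite IHL.
  destruct (Nat.eq_dec k L), (lt_dec k L), (lt_dec k (S L)); subst; try lia; ring.
Qed.

Lemma dirichlet_L2 l : Ip (fun x => dirichlet l x ^ 2) = 2 * PI * (2 * INR l + 1).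
Proof.
  assert (CD := cont_trig _ _ (dirichlet_trig l)).
  assert (E1 : Ip (dirichlet l) = 2 * PI).
  { rewrite (Ip_ext _ (fun x => 1 + 2 * sm (fun k => cos (INR (S k) * x)) l)) by easy.
    rewrite Ip_plus, Ip_const, Ip_scal, (Ip_sm (fun k x => cos (INR (S k) * x))) by (intros; ctac).
    rewrite sm_zero; [ring|]. intros i _.
    rewrite (Ip_ext _ (fun v => cos (0 + (INR (S i) - INR 0) * v))) by (intros; simpl INR; f_equal; ring).
    rewrite Ip_cos_nat. destruct (Nat.eq_dec (S i) 0); [lia|easy]. }
  assert (E2 : forall j, (j < l)%nat -> Ip (fun x => cos (INR (S j) * x) * dirichlet l x) = 2 * PI).
  { intros j Hj.
    rewrite (Ip_ext _ (fun x => cos (INR (S j) * x + 0) * cos (INR 0 * x + 0) +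
       2 * sm (fun k => cos (INR (S j) * x + 0) * cos (INR (S k) * x + 0)) l)).
    - rewrite Ip_plus, Ip_scal, (Ip_sm (fun k x => cos (INR (S j) * x + 0) * cos (INR (S k) * x + 0))) by (intros; ctac).
      rewrite Ip_coscos. destruct (Nat.eq_dec (S j) 0); [lia|].
      rewrite (sm_ext _ (fun k => if Nat.eq_dec j k then (fun _ => PI) k else 0)).
      + rewrite sm_delta. destruct (lt_dec j l); [ring|lia].
      + intros k _. rewrite Ip_coscos. destruct (Nat.eq_dec (S j) (S k)), (Nat.eq_dec j k); try lia; [|easy].
        destruct (Nat.eq_dec (S j) 0); [lia|]. rewrite Rminus_0_r, cos_0; ring.
    - intros x. rewrite !Rplus_0_r. simpl (INR 0). rewrite Rmult_0_l, cos_0. unfold dirichlet.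
      rewrite Rmult_plus_distr_l. f_equal.
      rewrite <- Rmult_assoc, (Rmult_comm _ 2), Rmult_assoc. f_equal.
      rewrite <- sm_scal. apply sm_ext; intros; now rewrite !Rplus_0_r. }
  rewrite (Ip_ext _ (fun x => dirichlet l x + 2 * sm (fun k => cos (INR (S k) * x) * dirichlet l x) l)).
  - rewrite Ip_plus, Ip_scal, (Ip_sm (fun k x => cos (INR (S k) * x) * dirichlet l x)), E1 by (intros; ctac).
    rewrite (sm_ext _ (fun _ => 2 * PI)) by auto. rewrite sm_const. ring.
  - intros x. rewrite (sm_ext _ (fun k => dirichlet l x * cos (INR (S k) * x))) by (intros; ring).
    rewrite sm_scal. unfold dirichlet. ring.
Qed.

(** All arguments stay below [1 < PI / 3], so every cosine is at least [1 / 2]. *)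
Lemma dirichlet_near0 l x : Rabs x <= / INR (S l) -> INR (S l) <= dirichlet l x.
Proof.
  intros Hx. unfold dirichlet. assert (P3 := PI_gt3).
  assert (L0 : 0 < INR (S l)) by (apply lt_0_INR; lia).
  assert (sm (fun _ => / 2) l <= sm (fun k => cos (INR (S k) * x)) l).
  { apply sm_le; intros k Hk.
    assert (K : Rabs (INR (S k) * x) <= 1).
    { rewrite Rabs_mult, Rabs_pos_eq by apply pos_INR.
      apply Rle_trans with (INR (S l) * / INR (S l)); [|right; field; lra].
      apply Rmult_le_compat; [apply pos_INR|apply Rabs_pos|apply le_INR; lia|auto]. }
    assert (G : cos (INR (S k) * x) = cos (Rabs (INR (S k) * x))).
    { unfold Rabs. destruct (Rcase_abs _); [now rewrite cos_neg|easy]. }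
    rewrite G. generalize (Rabs_pos (INR (S k) * x)); intros.
    replace (/ 2) with (cos (PI / 3)) by (rewrite cos_PI3; field). apply cos_decr_1; lra. }
  rewrite sm_const in H. rewrite S_INR. lra.
Qed.

Lemma Ip_ge_sub f d c : cont f -> (forall x, 0 <= f x) -> 0 <= d <= PI -> (forall x, Rabs x <= d -> c <= f x) ->
  2 * d * c <= Ip f.
Proof.
  intros C P Hd H. unfold Ip.
  assert (G : forall a b, a <= b -> 0 <= RInt f a b).
  { intros; apply RInt_ge_0; auto using cont_ex_RInt. }
  rewrite <- (RInt_Chasles (V := R_CompleteNormedModule) f (- PI) (- d) PI) by now apply cont_ex_RInt.
  rewrite <- (RInt_Chasles (V := R_CompleteNormedModule) f (- d) d PI) by now apply cont_ex_RInt.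
  assert (A1 := G (- PI) (- d) ltac:(lra)). assert (A2 := G d PI ltac:(lra)).
  assert (A3 : RInt (fun _ => c) (- d) d <= RInt f (- d) d).
  { apply RInt_le; [lra|apply cont_ex_RInt, cont_const|now apply cont_ex_RInt|].
    intros x Hx. apply H. apply Rabs_le; lra. }
  rewrite RInt_const in A3. unfold scal in A3; simpl in A3; unfold mult in A3; simpl in A3.
  unfold plus; simpl. lra.
Qed.

(** A normalized power [2 p + 2] of the Dirichlet kernel. In the moment, [p] factors absorb
    [|x| ^ p] by the decay away from 0, [p] factors are bounded by the maximum, and the last two are
    integrated by Parseval. The mass is bounded from below by the peak at 0. *)
Lemma jackson_kernel p : exists C, 0 < C /\ forall d : nat, exists J, trig d J /\ (forall x, 0 <= J x) /\
  Ip J = 1 /\ Ip (fun x => Rabs x ^ p * J x) <= C / INR (S d) ^ p.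
Proof.
  set (n := (2 * p + 2)%nat).
  assert (P3 := PI_gt3).
  set (C := 8 ^ p * 2 ^ (p + 1) * PI * INR n ^ p).
  assert (N0 : 0 < INR n) by (apply lt_0_INR; unfold n; lia).
  assert (HC : 0 < C).
  { assert (0 < 8 ^ p) by (apply pow_lt; lra). assert (0 < 2 ^ (p + 1)) by (apply pow_lt; lra).
    assert (0 < INR n ^ p) by (apply pow_lt; lra). unfold C.
    apply Rmult_lt_0_compat; [apply Rmult_lt_0_compat; [apply Rmult_lt_0_compat|]|]; lra. }
  exists C; split; [exact HC|].
  (* The power [n] of a kernel of order [l] has degree [l n <= d], while [d + 1 <= n (l + 1)] keeps
     the moment of the right order in [d]. *)
  intros d. set (l := (d / n)%nat).
  assert (Hl1 : (l * n <= d)%nat) by (unfold l; rewrite Nat.mul_comm; apply Nat.Div0.mul_div_le).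
  assert (Hl2 : (d < n * S l)%nat) by (unfold l; apply Nat.mul_succ_div_gt; unfold n; lia).
  set (J := fun x => dirichlet l x ^ n).
  assert (CD := cont_trig _ _ (dirichlet_trig l)).
  assert (CJ : cont J) by (unfold J; ctac).
  assert (J0 : forall x, 0 <= J x).
  { intros x. unfold J, n. replace (2 * p + 2)%nat with (2 * (p + 1))%nat by lia. rewrite pow_mult.
    apply pow_le, pow2_ge_0. }
  set (L := INR (S l)). assert (L1 : 1 <= L) by (apply (le_INR 1); lia).
  assert (Z : 2 * L ^ (2 * p + 1) <= Ip J).
  { assert (G := Ip_ge_sub J (/ L) (L ^ n) CJ J0).
    assert (IL : 0 < / L <= 1) by (apply Rinv_bounds; lra).
    eapply Rle_trans; [|apply G].
    - right. unfold n. replace (2 * p + 2)%nat with (S (2 * p + 1)) by lia. rewrite <- tech_pow_Rmult. field. lra.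
    - lra.
    - intros x Hx. unfold J. apply pow_incr; split; [lra|]. now apply dirichlet_near0. }
  assert (Z0 : 0 < L ^ (2 * p + 1)) by (apply pow_lt; lra).
  assert (CA : cont (fun x => Rabs x ^ p * J x)).
  { apply cont_mult; [|auto]. apply (cont_pow (fun x => Rabs x)), (cont_abs (fun x => x)), cont_id. }
  assert (U : Ip (fun x => Rabs x ^ p * J x) <= 8 ^ p * (2 * L) ^ p * (2 * PI * (2 * L))).
  { apply Rle_trans with (Ip (fun x => 8 ^ p * (2 * L) ^ p * dirichlet l x ^ 2)).
    - apply Ip_le_on; [auto|ctac|]. intros x Hx. unfold J, n.
      assert (Hd := dirichlet_decay l x ltac:(apply Rabs_def1; lra)). assert (Hb := dirichlet_bound l x).
      replace (dirichlet l x ^ (2 * p + 2)) with (Rabs (dirichlet l x) ^ p * Rabs (dirichlet l x) ^ p * dirichlet l x ^ 2).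
      2:{ rewrite <- pow_add, RPow_abs, Rabs_pos_eq.
          - rewrite <- pow_add. f_equal; lia.
          - replace (p + p)%nat with (2 * p)%nat by lia. rewrite pow_mult. apply pow_le, pow2_ge_0. }
      rewrite <- !Rmult_assoc. apply Rmult_le_compat_r; [apply pow2_ge_0|].
      rewrite <- Rpow_mult_distr.
      apply Rmult_le_compat; [apply pow_le, Rmult_le_pos; apply Rabs_pos|apply pow_le, Rabs_pos| |].
      + apply pow_incr; split; [apply Rmult_le_pos; apply Rabs_pos|auto].
      + apply pow_incr; split; [apply Rabs_pos|]. unfold L. rewrite S_INR. lra.
    - rewrite Ip_scal, dirichlet_L2 by ctac. apply Rmult_le_compat_l.
      + apply Rmult_le_pos; apply pow_le; lra.
      + apply Rmult_le_compat_l; [lra|]. unfold L. rewrite S_INR; lra. }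
  assert (Zp : 0 < Ip J) by lra.
  exists (fun x => / Ip J * J x); repeat split.
  - apply span_scal. eapply trig_mono; [apply Hl1|]. apply (trig_powf l); [apply dirichlet_trig|lia].
  - intros x. apply Rmult_le_pos; [left; now apply Rinv_0_lt_compat|auto].
  - rewrite Ip_scal by auto. field; lra.
  - rewrite (Ip_ext _ (fun x => / Ip J * (Rabs x ^ p * J x))) by (intros; ring).
    rewrite Ip_scal by auto.
    assert (D : INR (S d) ^ p <= (INR n * L) ^ p).
    { apply pow_incr; split; [apply pos_INR|]. unfold L. rewrite <- mult_INR. apply le_INR; lia. }
    assert (D0 : 0 < INR (S d) ^ p) by (apply pow_lt, lt_0_INR; lia).
    rewrite Rmult_comm. apply Rle_div_l; [lra|].
    apply Rle_trans with (C / INR (S d) ^ p * (2 * L ^ (2 * p + 1))).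
    + eapply Rle_trans; [apply U|].
      apply Rle_trans with (C / (INR n * L) ^ p * (2 * L ^ (2 * p + 1))).
      * right. unfold C. rewrite !Rpow_mult_distr, !pow_add, !pow_1.
        replace (L ^ (2 * p)) with (L ^ p * L ^ p) by (rewrite <- pow_add; f_equal; lia).
        field. split; apply pow_nonzero; lra.
      * apply Rmult_le_compat_r; [lra|]. apply Rmult_le_compat_l.
        { lra. }
        apply Rinv_le_contravar; auto.
    + apply Rmult_le_compat_l; [|auto].
      apply Rdiv_le_0_compat; [lra|auto].
Qed.

(** * Finite differences and their averages against the Jackson kernel *)

Fixpoint fdiff (s : nat) (g : R -> R) (th t : R) : R :=
  match s with O => g t | S s' => fdiff s' g th (t + th) - fdiff s' g th t end.

Lemma fdiff_S s g th t : fdiff (S s) g th t = fdiff s (fun x => g (x + th) - g x) th t.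
Proof.
  revert t; induction s; intros t; [easy|].
  change (fdiff (S s) g th (t + th) - fdiff (S s) g th t =
    fdiff s (fun x => g (x + th) - g x) th (t + th) - fdiff s (fun x => g (x + th) - g x) th t).
  now rewrite !IHs.
Qed.

Lemma shift_chain g th : smooth g ->
  smooth (fun x => g (x + th) - g x) /\
  forall k x, Derive_n (fun x => g (x + th) - g x) k x = Derive_n g k (x + th) - Derive_n g k x.
Proof.
  intros Hg. set (F := fun k x => Derive_n g k (x + th) - Derive_n g k x).
  assert (HF : forall k x, is_derive (F k) x (F (S k) x)).
  { intros k x. unfold F. apply @is_derive_minus; [|apply Hg].
    eapply is_derive_val; [apply (is_derive_comp (Derive_n g k) (fun x => x + th)); [apply Hg|]|].
    - auto_derive; [easy|reflexivity].
    - unfold scal; simpl; unfold mult; simpl. ring. }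
  split; [apply (chain_smooth F HF)|apply (chain_Derive_n F HF)].
Qed.

Lemma smooth_MVT g k x y : smooth g -> exists xi, Rabs (xi - x) <= Rabs (y - x) /\
  Derive_n g k y - Derive_n g k x = Derive_n g (S k) xi * (y - x).
Proof.
  intros Hg. destruct (MVT_gen (Derive_n g k) x y (Derive_n g (S k))) as [xi [Hxi E]].
  - intros; apply Hg.
  - intros z _. apply derivable_continuous_pt. exists (Derive_n g (S k) z). apply is_derive_Reals, Hg.
  - exists xi; split; [|auto]. unfold Rmin, Rmax in Hxi. destruct (Rle_dec x y).
    + rewrite !Rabs_pos_eq; lra.
    + rewrite !Rabs_left1; lra.
Qed.

Lemma fdiff_mvt s g th t : smooth g -> exists xi, Rabs (xi - t) <= INR s * Rabs th /\
  fdiff s g th t = th ^ s * Derive_n g s xi.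
Proof.
  revert g; induction s; intros g Hg.
  - exists t; simpl; rewrite Rminus_diag, Rabs_R0; split; lra.
  - destruct (shift_chain g th Hg) as [Hs HD].
    destruct (IHs _ Hs) as [xi [H1 H2]]. rewrite HD in H2.
    destruct (smooth_MVT g s xi (xi + th) Hg) as [xi' [H3 H4]].
    exists xi'; split.
    + rewrite S_INR. replace (xi' - t) with ((xi' - xi) + (xi - t)) by ring.
      eapply Rle_trans; [apply Rabs_triang|]. replace (xi + th - xi) with th in H3 by ring. lra.
    + rewrite fdiff_S, H2, H4. simpl pow. ring.
Qed.

(** The hypothesis concerns increments of the derivative from the single point [t]. The mean value
    form produces two points at distance at most [r |th|] and [(r + 1) |th|] from [t], whence the
    factor [2 r + 1]. *)
Lemma fdiff_lip r g th t L : smooth g -> 0 <= L ->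
  (forall v, Rabs (Derive_n g r v - Derive_n g r t) <= L * Rabs (v - t)) ->
  Rabs (fdiff (S r) g th t) <= (2 * INR r + 1) * L * Rabs th ^ S r.
Proof.
  intros Hg HL H. rewrite fdiff_S. destruct (shift_chain g th Hg) as [Hs HD].
  destruct (fdiff_mvt r _ th t Hs) as [xi [H1 H2]]. rewrite H2, HD, Rabs_mult, <- RPow_abs.
  assert (A1 := H (xi + th)). assert (A2 := H xi).
  assert (A3 : Rabs (xi + th - t) <= Rabs (xi - t) + Rabs th).
  { replace (xi + th - t) with ((xi - t) + th) by ring. apply Rabs_triang. }
  assert (Rabs (Derive_n g r (xi + th) - Derive_n g r xi) <= L * ((2 * INR r + 1) * Rabs th)).
  { replace (Derive_n g r (xi + th) - Derive_n g r xi) with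
      ((Derive_n g r (xi + th) - Derive_n g r t) - (Derive_n g r xi - Derive_n g r t)) by ring.
    eapply Rle_trans; [apply Rabs_triang|]. rewrite Rabs_Ropp.
    apply Rle_trans with (L * (Rabs (xi + th - t) + Rabs (xi - t))); [lra|].
    apply Rmult_le_compat_l; lra. }
  simpl (Rabs th ^ S r).
  apply Rle_trans with (Rabs th ^ r * (L * ((2 * INR r + 1) * Rabs th))); [|right; ring].
  apply Rmult_le_compat_l; [apply pow_le, Rabs_pos|auto].
Qed.

(** Frequency [k] of [g] meets frequency [k i] of [J], which is absent when [k > d]. The average
    thus has degree [d], whatever the degree of [g]. *)
Lemma trig_average d n g J i : trig n g -> trig d J -> (1 <= i)%nat ->
  trig d (fun t => Ip (fun x => J x * g (t + INR i * x))).
Proof.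
  intros H HJ Hi. assert (CJ := cont_trig _ _ HJ).
  induction H as [u [k [Hk Hu]]| |u v Hu IHu Hv IHv|c u Hu IHu|u v Hu IHu E].
  - destruct (le_lt_dec k d) as [Hd | Hd].
    + assert (A := trig_cos k d Hd). assert (B := trig_sin k d Hd).
      destruct Hu as [-> | ->].
      * eapply span_ext; [apply (span_minus _ _ _ (span_scal _ (Ip (fun v => J v * cos (INR k * INR i * v))) _ A)
          (span_scal _ (Ip (fun v => J v * sin (INR k * INR i * v))) _ B))|].
        intros t; simpl. rewrite (Rmult_comm _ (cos _)), (Rmult_comm _ (sin (_ * t))).
        rewrite <- !Ip_scal, <- Ip_minus by ctac. apply Ip_ext; intros v.
        rewrite Rmult_plus_distr_l, cos_plus, !Rmult_assoc; ring.
      * eapply span_ext; [apply (span_plus _ _ _ (span_scal _ (Ip (fun v => J v * sin (INR k * INR i * v))) _ A)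
          (span_scal _ (Ip (fun v => J v * cos (INR k * INR i * v))) _ B))|].
        intros t; simpl. rewrite (Rmult_comm _ (cos _)), (Rmult_comm _ (sin (_ * t))).
        rewrite <- !Ip_scal, <- Ip_plus by ctac. apply Ip_ext; intros v.
        rewrite Rmult_plus_distr_l, sin_plus, !Rmult_assoc; ring.
    + eapply span_ext; [apply span_zero|]. intros t. simpl. symmetry.
      destruct Hu as [-> | ->].
      * rewrite (Ip_ext _ (fun x => J x * cos (INR (k * i) * x + INR k * t))).
        { apply (Ip_orth d); [auto|nia]. }
        intros; rewrite mult_INR; do 2 f_equal; ring.
      * rewrite (Ip_ext _ (fun x => J x * cos (INR (k * i) * x + (INR k * t + - (PI / 2))))).
        { apply (Ip_orth d); [auto|nia]. }
        intros; rewrite mult_INR, sin_as_cos; do 2 f_equal; ring.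
  - eapply span_ext; [apply span_zero|]. intros; simpl.
    rewrite (Ip_ext _ (fun _ => 0)); [rewrite Ip_const; ring|intros; ring].
  - eapply span_ext; [apply (span_plus _ _ _ IHu IHv)|]. intros t; simpl.
    apply cont_trig in Hu, Hv. rewrite <- Ip_plus by ctac. apply Ip_ext; intros; ring.
  - eapply span_ext; [apply (span_scal _ c _ IHu)|]. intros t; simpl.
    apply cont_trig in Hu. rewrite <- Ip_scal by ctac. apply Ip_ext; intros; ring.
  - eapply span_ext; [apply IHu|]. intros t; simpl. apply Ip_ext; intros; now rewrite E.
Qed.

Lemma fdiff_cont s g f : cont g -> cont f -> cont (fun th => fdiff s g th (f th)).
Proof.
  intros Hg; revert f; induction s; intros f Hf; simpl.
  - ctac.
  - apply cont_minus; [apply IHs; ctac|auto].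
Qed.

(** Every term of the difference with a genuine shift averages to degree [d]; only the unshifted
    term [(-1) ^ s g t] is left. The first half is the induction invariant that supplies the shifted
    terms. *)
Lemma fdiff_average s d n g J : trig n g -> trig d J ->
  (forall i, (1 <= i)%nat -> trig d (fun t => Ip (fun x => J x * fdiff s g x (t + INR i * x)))) /\
  exists U, trig d U /\ forall t, Ip (fun x => J x * fdiff s g x t) = (-1) ^ s * Ip J * g t + U t.
Proof.
  intros Hg HJ. assert (CJ := cont_trig _ _ HJ). assert (Cg := cont_trig _ _ Hg).
  assert (CF : forall s f, cont f -> cont (fun x => J x * fdiff s g x (f x))).
  { intros; apply cont_mult; [auto|now apply fdiff_cont]. }
  induction s as [|s [IH1 [U [HU EU]]]].
  - split; [intros; now apply (trig_average d n)|].
    exists (fun _ => 0); split; [apply trig_const|]. intros t. simpl.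
    rewrite (Ip_ext _ (fun x => g t * J x)) by (intros; ring). rewrite Ip_scal by auto. ring.
  - split.
    + intros i Hi. eapply span_ext; [apply (span_minus _ _ _ (IH1 (S i) ltac:(lia)) (IH1 i Hi))|].
      intros t; simpl fdiff. cbv beta. rewrite <- Ip_minus.
      * apply Ip_ext; intros x. rewrite S_INR, Rmult_plus_distr_r, Rmult_1_l, <- Rplus_assoc. ring.
      * apply (CF s (fun x => t + INR (S i) * x)); ctac.
      * apply (CF s (fun x => t + INR i * x)); ctac.
    + exists (fun t => Ip (fun x => J x * fdiff s g x (t + INR 1 * x)) - U t); split.
      * apply span_minus; [apply IH1; lia|auto].
      * intros t. simpl fdiff. rewrite (Ip_ext _ (fun x => J x * fdiff s g x (t + INR 1 * x) - J x * fdiff s g x t)).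
        { rewrite Ip_minus, EU; [simpl; ring| |].
          - apply (CF s (fun x => t + INR 1 * x)); ctac.
          - apply (CF s (fun x => t)); ctac. }
        intros x. simpl INR. rewrite Rmult_1_l; ring.
Qed.

(** [T] is chosen before [t] and [L], so a Lipschitz constant that blows up as [t] approaches a zero
    of [sin] is allowed. *)
Lemma jackson r : exists C, 0 < C /\ forall d n g, trig n g -> exists T, trig d T /\
  forall t L, 0 <= L -> (forall v, Rabs (Derive_n g r v - Derive_n g r t) <= L * Rabs (v - t)) ->
  Rabs (g t - T t) <= C * L / INR (S d) ^ S r.
Proof.
  destruct (jackson_kernel (S r)) as [C [HC HJ]].
  assert (R0 := pos_INR r).
  exists ((2 * INR r + 1) * C); split; [apply Rmult_lt_0_compat; lra|].
  intros d n g Hg. destruct (HJ d) as [J [TJ [J0 [J1 Jm]]]].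
  destruct (fdiff_average (S r) d n g J Hg TJ) as [_ [U [HU EU]]].
  assert (CJ := cont_trig _ _ TJ). assert (Cg := cont_trig _ _ Hg).
  exists (fun t => (-1) ^ r * U t); split; [now apply span_scal|].
  intros t L HL H. specialize (EU t). rewrite J1, Rmult_1_r in EU.
  assert (E : Rabs (g t - (-1) ^ r * U t) = Rabs (Ip (fun x => J x * fdiff (S r) g x t))).
  { rewrite EU. simpl pow.
    replace (-1 * (-1) ^ r * g t + U t) with ((- (-1) ^ r) * (g t - (-1) ^ r * U t)).
    - rewrite (Rabs_mult (- _)), Rabs_Ropp, abs_pm1; ring.
    - assert ((-1) ^ r * (-1) ^ r = 1).
      { rewrite <- pow_add. replace (r + r)%nat with (2 * r)%nat by lia. apply pow_m1_even. }
      replace (- (-1) ^ r * (g t - (-1) ^ r * U t)) with (- (-1) ^ r * g t + ((-1) ^ r * (-1) ^ r) * U t) by ring.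
      rewrite H0; ring. }
  rewrite E.
  assert (CF : cont (fun x => fdiff (S r) g x t)) by (apply (fdiff_cont (S r) g (fun _ => t)); ctac).
  assert (CA : cont (fun x => Rabs x ^ S r * J x)).
  { apply cont_mult; [|auto]. apply (cont_pow (fun x => Rabs x)), (cont_abs (fun x => x)), cont_id. }
  eapply Rle_trans; [apply Ip_abs; ctac|].
  apply Rle_trans with (Ip (fun x => (2 * INR r + 1) * L * (Rabs x ^ S r * J x))).
  - apply Ip_le; [apply (cont_abs (fun x => J x * fdiff (S r) g x t)); ctac|ctac|].
    intros x. rewrite Rabs_mult, (Rabs_pos_eq (J x)) by auto.
    assert (A := fdiff_lip r g x t L (trig_smooth _ _ Hg) HL H). specialize (J0 x). nra.
  - rewrite Ip_scal by auto. replace ((2 * INR r + 1) * C * L / INR (S d) ^ S r)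
      with ((2 * INR r + 1) * L * (C / INR (S d) ^ S r)) by (unfold Rdiv; ring).
    apply Rmult_le_compat_l; [apply Rmult_le_pos; lra|auto].
Qed.

(** * Functions on the interval *)

Definition Ichain (m : nat) (F : nat -> R -> R) : Prop :=
  (forall k, (k <= m)%nat -> cont_on_I (F k)) /\
  (forall k x, (k < m)%nat -> -1 < x < 1 -> derivable_pt_lim (F k) x (F (S k) x)).

(** Composition with this projection turns continuity relative to the interval into continuity on
    the line, as the mean value theorem demands at the endpoints. *)
Definition clamp (x : R) : R := Rmax (-1) (Rmin 1 x).

Lemma clamp_I x : inI (clamp x).
Proof. unfold clamp, inI, Rmax, Rmin. destruct (Rle_dec 1 x), (Rle_dec _ _); lra. Qed.

Lemma clamp_id x : inI x -> clamp x = x.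
Proof. unfold clamp, inI, Rmax, Rmin; intros. destruct (Rle_dec 1 x), (Rle_dec _ _); lra. Qed.

Lemma clamp_lip x y : Rabs (clamp x - clamp y) <= Rabs (x - y).
Proof.
  assert (K : forall x y, x <= y -> 0 <= clamp y - clamp x <= y - x).
  { clear; intros x y H.
    assert (S : forall z, z <= -1 /\ clamp z = -1 \/ -1 <= z <= 1 /\ clamp z = z \/ 1 <= z /\ clamp z = 1).
    { intros z. destruct (Rle_dec (-1) z), (Rle_dec z 1); unfold clamp.
      - right; left. split; [lra|]. rewrite Rmin_right, Rmax_right; lra.
      - right; right. split; [lra|]. rewrite Rmin_left, Rmax_right; lra.
      - left. split; [lra|]. rewrite Rmin_right, Rmax_left; lra.
      - lra. }
    destruct (S x) as [Hx | [Hx | Hx]], (S y) as [Hy | [Hy | Hy]]; lra. }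
  destruct (Rle_dec x y) as [H | H].
  - specialize (K x y H). rewrite !Rabs_left1; lra.
  - specialize (K y x ltac:(lra)). rewrite !Rabs_pos_eq; lra.
Qed.

Lemma clamp_continuity h : cont_on_I h -> forall x, continuity_pt (fun z => h (clamp z)) x.
Proof.
  intros H x e He. destruct (H (clamp x) (clamp_I x) e He) as [d [Hd K]].
  exists d; split; [auto|]. intros y [_ Hy]. apply K; [apply clamp_I|].
  eapply Rle_lt_trans; [apply clamp_lip|exact Hy].
Qed.

Lemma mvt_I h h' x y : cont_on_I h -> (forall z, -1 < z < 1 -> derivable_pt_lim h z (h' z)) ->
  inI x -> inI y -> x <= y -> exists xi, x <= xi <= y /\ h y - h x = h' xi * (y - x).
Proof.
  intros C D Hx Hy Hxy. unfold inI in *.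
  destruct (MVT_gen (fun z => h (clamp z)) x y h') as [xi [Hxi E]].
  - intros z Hz. rewrite Rmin_left, Rmax_right in Hz by lra. apply (is_derive_ext_loc h).
    + assert (P : 0 < Rmin (z - x) (y - z)) by (apply Rmin_glb_lt; lra).
      exists (mkposreal _ P).
      intros w Hw. eqR. rewrite clamp_id; [easy|].
      apply Rabs_def2 in Hw. unfold minus, plus, opp in Hw; simpl in Hw.
      assert (A1 := Rmin_l (z - x) (y - z)). assert (A2 := Rmin_r (z - x) (y - z)).
      unfold inI; lra.
    + apply is_derive_Reals, D; lra.
  - intros z _; now apply clamp_continuity.
  - rewrite Rmin_left, Rmax_right in Hxi by lra. rewrite !clamp_id in E by (unfold inI; lra). eauto.
Qed.

(** Repeated integration from either endpoint gives powers of [1 - x] and of [1 + x]; at the nearer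
    endpoint this distance is at most [1 - x ^ 2]. *)
Lemma vanish_bound m F A : Ichain m F -> (forall x, inI x -> Rabs (F m x) <= A) ->
  (forall i, (i < m)%nat -> F i (-1) = 0 /\ F i 1 = 0) ->
  forall i x, (i <= m)%nat -> inI x -> Rabs (F i x) <= A * (1 - x ^ 2) ^ (m - i).
Proof.
  intros [HC HD] HA HV.
  assert (A0 : 0 <= A). { eapply Rle_trans; [apply Rabs_pos|apply (HA 0)]; unfold inI; lra. }
  assert (K : forall j, (j <= m)%nat -> forall x, inI x ->
     Rabs (F (m - j)%nat x) <= A * (1 - x) ^ j /\ Rabs (F (m - j)%nat x) <= A * (1 + x) ^ j).
  { induction j; intros Hj x Hx.
    - rewrite Nat.sub_0_r. simpl; rewrite Rmult_1_r. auto.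
    - set (i := (m - S j)%nat). assert (Ei : (m - j)%nat = S i) by (unfold i; lia). rewrite Ei in IHj.
      assert (V := HV i ltac:(unfold i; lia)).
      assert (C := HC i ltac:(unfold i; lia)).
      assert (D : forall z, -1 < z < 1 -> derivable_pt_lim (F i) z (F (S i) z)) by (intros; apply HD; [unfold i; lia|auto]).
      unfold inI in *. split.
      + destruct (mvt_I _ _ x 1 C D) as [xi [Hxi E]]; [unfold inI; lra..|].
        replace (F i x) with (- (F (S i) xi * (1 - x))) by lra.
        destruct (IHj ltac:(lia) xi ltac:(lra)) as [B _].
        rewrite Rabs_Ropp, Rabs_mult, (Rabs_pos_eq (1 - x)) by lra. simpl pow.
        assert ((1 - xi) ^ j <= (1 - x) ^ j) by (apply pow_incr; lra).
        apply Rle_trans with (A * (1 - xi) ^ j * (1 - x)); [apply Rmult_le_compat_r; lra|].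
        replace (A * ((1 - x) * (1 - x) ^ j)) with (A * (1 - x) ^ j * (1 - x)) by ring.
        apply Rmult_le_compat_r; [lra|]. apply Rmult_le_compat_l; lra.
      + destruct (mvt_I _ _ (-1) x C D) as [xi [Hxi E]]; [unfold inI; lra..|].
        replace (F i x) with (F (S i) xi * (1 + x)) by lra.
        destruct (IHj ltac:(lia) xi ltac:(lra)) as [_ B].
        rewrite Rabs_mult, (Rabs_pos_eq (1 + x)) by lra. simpl pow.
        assert ((1 + xi) ^ j <= (1 + x) ^ j) by (apply pow_incr; lra).
        apply Rle_trans with (A * (1 + xi) ^ j * (1 + x)); [apply Rmult_le_compat_r; lra|].
        replace (A * ((1 + x) * (1 + x) ^ j)) with (A * (1 + x) ^ j * (1 + x)) by ring.
        apply Rmult_le_compat_r; [lra|]. apply Rmult_le_compat_l; lra. }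
  intros i x Hi Hx. specialize (K (m - i)%nat ltac:(lia) x Hx). replace (m - (m - i))%nat with i in K by lia.
  unfold inI in Hx. destruct (Rle_lt_dec 0 x).
  - eapply Rle_trans; [apply (proj1 K)|]. apply Rmult_le_compat_l; [auto|]. apply pow_incr; split; [lra|].
    assert (0 <= x * (1 - x)) by (apply Rmult_le_pos; lra). lra.
  - eapply Rle_trans; [apply (proj2 K)|]. apply Rmult_le_compat_l; [auto|]. apply pow_incr; split; [lra|].
    assert (0 <= - x * (1 + x)) by (apply Rmult_le_pos; lra). lra.
Qed.

Lemma cont_I f : cont f -> cont_on_I f.
Proof.
  intros H x Hx e He. assert (C : continuity_pt f x) by (apply continuity_pt_filterlim, H).
  destruct (C e He) as [d [Hd K]]. exists d; split; [auto|]. intros y Hy Hd'.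
  destruct (Req_dec x y) as [<- | Hn]; [rewrite Rminus_diag, Rabs_R0; auto|].
  apply K. repeat split; auto.
Qed.

Lemma smooth_cont_n f k : smooth f -> cont (Derive_n f k).
Proof.
  intros H x. apply (ex_derive_continuous (Derive_n f k) x). eexists; apply H.
Qed.

Lemma smooth_Ichain f m : smooth f -> Ichain m (Derive_n f).
Proof.
  intros H; split.
  - intros k _. apply cont_I, smooth_cont_n, H.
  - intros k x _ _. apply is_derive_Reals, H.
Qed.

Lemma poly_bounded n f : poly n f -> exists B, 0 <= B /\ forall x, inI x -> Rabs (f x) <= B.
Proof.
  intros H; induction H as [u [k [Hk ->]]| |u v Hu [a [A0 IHu]] Hv [b [B0 IHv]]|c u Hu [a [A0 IHu]]|u v Hu [a [A0 IHu]] E].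
  - exists 1; split; [lra|]. intros x Hx. rewrite <- RPow_abs, <- (pow1 k). apply pow_incr.
    split; [apply Rabs_pos|apply Rabs_le, Hx].
  - exists 0; split; [lra|]. intros; rewrite Rabs_R0; lra.
  - exists (a + b); split; [lra|]. intros x Hx. eapply Rle_trans; [apply Rabs_triang|].
    specialize (IHu x Hx). specialize (IHv x Hx). lra.
  - exists (Rabs c * a); split; [apply Rmult_le_pos; [apply Rabs_pos|auto]|]. intros x Hx.
    rewrite Rabs_mult. apply Rmult_le_compat_l; [apply Rabs_pos|auto].
  - exists a; split; [auto|]. intros; rewrite <- E; auto.
Qed.

Lemma poly_bounded_derivs n f m : poly n f ->
  exists B, 0 <= B /\ forall i x, (i <= m)%nat -> inI x -> Rabs (Derive_n f i x) <= B.
Proof.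
  intros H. induction m as [|m [B [B0 IH]]].
  - destruct (poly_bounded _ _ H) as [B [B0 HB]]. exists B; split; [auto|]. intros i x Hi Hx.
    replace i with 0%nat by lia. auto.
  - destruct (poly_bounded _ _ (poly_Derive_n n f (S m) H)) as [B' [B0' HB]].
    exists (B + B'); split; [lra|]. intros i x Hi Hx.
    destruct (Nat.eq_dec i (S m)) as [-> | Hn].
    + specialize (HB x Hx). lra.
    + specialize (IH i x ltac:(lia) Hx). lra.
Qed.

(** Leibniz' rule for a linear factor. At [i = 0] the truncated index [i - 1] does no harm, its
    coefficient being 0. *)
Lemma Derive_n_factor v c i x : smooth v ->
  Derive_n (fun y => (y - c) * v y) i x = (x - c) * Derive_n v i x + INR i * Derive_n v (i - 1) x.
Proof.
  intros Hv.
  rewrite (Derive_n_ext _ (fun y => (y - c) * Derive_n v 0 y + INR 0 * Derive_n v (0 - 1) y)) by (intros; simpl; ring).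
  apply (chain_Derive_n (fun i x => (x - c) * Derive_n v i x + INR i * Derive_n v (i - 1) x)).
  intros k y. eapply is_derive_val.
  - apply @is_derive_plus.
    + apply @is_derive_mult; [|apply Hv|intros; apply Rmult_comm].
      apply @is_derive_minus; [apply @is_derive_id|apply @is_derive_const].
    + apply is_derive_scal, Hv.
  - change ((1 + - 0) * Derive_n v k y + (y + - c) * Derive_n v (S k) y + INR k * Derive_n v (S (k - 1)) y =
      (y - c) * Derive_n v (S k) y + INR (S k) * Derive_n v (S k - 1) y).
    destruct k; [simpl; ring|].
    replace (S k - 1)%nat with k by lia. replace (S (S k) - 1)%nat with (S k) by lia.
    rewrite (S_INR (S k)). ring.
Qed.

(** * Interpolation and division at the endpoints *)

Lemma poly_linpow n c k w : poly n w -> poly (k + n) (fun x => (x - c) ^ k * w x).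
Proof.
  intros H. apply (poly_mult k n); [|auto|lia].
  apply (poly_powf 1); [|lia]. apply span_minus; [apply poly_id; lia|apply poly_const].
Qed.

Lemma Derive_n_linpow n c k w i : poly n w ->
  Derive_n (fun x => (x - c) ^ S k * w x) i c = INR i * Derive_n (fun x => (x - c) ^ k * w x) (i - 1) c.
Proof.
  intros H. rewrite (Derive_n_ext _ (fun x => (x - c) * ((x - c) ^ k * w x))) by (intros; simpl; ring).
  rewrite (Derive_n_factor (fun x => (x - c) ^ k * w x)) by (eapply poly_smooth, poly_linpow; eauto). ring.
Qed.

Lemma Derive_n_vanish n c k w i : poly n w -> (i < k)%nat -> Derive_n (fun x => (x - c) ^ k * w x) i c = 0.
Proof.
  intros H; revert i; induction k; intros i Hi; [lia|].
  rewrite (Derive_n_linpow n) by auto. destruct i; [simpl; ring|].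
  rewrite IHk by lia. ring.
Qed.

Lemma Derive_n_diag n c k w : poly n w -> Derive_n (fun x => (x - c) ^ k * w x) k c = INR (fact k) * w c.
Proof.
  intros H; induction k; [simpl; ring|].
  rewrite (Derive_n_linpow n) by auto. replace (S k - 1)%nat with k by lia.
  rewrite IHk, fact_simpl, mult_INR. ring.
Qed.

(** The data at 1 are met one at a time, by multiples of [(x - 1) ^ d (x + 1) ^ k], which disturb
    neither the zeros at -1 nor the conditions already met. The constant depends on the orders only,
    so small data give a small interpolant. *)
Lemma hermite_interp k m d : (d <= k)%nat -> (k <= m)%nat -> exists C, 0 <= C /\ forall A y, 0 <= A ->
  (forall i, (i < d)%nat -> Rabs (y i) <= A) -> exists q, poly (k + d - 1) q /\
  (forall i, (i < k)%nat -> Derive_n q i (-1) = 0) /\ (forall i, (i < d)%nat -> Derive_n q i 1 = y i) /\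
  forall i x, (i <= m)%nat -> inI x -> Rabs (Derive_n q i x) <= C * A.
Proof.
  intros Hd Hm. induction d as [|d IH].
  - exists 0; split; [lra|]. intros A y HA _. exists (fun _ => 0); repeat split.
    + apply poly_const.
    + intros i _. destruct i; [easy|]. rewrite Derive_n_const; easy.
    + lia.
    + intros i x _ _. destruct i; [simpl; rewrite Rabs_R0; lra|]. rewrite Derive_n_const, Rabs_R0; lra.
  - destruct (IH ltac:(lia)) as [C [C0 HC]]. clear IH.
    set (E := fun x => (x - 1) ^ d * (x - -1) ^ k).
    assert (Pk : poly k (fun x => (x - -1) ^ k)).
    { apply (poly_powf 1); [|lia]. apply span_minus; [apply poly_id; lia|apply poly_const]. }
    assert (Pd : poly d (fun x => (x - 1) ^ d)).
    { apply (poly_powf 1); [|lia]. apply span_minus; [apply poly_id; lia|apply poly_const]. }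
    assert (PE : poly (k + d) E) by (apply (poly_mult d k); [auto|auto|lia]).
    destruct (poly_bounded_derivs _ _ m PE) as [B [B0 HB]].
    (* The value at 1 of the [d]-th derivative of [E], by which the remaining defect is divided. *)
    set (N := INR (fact d) * (1 - -1) ^ k).
    assert (N1 : 1 <= N).
    { unfold N. assert (1 <= INR (fact d)) by (apply (le_INR 1), lt_O_fact).
      assert (1 <= (1 - -1) ^ k) by (apply pow_R1_Rle; lra). nra. }
    exists (C + (1 + C) * B); split; [nra|]. intros A y HA Hy.
    destruct (HC A y HA ltac:(auto)) as [q [Pq [Q1 [Q2 Q3]]]].
    set (b := (y d - Derive_n q d 1) / N).
    assert (Hb : Rabs b <= (1 + C) * A).
    { assert (K1 := Hy d ltac:(lia)). assert (K2 := Q3 d 1 ltac:(lia) ltac:(unfold inI; lra)).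
      unfold b, Rdiv. rewrite Rabs_mult, Rabs_inv, (Rabs_pos_eq N) by lra.
      assert (Rabs (y d - Derive_n q d 1) <= (1 + C) * A).
      { eapply Rle_trans; [apply Rabs_triang|]. rewrite Rabs_Ropp. lra. }
      assert (0 < / N <= 1) by (apply Rinv_bounds; lra).
      generalize (Rabs_pos (y d - Derive_n q d 1)); nra. }
    assert (Sq := poly_smooth _ _ Pq). assert (SE := poly_smooth _ _ PE).
    assert (SbE : smooth (fun x => b * E x)) by (eapply poly_smooth, span_scal, PE).
    assert (DD : forall i x, Derive_n (fun x => q x + b * E x) i x = Derive_n q i x + b * Derive_n E i x).
    { intros. rewrite Derive_n_plus_smooth, Derive_n_scal_smooth; auto. }
    exists (fun x => q x + b * E x); repeat split.
    + apply span_plus; [eapply poly_mono; [|apply Pq]; lia|]. apply span_scal. eapply poly_mono; [|apply PE]; lia.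
    + intros i Hi. rewrite DD, Q1 by auto.
      rewrite (Derive_n_ext E (fun x => (x - -1) ^ k * (x - 1) ^ d)) by (intros; unfold E; ring).
      rewrite (Derive_n_vanish d) by auto. ring.
    + intros i Hi. rewrite DD. destruct (Nat.eq_dec i d) as [-> | Hn].
      * unfold E. rewrite (Derive_n_diag k) by auto. fold N. unfold b. field. lra.
      * rewrite Q2 by lia. unfold E. rewrite (Derive_n_vanish k) by (auto || lia). ring.
    + intros i x Hi Hx. rewrite DD. eapply Rle_trans; [apply Rabs_triang|]. rewrite Rabs_mult.
      specialize (HB i x Hi Hx). specialize (Q3 i x Hi Hx).
      assert (Rabs b * Rabs (Derive_n E i x) <= (1 + C) * A * B).
      { apply Rmult_le_compat; try apply Rabs_pos; auto. }
      nra.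
Qed.

Lemma poly_factor n f c : poly n f -> exists v, poly (n - 1) v /\ forall x, f x - f c = (x - c) * v x.
Proof.
  intros H; induction H as [u [k [Hk ->]]| |u v Hu [a [A0 IHu]] Hv [b [B0 IHv]]|l u Hu [a [A0 IHu]]|u v Hu [a [A0 IHu]] E].
  - cut (exists v, poly (k - 1) v /\ forall x, x ^ k - c ^ k = (x - c) * v x).
    { intros [v [Hv E]]; exists v; split; [eapply poly_mono; [|apply Hv]; lia|auto]. }
    clear Hk. induction k as [|k [v [Hv E]]].
    + exists (fun _ => 0); split; [apply poly_const|intros; simpl; ring].
    + destruct k.
      * exists (fun _ => 1); split; [apply poly_const|intros; simpl; ring].
      * exists (fun x => x * v x + c ^ S k); split.
        { apply span_plus; [|apply poly_const]. apply (poly_mult 1 k); [apply poly_id; lia| |lia].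
          eapply poly_mono; [|apply Hv]; lia. }
        intros x. specialize (E x).
        change (x * x ^ S k - c * c ^ S k = (x - c) * (x * v x + c ^ S k)).
        replace (x ^ S k) with ((x - c) * v x + c ^ S k) by lra. ring.
  - exists (fun _ => 0); split; [apply poly_const|intros; ring].
  - exists (fun x => a x + b x); split; [now apply span_plus|]. intros x. specialize (IHu x). specialize (IHv x). lra.
  - exists (fun x => l * a x); split; [now apply span_scal|]. intros x. specialize (IHu x).
    replace (l * u x - l * u c) with (l * (u x - u c)) by ring. rewrite IHu; ring.
  - exists a; split; [auto|]. intros x. now rewrite <- !E.
Qed.

(* Division by a power of [x - c], keeping the order of vanishing at every other point. *)
Lemma poly_div_linpow n k c f : poly n f -> (forall i, (i < k)%nat -> Derive_n f i c = 0) ->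
  exists v, poly n v /\ (forall x, f x = (x - c) ^ k * v x) /\
  forall b m, b <> c -> (forall i, (i < m)%nat -> Derive_n f i b = 0) -> forall i, (i < m)%nat -> Derive_n v i b = 0.
Proof.
  revert f; induction k; intros f Hf H.
  - exists f; repeat split; auto. intros; simpl; ring.
  - destruct (poly_factor n f c Hf) as [v [Hv E]].
    assert (F0 : f c = 0) by (apply (H 0%nat); lia).
    assert (E' : forall x, f x = (x - c) * v x) by (intros x; specialize (E x); lra).
    assert (DD : forall i x, Derive_n f i x = (x - c) * Derive_n v i x + INR i * Derive_n v (i - 1) x).
    { intros i x. rewrite (Derive_n_ext _ _ _ _ E'). apply Derive_n_factor. eapply poly_smooth; eauto. }
    destruct (IHk v) as [w [Hw [Ew Vw]]].
    + eapply poly_mono; [|apply Hv]; lia.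
    + intros i Hi. specialize (H (S i) ltac:(lia)). rewrite DD in H.
      replace (S i - 1)%nat with i in H by lia. rewrite Rminus_diag, Rmult_0_l, Rplus_0_l in H.
      apply Rmult_integral in H as [H | H]; [|auto]. exfalso; revert H; apply not_0_INR; lia.
    + exists w; repeat split; [auto|intros; rewrite E', Ew; simpl; ring|].
      intros b m Hb Hm. apply Vw; [auto|]. intros i Hi.
      induction i as [i IHi] using (well_founded_induction lt_wf).
      specialize (Hm i Hi) as Hz. rewrite DD in Hz.
      assert (Z : INR i * Derive_n v (i - 1) b = 0).
      { destruct i; [simpl; ring|]. rewrite IHi by lia. ring. }
      rewrite Z, Rplus_0_r in Hz. apply Rmult_integral in Hz as [Hz | Hz]; [lra|auto].
Qed.

Lemma poly_div_both n r f : poly n f ->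
  (forall i, (i < r)%nat -> Derive_n f i (-1) = 0 /\ Derive_n f i 1 = 0) ->
  exists phi, poly n phi /\ forall x, f x = (1 - x ^ 2) ^ r * phi x.
Proof.
  intros Hf H.
  destruct (poly_div_linpow n r 1 f Hf) as [v [Hv [E V]]]; [apply H|].
  destruct (poly_div_linpow n r (-1) v Hv) as [w [Hw [E' _]]].
  - apply (V (-1) r); [lra|]. apply H.
  - exists (fun x => (-1) ^ r * w x); split; [now apply span_scal|]. intros x.
    rewrite E, E', <- !Rmult_assoc, <- !Rpow_mult_distr. f_equal. f_equal. ring.
Qed.

Lemma is_derive_sm (F dF : nat -> R -> R) n x : (forall i, (i < n)%nat -> is_derive (F i) x (dF i x)) ->
  is_derive (fun x => sm (fun i => F i x) n) x (sm (fun i => dF i x) n).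
Proof.
  induction n as [|n IH]; intros H; cbn [sm].
  - apply @is_derive_const.
  - apply @is_derive_plus; auto.
Qed.

Lemma is_derive_multR (f g : R -> R) x a b : is_derive f x a -> is_derive g x b ->
  is_derive (fun x => f x * g x) x (a * g x + f x * b).
Proof. intros F G. apply @is_derive_mult; auto. intros; apply Rmult_comm. Qed.

Lemma is_derive_compR (f g : R -> R) x a b : is_derive f (g x) a -> is_derive g x b ->
  is_derive (fun x => f (g x)) x (b * a).
Proof. intros F G. apply (is_derive_comp f g); auto. Qed.

(* The leading behaviour of the derivatives of [f (cos t) / sin t ^ r], with denominators cleared. *)
Lemma sin_quotient_derivs r k : exists Q : nat -> R -> R, (forall j, exists n, poly n (Q j)) /\
  (forall x, Q k x = (-1) ^ k) /\ (forall j, (k < j)%nat -> forall x, Q j x = 0) /\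
  forall f g, smooth f -> smooth g -> (forall t, g t * sin t ^ r = f (cos t)) ->
  forall t, Derive_n g k t * sin t ^ (r + k) =
    sm (fun j => Derive_n f j (cos t) * Q j (cos t) * sin t ^ (2 * j)) (S k).
Proof.
  induction k as [|k [Q [PQ [Q1 [Q0 HQ]]]]].
  - exists (fun j _ => if Nat.eq_dec j 0 then 1 else 0); repeat split.
    + intros j. exists 0%nat. apply (poly_const 0 (if Nat.eq_dec j 0 then 1 else 0)).
    + intros j Hj _. destruct (Nat.eq_dec j 0); [lia|easy].
    + intros f g Hf Hg E t. rewrite Nat.add_0_r. simpl. rewrite E. ring.
  - assert (DQ : forall j x, is_derive (Q j) x (Derive (Q j) x)).
    { intros j x. destruct (PQ j) as [n Hn]. apply (poly_smooth n _ Hn 0%nat). }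
    (* Differentiate the identity for [k] and multiply by [sin t]. The term [- (r + k)] comes from
       the power on the left and [2 j] from the one on the right; differentiating
       [Derive_n f j (cos t)] moves [Q j] to index [j + 1], which gives [be]. *)
    set (al := fun j x => (2 * INR j - INR r - INR k) * (x * Q j x) - (1 - x ^ 2) * Derive (Q j) x).
    set (be := fun j x => match j with O => 0 | S i => Q i x end).
    exists (fun j x => al j x - be j x); repeat split.
    + intros j. destruct (PQ j) as [n Hn]. destruct (PQ (j - 1)%nat) as [m Hm].
      exists (n + m + 2)%nat. apply span_minus.
      * apply span_minus.
        { apply span_scal. apply (poly_mult 1 n); [apply poly_id; lia|auto|lia]. }
        apply (poly_mult 2 n); [|apply (poly_Derive_n n (Q j) 1 Hn)|lia].
        apply span_minus; [apply poly_const|apply poly_pow; lia].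
      * destruct j; [apply (poly_const _ 0)|]. replace (S j - 1)%nat with j in Hm by lia.
        eapply poly_mono; [|apply Hm]; lia.
    + intros x. unfold al, be. rewrite (Q0 (S k)) by lia. rewrite Q1.
      rewrite (Derive_ext (Q (S k)) (fun _ => 0)) by (intros; apply Q0; lia). rewrite Derive_const. simpl; ring.
    + intros j Hj x. unfold al, be. rewrite (Q0 j) by lia.
      rewrite (Derive_ext (Q j) (fun _ => 0)) by (intros; apply Q0; lia). rewrite Derive_const.
      destruct j; [lia|]. rewrite (Q0 j) by lia. ring.
    + intros f g Hf Hg E t. specialize (HQ f g Hf Hg E).
      set (c := cos t). set (s := sin t).
      assert (Dc : is_derive cos t (- s)) by (unfold s; auto_derive; [easy|ring]).
      assert (Dp : forall n, is_derive (fun t => sin t ^ n) t (INR n * s ^ (n - 1) * c)).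
      { intros n. unfold s, c. auto_derive; [easy|]. replace (Init.Nat.pred n) with (n - 1)%nat by lia. ring. }
      assert (L : is_derive (fun t => Derive_n g k t * sin t ^ (r + k)) t
         (Derive_n g (S k) t * s ^ (r + k) + Derive_n g k t * (INR (r + k) * s ^ (r + k - 1) * c))).
      { apply (is_derive_multR (Derive_n g k) (fun t => sin t ^ (r + k))); [apply Hg|apply Dp]. }
      assert (Rr : is_derive (fun t => sm (fun j => Derive_n f j (cos t) * Q j (cos t) * sin t ^ (2 * j)) (S k)) t
         (sm (fun j => ((- s * Derive_n f (S j) c) * Q j c + Derive_n f j c * (- s * Derive (Q j) c)) * s ^ (2 * j)
            + Derive_n f j c * Q j c * (INR (2 * j) * s ^ (2 * j - 1) * c)) (S k))).
      { apply (is_derive_sm (fun j t => Derive_n f j (cos t) * Q j (cos t) * sin t ^ (2 * j))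
          (fun j t => ((- sin t * Derive_n f (S j) (cos t)) * Q j (cos t) + Derive_n f j (cos t) * (- sin t * Derive (Q j) (cos t))) * sin t ^ (2 * j)
            + Derive_n f j (cos t) * Q j (cos t) * (INR (2 * j) * sin t ^ (2 * j - 1) * cos t))).
        intros j _. apply (is_derive_multR (fun t => Derive_n f j (cos t) * Q j (cos t)) (fun t => sin t ^ (2 * j))); [|apply Dp].
        apply (is_derive_multR (fun t => Derive_n f j (cos t)) (fun t => Q j (cos t))).
        - apply (is_derive_compR (Derive_n f j) cos); [apply Hf|apply Dc].
        - apply (is_derive_compR (Q j) cos); [apply DQ|apply Dc]. }
      assert (U : Derive_n g (S k) t * s ^ (r + k) + Derive_n g k t * (INR (r + k) * s ^ (r + k - 1) * c) =
        sm (fun j => ((- s * Derive_n f (S j) c) * Q j c + Derive_n f j c * (- s * Derive (Q j) c)) * s ^ (2 * j)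
            + Derive_n f j c * Q j c * (INR (2 * j) * s ^ (2 * j - 1) * c)) (S k)).
      { rewrite <- (is_derive_unique _ _ _ L), <- (is_derive_unique _ _ _ Rr). apply Derive_ext, HQ. }
      assert (S2 : s * s = 1 - c * c) by (unfold s, c; generalize (sin2_cos2 t); unfold Rsqr; lra).
      assert (SP : forall n, INR n * s ^ (n - 1) * s = INR n * s ^ n).
      { intros [|n]; [simpl; ring|]. replace (S n - 1)%nat with n by lia. simpl (s ^ S n). ring. }
      apply (f_equal (fun z => s * z)) in U.
      rewrite Rmult_plus_distr_l in U.
      replace (s * (Derive_n g k t * (INR (r + k) * s ^ (r + k - 1) * c)))
        with (INR (r + k) * c * (Derive_n g k t * s ^ (r + k))) in U.
      2:{ replace (INR (r + k) * c * (Derive_n g k t * s ^ (r + k))) with (c * Derive_n g k t * (INR (r + k) * s ^ (r + k))) by ring.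
          rewrite <- SP. ring. }
      unfold s at 3 in U. rewrite HQ in U. fold s in U. fold c in U.
      rewrite <- !sm_scal in U.
      replace (r + S k)%nat with (S (r + k)) by lia.
      replace (Derive_n g (S k) t * s ^ S (r + k)) with (s * (Derive_n g (S k) t * s ^ (r + k))) by (simpl (s ^ S _); ring).
      match type of U with ?X + ?Y = ?Z => replace X with (Z + -1 * Y) by lra end.
      rewrite <- sm_scal, <- sm_plus.
      transitivity (sm (fun j => Derive_n f j c * s ^ (2 * j) * al j c) (S (S k))
          + -1 * sm (fun j => Derive_n f j c * s ^ (2 * j) * be j c) (S (S k))).
      * rewrite (sm_shift (fun j => Derive_n f j c * s ^ (2 * j) * be j c)). unfold be at 1.
        rewrite Rmult_0_r, Rplus_0_l, <- sm_scal.
        change (sm (fun j => Derive_n f j c * s ^ (2 * j) * al j c) (S (S k))) with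
          (sm (fun j => Derive_n f j c * s ^ (2 * j) * al j c) (S k) + Derive_n f (S k) c * s ^ (2 * S k) * al (S k) c).
        assert (A0 : al (S k) c = 0).
        { unfold al. rewrite (Q0 (S k)) by lia.
          rewrite (Derive_ext (Q (S k)) (fun _ => 0)) by (intros; apply Q0; lia). rewrite Derive_const; ring. }
        rewrite A0, Rmult_0_r, Rplus_0_r, <- sm_plus. apply sm_ext; intros j _.
        unfold al, be. replace (2 * S j)%nat with (S (S (2 * j))) by lia.
        replace (s * (((- s * Derive_n f (S j) c) * Q j c + Derive_n f j c * (- s * Derive (Q j) c)) * s ^ (2 * j)
            + Derive_n f j c * Q j c * (INR (2 * j) * s ^ (2 * j - 1) * c)))
          with ((- (s * s) * Derive_n f (S j) c * Q j c + Derive_n f j c * (- (s * s) * Derive (Q j) c)) * s ^ (2 * j)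
            + Derive_n f j c * Q j c * ((INR (2 * j) * s ^ (2 * j - 1) * s) * c)) by ring.
        rewrite SP. replace (s ^ S (S (2 * j))) with (s * s * s ^ (2 * j)) by (rewrite <- !tech_pow_Rmult; ring).
        rewrite S2, plus_INR, mult_INR. replace (INR 2) with 2 by (simpl; ring). ring.
      * rewrite <- sm_scal, <- sm_plus. apply sm_ext; intros. ring.
Qed.

(** * The approximation of polynomials *)

Lemma sin_lip x y : Rabs (sin x - sin y) <= Rabs (x - y).
Proof.
  destruct (MVT_gen sin y x cos) as [c [_ E]].
  - intros; auto_derive; [easy|ring].
  - intros; apply derivable_continuous_pt, derivable_pt_sin.
  - rewrite E, Rabs_mult. assert (Rabs (cos c) <= 1) by (apply Rabs_le, COS_bound).
    generalize (Rabs_pos (x - y)); nra.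
Qed.

Lemma cos_open t : sin t <> 0 -> -1 < cos t < 1.
Proof.
  intros H. assert (E := sin2_cos2 t). unfold Rsqr in E.
  assert (0 < sin t * sin t) by (destruct (Rdichotomy _ _ H); nra). nra.
Qed.

(** For [|v - t| <= |sin t| / 2] the sine stays comparable to [sin t] in between, and the derivative
    [- sin w U' (cos w)] is at most [C / |sin w|]. For larger increments the bound [2 C] on
    [|G v - G t|] is already enough. *)
Lemma singular_derivative_lip (U G : R -> R) (C : R) : cont G -> 0 <= C ->
  (forall t, sin t <> 0 -> G t = U (cos t)) -> (forall x, -1 < x < 1 -> Rabs (U x) <= C) ->
  (forall x, -1 < x < 1 -> exists l, is_derive U x l /\ Rabs l * (1 - x ^ 2) <= C) ->
  forall t v, sin t <> 0 -> Rabs (G v - G t) <= 4 * C / Rabs (sin t) * Rabs (v - t).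
Proof.
  intros CG C0 HG HU HD.
  (* [v] may be a zero of [sin], where [G] is not given by [U]; there the bound follows by
     continuity from neighbouring points. *)
  assert (BG : forall t, Rabs (G t) <= C).
  { intros t. destruct (Req_dec (sin t) 0) as [Hs | Hs].
    2:{ rewrite HG by auto. apply HU. now apply cos_open. }
    apply le_epsilon; intros e He.
    assert (K : continuity_pt G t) by (apply continuity_pt_filterlim, CG).
    destruct (K e He) as [d [Hd Kd]].
    set (h := Rmin (d / 2) 1). assert (Hh : 0 < h <= 1 /\ h < d).
    { unfold h; generalize (Rmin_l (d / 2) 1) (Rmin_r (d / 2) 1); intros.
      repeat split; try lra. apply Rmin_glb_lt; lra. }
    assert (S1 : sin (t + h) <> 0).
    { rewrite sin_plus, Hs. assert (P3 := PI_gt3). assert (0 < sin h) by (apply sin_gt_0; lra).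
      assert (E := sin2_cos2 t). rewrite Hs in E. unfold Rsqr in E.
      intros Z. assert (cos t * sin h <> 0); [|lra].
      apply Rmult_integral_contrapositive_currified; [|lra]. intros Z'; rewrite Z' in E; lra. }
    assert (B1 := HU _ (cos_open _ S1)). rewrite <- HG in B1 by auto.
    specialize (Kd (t + h)). unfold dist in Kd; simpl in Kd; unfold Rdist in Kd.
    assert (Rabs (G (t + h) - G t) < e).
    { apply Kd. split; [split; [exact I|lra]|]. replace (t + h - t) with h by ring. rewrite Rabs_pos_eq; lra. }
    replace (G t) with (G (t + h) - (G (t + h) - G t)) by ring.
    eapply Rle_trans; [apply Rabs_triang|]. rewrite Rabs_Ropp; lra. }
  intros t v Hs.
  assert (S0 : 0 < Rabs (sin t)) by (now apply Rabs_pos_lt).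
  destruct (Rle_lt_dec (Rabs (v - t)) (Rabs (sin t) / 2)) as [Hv | Hv].
  - assert (K : forall w, Rabs (w - t) <= Rabs (v - t) -> Rabs (sin t) / 2 <= Rabs (sin w)).
    { intros w Hw. assert (L := sin_lip w t). assert (T := Rabs_triang (sin w) (sin t - sin w)).
      replace (sin w + (sin t - sin w)) with (sin t) in T by ring. rewrite (Rabs_minus_sym (sin t)) in T. lra. }
    assert (B : forall w, Rmin t v <= w <= Rmax t v -> Rabs (w - t) <= Rabs (v - t)).
    { intros w Hw. unfold Rmin, Rmax in Hw. destruct (Rle_dec t v); [rewrite !Rabs_pos_eq; lra|rewrite !Rabs_left1; lra]. }
    assert (S1 : forall w, Rmin t v <= w <= Rmax t v -> sin w <> 0).
    { intros w Hw Z. specialize (K w (B w Hw)). rewrite Z, Rabs_R0 in K. lra. }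
    assert (D : forall w, Rmin t v <= w <= Rmax t v -> exists l, is_derive (fun w => U (cos w)) w l /\
       Rabs l <= 2 * C / Rabs (sin t)).
    { intros w Hw. destruct (HD _ (cos_open _ (S1 w Hw))) as [l [Hl Bl]].
      exists (- sin w * l); split.
      - apply (is_derive_compR U cos); [auto|]. auto_derive; [easy|ring].
      - rewrite Rabs_mult, Rabs_Ropp. specialize (K w (B w Hw)).
        assert (E : 1 - cos w ^ 2 = Rabs (sin w) * Rabs (sin w)).
        { rewrite <- Rabs_mult, Rabs_pos_eq by (apply Rle_0_sqr). generalize (sin2_cos2 w); unfold Rsqr; simpl; lra. }
        rewrite E in Bl. apply (Rle_div_r _ _ _ S0).
        apply Rle_trans with (Rabs (sin w) * Rabs l * (2 * Rabs (sin w))); [|lra].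
        apply Rmult_le_compat_l; [apply Rmult_le_pos; apply Rabs_pos|lra]. }
    destruct (MVT_gen (fun w => U (cos w)) t v (Derive (fun w => U (cos w)))) as [xi [Hxi E]].
    + intros w Hw. destruct (D w ltac:(lra)) as [l [Hl _]]. apply Derive_correct. now exists l.
    + intros w Hw. destruct (D w ltac:(lra)) as [l [Hl _]].
      apply derivable_continuous_pt. exists l. now apply is_derive_Reals.
    + assert (M1 := Rmin_l t v). assert (M2 := Rmax_l t v). assert (M3 := Rmin_r t v). assert (M4 := Rmax_r t v).
      rewrite (HG v), (HG t) by (apply S1; lra). rewrite E, Rabs_mult.
      destruct (D xi Hxi) as [l [Hl Bl]]. rewrite (is_derive_unique (fun w : R => U (cos w)) xi l Hl : Derive (fun w : R => U (cos w)) xi = l).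
      apply Rmult_le_compat_r; [apply Rabs_pos|]. eapply Rle_trans; [apply Bl|].
      apply Rmult_le_compat_r; [left; now apply Rinv_0_lt_compat|lra].
  - apply Rle_trans with (2 * C).
    + eapply Rle_trans; [apply Rabs_triang|]. rewrite Rabs_Ropp. generalize (BG v) (BG t); lra.
    + replace (4 * C / Rabs (sin t) * Rabs (v - t)) with (4 * C * Rabs (v - t) / Rabs (sin t)) by (unfold Rdiv; ring).
      apply (Rle_div_r _ _ _ S0). assert (C * Rabs (sin t) <= C * (2 * Rabs (v - t))) by (apply Rmult_le_compat_l; lra). lra.
Qed.

Lemma ctrig_coefs n g : ctrig n g -> exists a, forall t,
  g t = a 0%nat + sm (fun k => a (S k) * cos (INR (S k) * t)) n.
Proof.
  intros H. cut (exists a, forall t, g t = sm (fun k => a k * cos (INR k * t)) (S n)).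
  { intros [a Ha]. exists a; intros t. rewrite Ha, sm_shift. f_equal. simpl INR. rewrite Rmult_0_l, cos_0; ring. }
  induction H as [u [k [Hk ->]]| |u v Hu [a IHu] Hv [b IHv]|c u Hu [a IHu]|u v Hu [a IHu] E].
  - exists (fun i => if Nat.eq_dec k i then 1 else 0). intros t.
    rewrite (sm_ext _ (fun i => if Nat.eq_dec k i then (fun i => cos (INR i * t)) i else 0)).
    + rewrite sm_delta. destruct (lt_dec k (S n)); [easy|lia].
    + intros i _. destruct (Nat.eq_dec k i); ring.
  - exists (fun _ => 0); intros; rewrite sm_zero; intros; ring.
  - exists (fun i => a i + b i); intros. rewrite IHu, IHv, <- sm_plus. apply sm_ext; intros; ring.
  - exists (fun i => c * a i); intros. rewrite IHu, <- sm_scal. apply sm_ext; intros; ring.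
  - exists a; intros; now rewrite <- E.
Qed.

(** Each derivative multiplies a term by its frequency and advances the phase by [PI / 2]. The
    frequencies are arbitrary because both all positive integers and the odd ones are needed. *)
Lemma trig_antiderivative r K a (n : nat -> nat) D : (forall k, (k < K)%nat -> (1 <= n k <= D)%nat) ->
  exists G, trig D G /\
  (forall t, G t = sm (fun k => a k / INR (n k) ^ r * cos (INR (n k) * t - INR r * (PI / 2))) K) /\
  forall t, Derive_n G r t = sm (fun k => a k * cos (INR (n k) * t)) K.
Proof.
  intros Hn.
  set (T := fun i k t => a k / INR (n k) ^ r * INR (n k) ^ i * cos (INR (n k) * t - (INR r - INR i) * (PI / 2))).
  exists (fun t => sm (fun k => T 0%nat k t) K); repeat split.
  - apply (span_sm _ (T 0%nat)). intros k Hk. apply span_scal.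
    apply (trig_phase (- ((INR r - INR 0) * (PI / 2)))), Hn, Hk.
  - intros t. apply sm_ext; intros k _. unfold T. simpl (INR 0). rewrite Rminus_0_r. simpl (_ ^ 0). ring.
  - intros t. rewrite (chain_Derive_n (fun i t => sm (fun k => T i k t) K)).
    + apply sm_ext; intros k Hk. specialize (Hn k Hk). unfold T. rewrite Rminus_diag, Rmult_0_l, Rminus_0_r. field.
      apply pow_nonzero, not_0_INR; lia.
    + intros i x. apply (is_derive_sm (T i) (T (S i))).
      intros k _. unfold T. set (b := INR (n k)). set (c := a k / b ^ r).
      auto_derive; [easy|]. rewrite (S_INR i).
      replace (b * x - (INR r - (INR i + 1)) * (PI / 2)) with (PI / 2 + (b * x + - ((INR r - INR i) * (PI / 2)))) by field.
      rewrite (cos_plus (PI / 2)), cos_PI2, sin_PI2. simpl (b ^ S i). unfold Rminus. ring.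
Qed.

Lemma derivs_bound_from_left r f : smooth f -> (forall x, inI x -> Rabs (Derive_n f r x) <= 1) ->
  (forall i, (i < r)%nat -> Derive_n f i (-1) = 0) ->
  forall i x, (i <= r)%nat -> inI x -> Rabs (Derive_n f i x) <= 2 ^ r.
Proof.
  intros Sf H V. destruct (smooth_Ichain f r Sf) as [HC HD].
  assert (K : forall j, (j <= r)%nat -> forall x, inI x -> Rabs (Derive_n f (r - j) x) <= 2 ^ j).
  { induction j; intros Hj x Hx; [rewrite Nat.sub_0_r; simpl; auto|].
    destruct (mvt_I (Derive_n f (r - S j)) (Derive_n f (r - j)) (-1) x) as [xi [Hxi E]].
    - apply HC; lia.
    - intros z Hz. replace (r - j)%nat with (S (r - S j)) by lia. apply HD; [lia|auto].
    - unfold inI; lra.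
    - auto.
    - apply Hx.
    - unfold inI in *. rewrite V in E by lia.
      rewrite Rminus_0_r in E. rewrite E, Rabs_mult, (Rabs_pos_eq (x - -1)) by lra.
      specialize (IHj ltac:(lia) xi ltac:(lra)). simpl pow.
      generalize (Rabs_pos (Derive_n f (r - j) xi)); nra. }
  intros i x Hi Hx. specialize (K (r - i)%nat ltac:(lia) x Hx). replace (r - (r - i))%nat with i in K by lia.
  eapply Rle_trans; [apply K|]. apply Rle_pow; [lra|lia].
Qed.

Lemma Kr_bounds r : (1 <= r)%nat -> 0 <= Kr r <= 3.
Proof.
  intros Hr. assert (H := Kr_approx r 1 Hr (le_n 1)). cbn [sm] in H.
  assert (E := Kr_term_0 r).
  rewrite E in H. simpl INR in H. rewrite Rinv_1 in H. apply Rabs_le_between in H.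
  assert (P3 := PI_gt3). split; [|].
  - assert (0 <= Kr r * PI) by lra. apply Rmult_le_reg_r with PI; lra.
  - nra.
Qed.

Lemma polys_bounded n (Q : nat -> R -> R) : (forall j, exists m, poly m (Q j)) ->
  exists B, 0 <= B /\ forall j x, (j < n)%nat -> inI x -> Rabs (Q j x) <= B /\ Rabs (Derive (Q j) x) <= B.
Proof.
  intros H. induction n as [|n [B [B0 IH]]].
  - exists 0; split; [lra|lia].
  - destruct (H n) as [m Hm]. destruct (poly_bounded_derivs m (Q n) 1 Hm) as [B' [B0' HB]].
    exists (B + B'); split; [lra|]. intros j x Hj Hx. destruct (Nat.eq_dec j n) as [-> | Hn].
    + assert (K0 := HB 0%nat x ltac:(lia) Hx). assert (K1 := HB 1%nat x ltac:(lia) Hx). change (Rabs (Q n x) <= B') in K0. change (Rabs (Derive (Q n) x) <= B') in K1. lra.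
    + specialize (IH j x ltac:(lia) Hx). lra.
Qed.

(** The order of vanishing compensates the denominators, so each quotient is bounded; a derivative
    raises the order of one factor and costs a single power of [1 - x ^ 2]. These are the hypotheses
    of [singular_derivative_lip]. *)
Lemma lower_order_bounds r f Q A B : smooth f -> 0 <= A -> 0 <= B ->
  (forall j x, (j <= r)%nat -> inI x -> Rabs (Derive_n f j x) <= A * (1 - x ^ 2) ^ (r - j)) ->
  (forall j, exists m, poly m (Q j)) ->
  (forall j x, (j < r)%nat -> inI x -> Rabs (Q j x) <= B /\ Rabs (Derive (Q j) x) <= B) ->
  forall x, -1 < x < 1 ->
  Rabs (sm (fun j => Derive_n f j x * Q j x / (1 - x ^ 2) ^ (r - j)) r) <= INR r * (A * B * (2 + 2 * INR r)) /\
  exists l, is_derive (fun x => sm (fun j => Derive_n f j x * Q j x / (1 - x ^ 2) ^ (r - j)) r) x l /\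
    Rabs l * (1 - x ^ 2) <= INR r * (A * B * (2 + 2 * INR r)).
Proof.
  intros Sf HA HB Hf PQ HQ x Hx.
  set (d := 1 - x ^ 2). assert (Hd : 0 < d <= 1) by (unfold d; nra).
  assert (HxI : inI x) by (unfold inI; lra).
  assert (R0 := pos_INR r).
  assert (T0 : forall j, (j < r)%nat -> Rabs (Derive_n f j x * Q j x / d ^ (r - j)) <= A * B).
  { intros j Hj. assert (Pd : 0 < d ^ (r - j)) by (apply pow_lt; lra).
    unfold Rdiv. rewrite !Rabs_mult, Rabs_inv, (Rabs_pos_eq (d ^ (r - j))) by lra.
    apply (Rle_div_l _ _ _ Pd). destruct (HQ j x Hj HxI) as [q1 _].
    assert (F := Hf j x ltac:(lia) HxI). fold d in F.
    apply Rle_trans with (A * d ^ (r - j) * B); [|lra].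
    apply Rmult_le_compat; try apply Rabs_pos; auto. }
  split.
  - eapply Rle_trans; [apply sm_abs|]. rewrite <- sm_const. apply sm_le; intros j Hj.
    eapply Rle_trans; [apply T0; auto|]. assert (0 <= A * B) by nra. nra.
  - set (dl := fun j => (Derive_n f (S j) x * Q j x + Derive_n f j x * Derive (Q j) x) / d ^ (r - j)
        + Derive_n f j x * Q j x * (INR (r - j) * (2 * x)) / (d ^ (r - j) * d)).
    exists (sm dl r); split.
    + apply (is_derive_sm (fun j x => Derive_n f j x * Q j x / (1 - x ^ 2) ^ (r - j)) (fun j _ => dl j)).
      intros j Hj. destruct (PQ j) as [m Hm].
      assert (D1 : is_derive (fun x => Derive_n f j x * Q j x) x (Derive_n f (S j) x * Q j x + Derive_n f j x * Derive (Q j) x)).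
      { apply is_derive_multR; [apply Sf|apply (poly_smooth m _ Hm 0%nat)]. }
      assert (Pd : 0 < d ^ (r - j)) by (apply pow_lt; lra).
      eapply is_derive_val.
      * apply (is_derive_div (fun x => Derive_n f j x * Q j x) (fun x => (1 - x ^ 2) ^ (r - j)) x
          (Derive_n f (S j) x * Q j x + Derive_n f j x * Derive (Q j) x)
          (INR (r - j) * (- 2 * x) * d ^ (r - j - 1))); [exact D1| |fold d; lra].
        unfold d. auto_derive; [easy|]. replace (Init.Nat.pred (r - j)) with (r - j - 1)%nat by lia.
        replace (1 + - (x * (x * 1))) with (1 - x ^ 2) by ring. ring.
      * fold d. unfold dl.
        assert (Ed : d ^ (r - j) = d * d ^ (r - j - 1)).
        { replace (r - j)%nat with (S (r - j - 1)) at 1 by lia. simpl; ring. }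
        rewrite !Ed. eqR. field. repeat split; try lra; apply pow_nonzero; lra.
    + rewrite <- (Rabs_pos_eq d), <- Rabs_mult, Rmult_comm, <- sm_scal by lra.
      eapply Rle_trans; [apply sm_abs|]. rewrite <- sm_const. apply sm_le; intros j Hj.
      assert (Pd : 0 < d ^ (r - j)) by (apply pow_lt; lra).
      assert (Pd' : 0 < d ^ (r - S j)) by (apply pow_lt; lra).
      assert (Ed : d ^ (r - j) = d * d ^ (r - S j)).
      { replace (r - j)%nat with (S (r - S j)) by lia. simpl; ring. }
      replace (d * dl j) with (Derive_n f (S j) x / d ^ (r - S j) * Q j x + Derive_n f j x / d ^ (r - j) * (d * Derive (Q j) x)
        + Derive_n f j x / d ^ (r - j) * (Q j x * (INR (r - j) * (2 * x)))).
      2:{ unfold dl. rewrite Ed. field. lra. }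
      assert (F0 : Rabs (Derive_n f j x / d ^ (r - j)) <= A).
      { unfold Rdiv. rewrite Rabs_mult, Rabs_inv, (Rabs_pos_eq (d ^ (r - j))) by lra.
        apply (Rle_div_l _ _ _ Pd). apply Hf; [lia|auto]. }
      assert (F1 : Rabs (Derive_n f (S j) x / d ^ (r - S j)) <= A).
      { unfold Rdiv. rewrite Rabs_mult, Rabs_inv, (Rabs_pos_eq (d ^ (r - S j))) by lra.
        apply (Rle_div_l _ _ _ Pd'). apply Hf; [lia|auto]. }
      destruct (HQ j x Hj HxI) as [q0 q1].
      assert (rj : 0 <= INR (r - j) <= INR r) by (split; [apply pos_INR|apply le_INR; lia]).
      assert (X1 : Rabs x <= 1) by (apply Rabs_le; lra).
      assert (B1 : Rabs (Derive_n f (S j) x / d ^ (r - S j) * Q j x) <= A * B).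
      { rewrite Rabs_mult. apply Rmult_le_compat; try apply Rabs_pos; auto. }
      assert (B2 : Rabs (Derive_n f j x / d ^ (r - j) * (d * Derive (Q j) x)) <= A * B).
      { rewrite !(Rabs_mult (_ / _)), (Rabs_mult d), (Rabs_pos_eq d) by lra.
        apply Rmult_le_compat; [apply Rabs_pos|apply Rmult_le_pos; [lra|apply Rabs_pos]|auto|].
        generalize (Rabs_pos (Derive (Q j) x)); nra. }
      assert (B3 : Rabs (Derive_n f j x / d ^ (r - j) * (Q j x * (INR (r - j) * (2 * x)))) <= A * (B * (INR r * 2))).
      { rewrite (Rabs_mult (_ / _)). apply Rmult_le_compat; try apply Rabs_pos; auto.
        rewrite Rabs_mult. apply Rmult_le_compat; try apply Rabs_pos; auto.
        rewrite Rabs_mult, (Rabs_pos_eq (INR (r - j))) by lra.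
        apply Rmult_le_compat; [lra|apply Rabs_pos|lra|]. rewrite Rabs_mult, (Rabs_pos_eq 2) by lra. lra. }
      eapply Rle_trans; [apply Rabs_triang|]. eapply Rle_trans; [apply Rplus_le_compat_r, Rabs_triang|]. lra.
Qed.

Lemma pow_abs_even_sin t r : Rabs (sin (- t)) ^ r = Rabs (sin t) ^ r.
Proof. now rewrite sin_neg, Rabs_Ropp. Qed.

(** The vanishing at -1 bounds all lower derivatives of [f] by [2 ^ r]. This is why the Hermite data
    at 1, and hence [C], are controlled independently of [D] and [f]. *)
Lemma poly_core r : (1 <= r)%nat -> exists C, 0 <= C /\ forall D f, poly D f ->
  (forall x, inI x -> Rabs (Derive_n f r x) <= 1) -> (forall i, (i < r)%nat -> Derive_n f i (-1) = 0) ->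
  forall M, (r <= M)%nat -> exists p, poly (M + r - 1) p /\ forall x, inI x ->
  Rabs (f x - p x) <= Kr r * sqrt (1 - x ^ 2) ^ r / INR M ^ r + C * sqrt (1 - x ^ 2) ^ (r - 1) / INR M ^ (r + 1).
Proof.
  intros Hr.
  (* Order [S r] is included because the derivative of the remainder contains the derivative of
     order [r + 1] of the interpolant. *)
  destruct (hermite_interp r (S r) r (le_n r) ltac:(lia)) as [C1 [C10 HH]].
  destruct (sin_quotient_derivs r r) as [Q [PQ [Qr [_ HQ]]]].
  destruct (polys_bounded r Q PQ) as [B [B0 HB]].
  destruct (jackson r) as [CJ [CJ0 HJ]].
  set (A0 := 2 ^ r). assert (A00 : 0 < A0) by (apply pow_lt; lra).
  set (A := 1 + C1 * A0). assert (HA : 0 <= A) by (unfold A; nra).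
  assert (R0 := pos_INR r).
  set (CS := INR r * (A * B * (2 + 2 * INR r)) + C1 * A0).
  assert (CS0 : 0 <= CS).
  { unfold CS. assert (0 <= A * B) by nra. assert (0 <= A * B * (2 + 2 * INR r)) by nra. nra. }
  destruct (Kr_bounds r Hr) as [K0 _].
  exists (1 + CJ * (4 * CS)); split; [nra|].
  intros D f Pf Hf1 Hf0 M HM.
  assert (Sf := poly_smooth _ _ Pf).
  assert (Hfb := derivs_bound_from_left r f Sf Hf1 Hf0).
  destruct (HH A0 (fun i => Derive_n f i 1)) as [q [Pq [q0 [q1 qB]]]]; [lra| |].
  { intros i Hi. apply Hfb; [lia|unfold inI; lra]. }
  assert (Sq := poly_smooth _ _ Pq).
  set (f1 := fun x => f x - q x).
  assert (Pf1 : poly (D + (r + r - 1)) f1).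
  { apply span_minus; [eapply poly_mono; [|apply Pf]; lia|eapply poly_mono; [|apply Pq]; lia]. }
  assert (Sf1 := poly_smooth _ _ Pf1).
  assert (D1 : forall i x, Derive_n f1 i x = Derive_n f i x - Derive_n q i x).
  { intros; now apply Derive_n_minus_smooth. }
  assert (V1 : forall i, (i < r)%nat -> Derive_n f1 i (-1) = 0 /\ Derive_n f1 i 1 = 0).
  { intros i Hi. rewrite !D1, Hf0, q0, q1 by auto. lra. }
  assert (VB : forall j x, (j <= r)%nat -> inI x -> Rabs (Derive_n f1 j x) <= A * (1 - x ^ 2) ^ (r - j)).
  { apply vanish_bound; [apply smooth_Ichain, Sf1| |auto].
    intros x Hx. rewrite D1. eapply Rle_trans; [apply Rabs_triang|]. rewrite Rabs_Ropp.
    specialize (Hf1 x Hx). specialize (qB r x ltac:(lia) Hx). unfold A. lra. }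
  destruct (poly_div_both _ r f1 Pf1 V1) as [phi [Pphi Ephi]].
  set (g := fun t => sin t ^ r * phi (cos t)).
  assert (Tg : trig (r + (D + (r + r - 1))) g).
  { apply (trig_mult r (D + (r + r - 1))); [|apply ctrig_trig, poly_cos_ctrig, Pphi|lia].
    apply (trig_powf 1); [apply trig_sin1|lia]. }
  assert (Sg := trig_smooth _ _ Tg).
  assert (Eg : forall t, g t * sin t ^ r = f1 (cos t)).
  { intros t. rewrite Ephi. unfold g. replace (1 - cos t ^ 2) with (sin t * sin t).
    - rewrite Rpow_mult_distr; ring.
    - generalize (sin2_cos2 t); unfold Rsqr; simpl; lra. }
  assert (HQ' := HQ f1 g Sf1 Sg Eg). clear HQ.
  set (U := fun x => sm (fun j => Derive_n f1 j x * Q j x / (1 - x ^ 2) ^ (r - j)) r + - (-1) ^ r * Derive_n q r x).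
  set (RR := fun t => Derive_n g r t - (-1) ^ r * Derive_n f r (cos t)).
  assert (Th : ctrig D (fun t => Derive_n f r (cos t))).
  { apply (poly_cos_ctrig D (Derive_n f r)), poly_Derive_n, Pf. }
  assert (CR : cont RR).
  { unfold RR. apply cont_minus; [eapply cont_trig, trig_Derive_n, Tg|].
    apply cont_mult; [apply cont_const|]. eapply cont_trig, ctrig_trig, Th. }
  assert (ER : forall t, sin t <> 0 -> RR t = U (cos t)).
  { intros t Ht. specialize (HQ' t). change (sm _ (S r)) with
      (sm (fun j => Derive_n f1 j (cos t) * Q j (cos t) * sin t ^ (2 * j)) r + Derive_n f1 r (cos t) * Q r (cos t) * sin t ^ (2 * r)) in HQ'.
    replace (r + r)%nat with (2 * r)%nat in HQ' by lia.
    assert (Z : sin t ^ (2 * r) <> 0) by (now apply pow_nonzero).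
    apply Rmult_eq_reg_r with (sin t ^ (2 * r)); [|auto].
    unfold RR, U. rewrite Rmult_minus_distr_r, HQ', Qr, D1, Rmult_plus_distr_r.
    rewrite (Rmult_comm (sm (fun j => Derive_n f1 j (cos t) * Q j (cos t) / (1 - cos t ^ 2) ^ (r - j)) r)), <- sm_scal.
    rewrite (sm_ext (fun i => sin t ^ (2 * r) * (Derive_n f1 i (cos t) * Q i (cos t) / (1 - cos t ^ 2) ^ (r - i)))
       (fun j => Derive_n f1 j (cos t) * Q j (cos t) * sin t ^ (2 * j))); [ring|].
    intros j Hj. replace (1 - cos t ^ 2) with (sin t ^ 2) by (generalize (sin2_cos2 t); unfold Rsqr; simpl; lra).
    rewrite <- pow_mult. replace (2 * r)%nat with (2 * (r - j) + 2 * j)%nat by lia. rewrite pow_add.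
    field. now apply pow_nonzero. }
  assert (LB := lower_order_bounds r f1 Q A B Sf1 HA B0 VB PQ HB).
  assert (LIP : forall t v, sin t <> 0 -> Rabs (RR v - RR t) <= 4 * CS / Rabs (sin t) * Rabs (v - t)).
  { apply (singular_derivative_lip U RR CS CR CS0 ER).
    - intros x Hx. unfold U, CS. eapply Rle_trans; [apply Rabs_triang|].
      apply Rplus_le_compat; [now apply LB|]. rewrite Rabs_mult, Rabs_Ropp, abs_pm1, Rmult_1_l.
      apply qB; [lia|unfold inI; lra].
    - intros x Hx. destruct (LB x Hx) as [_ [l [Hl Bl]]].
      exists (l + - (-1) ^ r * Derive_n q (S r) x); split.
      + apply @is_derive_plus; [auto|]. apply is_derive_scal, Sq.
      + assert (Bq := qB (S r) x ltac:(lia) ltac:(unfold inI; lra)).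
        assert (0 < 1 - x ^ 2 <= 1) by nra.
        apply Rle_trans with ((Rabs l + Rabs (Derive_n q (S r) x)) * (1 - x ^ 2)).
        * apply Rmult_le_compat_r; [lra|]. eapply Rle_trans; [apply Rabs_triang|].
          rewrite (Rabs_mult (- _)), Rabs_Ropp, abs_pm1; lra.
        * rewrite Rmult_plus_distr_r. unfold CS. apply Rplus_le_compat; [auto|].
          generalize (Rabs_pos (Derive_n q (S r) x)); nra. }
  destruct (ctrig_coefs _ _ Th) as [a Ha].
  destruct (trig_antiderivative r D (fun k => a (S k)) S D) as [G [TG [EG DG]]]; [intros; lia|].
  (* [G] integrates [f^(r) (cos t)] without its mean, so the [r]-th derivative of [gB] differs from
     [RR] by a constant, which does not affect increments. *)
  set (gB := fun t => g t - (-1) ^ r * G t).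
  assert (TgB : trig (r + (D + (r + r - 1))) gB).
  { apply span_minus; [auto|]. apply span_scal. eapply trig_mono; [|apply TG]; lia. }
  assert (DgB : forall v t, Derive_n gB r v - Derive_n gB r t = RR v - RR t).
  { intros v t. assert (SG := trig_smooth _ _ TG).
    assert (K : forall t, Derive_n gB r t = RR t + (-1) ^ r * a 0%nat).
    { intros s. unfold gB. rewrite Derive_n_minus_smooth, Derive_n_scal_smooth, DG; [|auto|auto|].
      - unfold RR. rewrite Ha. ring.
      - eapply trig_smooth, span_scal, TG. }
    rewrite !K; ring. }
  assert (M1 : 1 <= INR M) by (apply (le_INR 1); lia).
  assert (Mr : 0 < INR M ^ (r + 1)) by (apply pow_lt; lra).
  (* The slack in Favard's theorem is of the order of the second term and contributes the 1 in the
     constant. *)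
  destruct (favard r M D a (/ INR M ^ (r + 1)) Hr ltac:(lia)) as [TA [HTA ETA]].
  { now apply Rinv_0_lt_compat. }
  { intros t. rewrite <- Ha. apply Hf1, COS_bound. }
  destruct (HJ (M - 1)%nat _ gB TgB) as [TB [HTB ETB]].
  set (P := fun t => sin t ^ r * ((-1) ^ r * TA t + TB t)).
  assert (TP : trig (M + r - 1) P).
  { apply (trig_mult r (M - 1)); [|apply span_plus; [now apply span_scal|auto]|lia].
    apply (trig_powf 1); [apply trig_sin1|lia]. }
  (* [P] need not be even. Its even part is as good, since the approximated function and the error
     bound are both even. *)
  destruct (ctrig_poly_cos _ _ (trig_even_part _ _ TP)) as [p0 [Pp0 Ep0]].
  exists (fun x => q x + p0 x); split.
  { apply span_plus; [eapply poly_mono; [|apply Pq]; lia|auto]. }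
  assert (MAIN : forall s, Rabs (f1 (cos s) - P s) <= Kr r * Rabs (sin s) ^ r / INR M ^ r
     + (1 + CJ * (4 * CS)) * Rabs (sin s) ^ (r - 1) / INR M ^ (r + 1)).
  { intros s. rewrite <- Eg. unfold P.
    replace (g s * sin s ^ r - sin s ^ r * ((-1) ^ r * TA s + TB s))
      with (sin s ^ r * ((-1) ^ r * (G s - TA s) + (gB s - TB s))) by (unfold gB; ring).
    rewrite Rabs_mult, <- RPow_abs.
    set (z := Rabs (sin s)).
    assert (Er : z ^ r = z * z ^ (r - 1)) by (replace r with (S (r - 1)) at 1 by lia; simpl; ring).
    assert (z0 : 0 <= z <= 1) by (split; [apply Rabs_pos|apply Rabs_le, SIN_bound]).
    assert (zr : 0 <= z ^ (r - 1)) by (apply pow_le; lra).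
    assert (IM : 0 < / INR M ^ (r + 1)) by (now apply Rinv_0_lt_compat).
    assert (IM' : 0 < / INR M ^ r) by (apply Rinv_0_lt_compat, pow_lt; lra).
    destruct (Req_dec (sin s) 0) as [Hs | Hs].
    - assert (Z : z = 0) by (unfold z; rewrite Hs; apply Rabs_R0).
      rewrite Er, Z, Rmult_0_l. rewrite Z in zr.
      assert (0 <= (1 + CJ * (4 * CS)) * 0 ^ (r - 1) / INR M ^ (r + 1)).
      { apply Rmult_le_pos; [|lra]. apply Rmult_le_pos; [nra|auto]. }
      unfold Rdiv in *. lra.
    - assert (zp : 0 < z) by (now apply Rabs_pos_lt).
      specialize (ETA s). rewrite <- EG in ETA.
      specialize (ETB s (4 * CS / z)). replace (S (M - 1)) with M in ETB by lia.
      assert (E2 : Rabs (gB s - TB s) <= CJ * (4 * CS / z) / INR M ^ S r).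
      { apply ETB.
        - apply Rdiv_le_0_compat; lra.
        - intros v. rewrite DgB. now apply LIP. }
      replace (S r) with (r + 1)%nat in E2 by lia.
      assert (E3 : Rabs ((-1) ^ r * (G s - TA s) + (gB s - TB s)) <=
         Kr r / INR M ^ r + / INR M ^ (r + 1) + CJ * (4 * CS / z) / INR M ^ (r + 1)).
      { eapply Rle_trans; [apply Rabs_triang|]. rewrite (Rabs_mult _ (G s - TA s)), abs_pm1. lra. }
      apply Rle_trans with (z ^ r * (Kr r / INR M ^ r + / INR M ^ (r + 1) + CJ * (4 * CS / z) / INR M ^ (r + 1))).
      + apply Rmult_le_compat_l; [apply pow_le; lra|auto].
      + replace (z ^ r * (Kr r / INR M ^ r + / INR M ^ (r + 1) + CJ * (4 * CS / z) / INR M ^ (r + 1)))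
          with (Kr r * z ^ r / INR M ^ r + (z ^ (r - 1) * z + CJ * (4 * CS) * z ^ (r - 1)) / INR M ^ (r + 1)).
        2:{ rewrite Er. field. repeat split; try lra; apply pow_nonzero; lra. }
        apply Rplus_le_compat_l. unfold Rdiv. apply Rmult_le_compat_r; [lra|]. nra. }
  intros x Hx. set (t := acos x).
  assert (Ct : cos t = x) by (apply cos_acos, Hx).
  assert (St : Rabs (sin t) = sqrt (1 - x ^ 2)).
  { unfold t. rewrite sin_acos by apply Hx. rewrite Rsqr_pow2. apply Rabs_pos_eq, sqrt_pos. }
  assert (Hp : f x - (q x + p0 x) = / 2 * ((f1 (cos t) - P t) + (f1 (cos (- t)) - P (- t)))).
  { rewrite cos_neg, Ct. rewrite <- Ct at 3. rewrite <- Ep0. unfold f1. field. }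
  rewrite Hp, Rabs_mult, (Rabs_pos_eq (/ 2)) by lra.
  assert (N1 := MAIN t). assert (N2 := MAIN (- t)). rewrite !pow_abs_even_sin in N2. rewrite St in N1, N2.
  assert (T := Rabs_triang (f1 (cos t) - P t) (f1 (cos (- t)) - P (- t))). lra.
Qed.

(** * Endpoint corrections, small degrees and the estimate for all degrees *)

Lemma poly_high_deriv n f k x : poly n f -> (n < k)%nat -> Derive_n f k x = 0.
Proof.
  revert f k x; induction n; intros f k x Hf Hk; destruct k; try lia.
  - apply poly_eval_poly in Hf as [a Ha].
    rewrite (Derive_n_ext f (fun _ => a 0%nat)) by (intros t; rewrite Ha; unfold poly_eval; simpl; ring).
    apply Derive_n_const.
  - rewrite Derive_n_S. apply IHn; [|lia].
    destruct (poly_derive _ _ Hf) as [d [Hd E]]. replace (S n - 1)%nat with n in Hd by lia.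
    apply (span_ext _ _ _ Hd). intros y; symmetry; now apply is_derive_unique.
Qed.

Lemma taylor_at f c d : smooth f -> exists p, poly (d - 1) p /\
  forall i, (i < d)%nat -> Derive_n p i c = Derive_n f i c.
Proof.
  intros Sf. induction d as [|d [p [Pp Ep]]].
  - exists (fun _ => 0); split; [apply poly_const|lia].
  - assert (Pl : poly (d + 0) (fun x => (x - c) ^ d * 1)) by (apply poly_linpow, poly_const).
    set (b := (Derive_n f d c - Derive_n p d c) / INR (fact d)).
    assert (N0 : INR (fact d) <> 0) by apply INR_fact_neq_0.
    exists (fun x => p x + b * ((x - c) ^ d * 1)); split.
    + apply span_plus; [eapply poly_mono; [|apply Pp]; lia|]. apply span_scal. eapply poly_mono; [|apply Pl]; lia.
    + intros i Hi.
      assert (Sl := poly_smooth _ _ Pl).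
      rewrite Derive_n_plus_smooth, Derive_n_scal_smooth;
        [|auto|eapply poly_smooth, Pp|eapply poly_smooth, span_scal, Pl].
      destruct (Nat.eq_dec i d) as [-> | Hn].
      * rewrite (Derive_n_diag 0 c d (fun _ => 1)) by apply poly_const. unfold b. field; auto.
      * rewrite (Derive_n_vanish 0 c d (fun _ => 1)) by (apply poly_const || lia). rewrite Ep by lia. ring.
Qed.

Lemma Ichain_minus m F G : Ichain m F -> Ichain m G -> Ichain m (fun i x => F i x - G i x).
Proof.
  intros [FC FD] [GC GD]; split.
  - intros k Hk x Hx e He.
    destruct (FC k Hk x Hx (e / 2) ltac:(lra)) as [d1 [Hd1 K1]].
    destruct (GC k Hk x Hx (e / 2) ltac:(lra)) as [d2 [Hd2 K2]].
    exists (Rmin d1 d2); split; [apply Rmin_glb_lt; lra|]. intros y Hy Hd.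
    specialize (K1 y Hy ltac:(generalize (Rmin_l d1 d2); lra)).
    specialize (K2 y Hy ltac:(generalize (Rmin_r d1 d2); lra)).
    replace (F k y - G k y - (F k x - G k x)) with ((F k y - F k x) - (G k y - G k x)) by ring.
    eapply Rle_lt_trans; [apply Rabs_triang|]. rewrite Rabs_Ropp. lra.
  - intros k x Hk Hx. apply derivable_pt_lim_minus; auto.
Qed.

Lemma Ichain_mono m n F : (n <= m)%nat -> Ichain m F -> Ichain n F.
Proof. intros H [FC FD]; split; intros; [apply FC|apply FD]; auto; lia. Qed.

Lemma sqrt_pow_half r x : inI x ->
  (1 - x ^ 2) ^ (r / 2) <= sqrt (1 - x ^ 2) ^ (r - 1).
Proof.
  intros Hx. assert (D : 0 <= 1 - x ^ 2 <= 1) by (unfold inI in Hx; nra).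
  set (s := sqrt (1 - x ^ 2)).
  assert (S0 : 0 <= s <= 1).
  { split; [apply sqrt_pos|]. rewrite <- sqrt_1. apply sqrt_le_1_alt; lra. }
  assert (E : 1 - x ^ 2 = s ^ 2) by (unfold s; rewrite pow2_sqrt; lra).
  rewrite E, <- pow_mult.
  assert (r <= 2 * (r / 2) + 1)%nat.
  { generalize (Nat.div_mod r 2 ltac:(lia)) (Nat.mod_upper_bound r 2 ltac:(lia)); lia. }
  replace (2 * (r / 2))%nat with ((r - 1) + (2 * (r / 2) - (r - 1)))%nat by lia.
  rewrite pow_add. assert (0 <= s ^ (r - 1)) by (apply pow_le; lra).
  assert (s ^ (2 * (r / 2) - (r - 1)) <= 1).
  { rewrite <- (pow1 (2 * (r / 2) - (r - 1))). apply pow_incr; lra. }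
  assert (0 <= s ^ (2 * (r / 2) - (r - 1))) by (apply pow_le; lra). nra.
Qed.

(** Half of [r], rounded down, balances two demands: that many conditions at each endpoint fit into
    degree [r - 1], and zeros of that order give [(1 - x ^ 2) ^ (r / 2)], at most the required power
    [r - 1] of the square root. *)
Lemma endpoint_correction r : (1 <= r)%nat -> exists C, 0 <= C /\ forall F e, 0 <= e -> Ichain (r / 2) F ->
  (forall i x, (i <= r / 2)%nat -> inI x -> Rabs (F i x) <= e) ->
  (forall i, (i < r / 2)%nat -> F i (-1) = 0) ->
  exists q, poly (r - 1) q /\ forall x, inI x -> Rabs (F 0%nat x - q x) <= C * e * sqrt (1 - x ^ 2) ^ (r - 1).
Proof.
  intros Hr. set (k := (r / 2)%nat).
  assert (Hk : (2 * k <= r)%nat) by (apply Nat.Div0.mul_div_le).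
  destruct (hermite_interp k k k (le_n k) (le_n k)) as [C [C0 HC]].
  exists (1 + C); split; [lra|]. intros F e He HF Fb F0.
  destruct (HC e (fun i => F i 1) He) as [q [Pq [Q0 [Q1 QB]]]].
  { intros i Hi. apply Fb; [lia|unfold inI; lra]. }
  exists q; split; [eapply poly_mono; [|apply Pq]; lia|]. intros x Hx.
  assert (HG := Ichain_minus _ _ _ HF (smooth_Ichain q k (poly_smooth _ _ Pq))).
  eapply Rle_trans; [apply (vanish_bound k _ ((1 + C) * e) HG) with (i := 0%nat)|]; [| |lia|auto|].
  - intros z Hz. eapply Rle_trans; [apply Rabs_triang|]. rewrite Rabs_Ropp.
    specialize (Fb k z (le_n k) Hz). specialize (QB k z (le_n k) Hz). lra.
  - intros i Hi. rewrite F0, Q0, Q1 by auto. lra.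
  - rewrite Nat.sub_0_r. apply Rmult_le_compat_l; [nra|]. now apply sqrt_pow_half.
Qed.

(** Meant for [n + 1 < 2 r], where powers of [n + 1] are bounded in terms of [r] and only the weight
    matters. *)
Lemma poly_small r : (1 <= r)%nat -> exists C, 0 <= C /\ forall D f, poly D f ->
  (forall x, inI x -> Rabs (Derive_n f r x) <= 1) -> exists p, poly (r - 1) p /\
  forall x, inI x -> Rabs (f x - p x) <= C * sqrt (1 - x ^ 2) ^ (r - 1).
Proof.
  intros Hr. destruct (endpoint_correction r Hr) as [C [C0 HC]].
  assert (A0 : 0 < 2 ^ r) by (apply pow_lt; lra).
  assert (r2 : (r / 2 < r)%nat) by (apply Nat.div_lt; lia).
  exists (C * 2 ^ r); split; [nra|]. intros D f Pf Hf.
  assert (Sf := poly_smooth _ _ Pf).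
  destruct (taylor_at f (-1) r Sf) as [p [Pp Ep]]. assert (Sp := poly_smooth _ _ Pp).
  assert (Sd : smooth (fun x => f x - p x)).
  { apply (poly_smooth (D + r)), span_minus; [eapply poly_mono; [|apply Pf]; lia|eapply poly_mono; [|apply Pp]; lia]. }
  assert (V : forall i, (i < r)%nat -> Derive_n (fun x => f x - p x) i (-1) = 0).
  { intros i Hi. rewrite Derive_n_minus_smooth, Ep by auto. ring. }
  destruct (HC (Derive_n (fun x => f x - p x)) (2 ^ r)) as [q [Pq Hq]]; [lra|now apply smooth_Ichain| | |].
  - intros i x Hi Hx. apply derivs_bound_from_left; [auto| |auto|lia|auto].
    intros y Hy. rewrite Derive_n_minus_smooth, (poly_high_deriv (r - 1) p) by (auto || lia).
    rewrite Rminus_0_r; auto.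
  - intros i Hi. apply V; lia.
  - exists (fun x => p x + q x); split; [now apply span_plus|]. intros x Hx. specialize (Hq x Hx).
    change (Derive_n (fun x => f x - p x) 0 x) with (f x - p x) in Hq.
    replace (f x - (p x + q x)) with (f x - p x - q x) by ring. auto.
Qed.

Lemma pow_1p_bound y r : 0 <= y <= 1 -> (1 + y) ^ r <= 1 + y * (2 ^ r - 1).
Proof.
  intros Hy. induction r; [simpl; lra|]. simpl pow.
  assert (1 <= 2 ^ r) by (apply pow_R1_Rle; lra).
  assert ((1 + y) * (1 + y) ^ r <= (1 + y) * (1 + y * (2 ^ r - 1))) by (apply Rmult_le_compat_l; lra).
  assert (y * y * (2 ^ r - 1) <= y * (2 ^ r - 1)) by (apply Rmult_le_compat_r; nra). nra.
Qed.

Lemma poly_case r : (1 <= r)%nat -> exists C, 0 < C /\ forall D f, poly D f ->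
  (forall x, inI x -> Rabs (Derive_n f r x) <= 1) -> forall n, (r - 1 <= n)%nat -> exists p, poly n p /\
  forall x, inI x -> Rabs (f x - p x) <=
    Kr r * (sqrt (1 - x ^ 2) / INR (n + 1)) ^ r + C * sqrt (1 - x ^ 2) ^ (r - 1) / INR (n + 1) ^ (r + 1).
Proof.
  intros Hr. destruct (poly_small r Hr) as [C1 [C10 H1]]. destruct (poly_core r Hr) as [C2 [C20 H2]].
  destruct (Kr_bounds r Hr) as [K0 K1].
  assert (r1 : 1 <= INR r) by (apply (le_INR 1); auto).
  assert (p2 : 1 <= 2 ^ r) by (apply pow_R1_Rle; lra).
  assert (p3 : 0 < (2 * INR r) ^ (r + 1)) by (apply pow_lt; lra).
  set (Ca := C1 * (2 * INR r) ^ (r + 1)). set (Cb := 3 * (2 ^ r * (2 * INR r)) + C2 * 2 ^ (r + 1)).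
  assert (Ca0 : 0 <= Ca) by (unfold Ca; nra).
  assert (Cb0 : 0 <= Cb). { unfold Cb. assert (0 < 2 ^ (r + 1)) by (apply pow_lt; lra). nra. }
  exists (1 + Ca + Cb); split; [lra|]. intros D f Pf Hf n Hn.
  set (N := INR (n + 1)). assert (N1 : 1 <= N) by (apply (le_INR 1); lia).
  assert (Nr : 0 < N ^ r) by (apply pow_lt; lra). assert (Nr1 : 0 < N ^ (r + 1)) by (apply pow_lt; lra).
  assert (IN : 0 < / N ^ (r + 1)) by (now apply Rinv_0_lt_compat).
  assert (RHO : forall x, inI x -> 0 <= sqrt (1 - x ^ 2) <= 1).
  { intros x Hx. split; [apply sqrt_pos|]. apply Rle_trans with (sqrt 1); [apply sqrt_le_1_alt; generalize (pow2_ge_0 x); lra|rewrite sqrt_1; lra]. }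
  (* For [n + 1 >= 2 r] the effective degree [M = n + 1 - r] is at least [r] and at least half of
     [n + 1]. *)
  destruct (le_lt_dec (2 * r) (n + 1)) as [Hbig | Hsm].
  - set (M := (n + 1 - r)%nat).
    assert (Sf := poly_smooth _ _ Pf).
    destruct (taylor_at f (-1) r Sf) as [t [Pt Et]]. assert (St := poly_smooth _ _ Pt).
    destruct (H2 (D + r)%nat (fun x => f x - t x)) with (M := M) as [p [Pp Hp]].
    + apply span_minus; [eapply poly_mono; [|apply Pf]; lia|eapply poly_mono; [|apply Pt]; lia].
    + intros x Hx. rewrite Derive_n_minus_smooth, (poly_high_deriv (r - 1) t) by (auto || lia).
      rewrite Rminus_0_r; auto.
    + intros i Hi. rewrite Derive_n_minus_smooth, Et by auto. ring.
    + unfold M; lia.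
    + exists (fun x => t x + p x); split.
      { apply span_plus; [eapply poly_mono; [|apply Pt]; lia|eapply poly_mono; [|apply Pp]; unfold M; lia]. }
      intros x Hx. specialize (Hp x Hx). specialize (RHO x Hx).
      replace (f x - (t x + p x)) with (f x - t x - p x) by ring.
      eapply Rle_trans; [apply Hp|].
      set (s := sqrt (1 - x ^ 2)) in *.
      assert (s0 : 0 <= s ^ (r - 1)) by (apply pow_le; lra).
      assert (Es : s ^ r = s * s ^ (r - 1)) by (replace r with (S (r - 1)) at 1 by lia; simpl; ring).
      set (m := INR M) in *.
      assert (EN : N = m + INR r) by (unfold N, m, M; rewrite <- plus_INR; f_equal; lia).
      assert (rm : INR r <= m) by (unfold m, M; apply le_INR; lia).
      assert (mr : 0 < m ^ r) by (apply pow_lt; lra). assert (mr1 : 0 < m ^ (r + 1)) by (apply pow_lt; lra).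
      assert (Y : 0 <= INR r / m <= 1).
      { split; [apply Rdiv_le_0_compat; lra|]. apply Rle_div_l; lra. }
      (* The excess over 1 carries a factor [/ N], so its share of the leading term is of the order
         of the second term. *)
      assert (Q1 : N ^ r / m ^ r <= 1 + 2 * INR r / N * 2 ^ r).
      { unfold Rdiv. rewrite <- pow_inv, <- Rpow_mult_distr.
        replace (N * / m) with (1 + INR r / m) by (rewrite EN; field; lra).
        eapply Rle_trans; [apply pow_1p_bound, Y|].
        assert (INR r / m <= 2 * INR r * / N).
        { apply Rle_div_l; [lra|]. replace (2 * INR r * / N * m) with (INR r * (2 * m / N)) by (unfold Rdiv; ring).
          rewrite <- (Rmult_1_r (INR r)) at 1. apply Rmult_le_compat_l; [lra|]. apply (Rle_div_r 1 (2 * m) N); lra. }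
        nra. }
      assert (Q2 : N ^ (r + 1) / m ^ (r + 1) <= 2 ^ (r + 1)).
      { unfold Rdiv. rewrite <- pow_inv, <- Rpow_mult_distr. apply pow_incr.
        split; [apply Rdiv_le_0_compat; lra|]. apply (Rle_div_l N 2 m); lra. }
      replace (Kr r * s ^ r / m ^ r) with (Kr r * s ^ r / N ^ r * (N ^ r / m ^ r)) by (field; lra).
      replace (C2 * s ^ (r - 1) / m ^ (r + 1)) with (C2 * s ^ (r - 1) / N ^ (r + 1) * (N ^ (r + 1) / m ^ (r + 1))) by (field; lra).
      replace (Kr r * (s / N) ^ r) with (Kr r * s ^ r / N ^ r) by (unfold Rdiv; rewrite Rpow_mult_distr, pow_inv; ring).
      assert (X0 : 0 <= Kr r * s ^ r / N ^ r).
      { apply Rdiv_le_0_compat; [|auto]. apply Rmult_le_pos; [auto|apply pow_le; lra]. }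
      assert (X1 : 0 <= C2 * s ^ (r - 1) / N ^ (r + 1)) by (apply Rdiv_le_0_compat; [nra|auto]).
      assert (Z1 : Kr r * s ^ r / N ^ r * (N ^ r / m ^ r) <= Kr r * s ^ r / N ^ r + 3 * (2 ^ r * (2 * INR r)) * s ^ (r - 1) / N ^ (r + 1)).
      { apply Rle_trans with (Kr r * s ^ r / N ^ r * (1 + 2 * INR r / N * 2 ^ r)); [apply Rmult_le_compat_l; auto|].
        rewrite Rmult_plus_distr_l, Rmult_1_r. apply Rplus_le_compat_l.
        replace (Kr r * s ^ r / N ^ r * (2 * INR r / N * 2 ^ r)) with (Kr r * s ^ r * (2 ^ r * (2 * INR r)) / N ^ (r + 1)).
        - unfold Rdiv. apply Rmult_le_compat_r; [lra|]. rewrite Es.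
          assert (0 <= 2 ^ r * (2 * INR r)) by nra.
          assert (Kr r * (s * s ^ (r - 1)) <= 3 * s ^ (r - 1)); [|nra].
          assert (s * s ^ (r - 1) <= s ^ (r - 1)) by nra. assert (0 <= s * s ^ (r - 1)) by nra. nra.
        - rewrite pow_add, pow_1. field. lra. }
      assert (Z2 : C2 * s ^ (r - 1) / N ^ (r + 1) * (N ^ (r + 1) / m ^ (r + 1)) <= C2 * 2 ^ (r + 1) * s ^ (r - 1) / N ^ (r + 1)).
      { replace (C2 * 2 ^ (r + 1) * s ^ (r - 1) / N ^ (r + 1)) with (C2 * s ^ (r - 1) / N ^ (r + 1) * 2 ^ (r + 1)) by (unfold Rdiv; ring).
        apply Rmult_le_compat_l; auto. }
      assert (Z3 : 0 <= (1 + Ca) * s ^ (r - 1) / N ^ (r + 1)) by (apply Rdiv_le_0_compat; [nra|auto]).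
      unfold Cb. unfold Rdiv in *. lra.
  - destruct (H1 D f Pf Hf) as [p [Pp Hp]]. exists p; split; [eapply poly_mono; [|apply Pp]; lia|].
    intros x Hx. specialize (Hp x Hx). specialize (RHO x Hx). set (s := sqrt (1 - x ^ 2)) in *.
    assert (s0 : 0 <= s ^ (r - 1)) by (apply pow_le; lra).
    assert (X0 : 0 <= Kr r * (s / N) ^ r).
    { apply Rmult_le_pos; [auto|]. apply pow_le, Rdiv_le_0_compat; lra. }
    assert (NN : N ^ (r + 1) <= (2 * INR r) ^ (r + 1)).
    { apply pow_incr; split; [lra|]. unfold N. replace 2 with (INR 2) by (simpl; ring). rewrite <- mult_INR. apply le_INR; lia. }
    assert (C1 * s ^ (r - 1) <= (1 + Ca + Cb) * s ^ (r - 1) / N ^ (r + 1)); [|lra].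
    apply (Rle_div_r _ _ _ Nr1).
    apply Rle_trans with (C1 * s ^ (r - 1) * (2 * INR r) ^ (r + 1)); [apply Rmult_le_compat_l; nra|].
    unfold Ca. assert (0 <= (1 + Cb) * s ^ (r - 1)) by nra. lra.
Qed.

(** * The class W^r and the upper estimate *)

Lemma chain_lo lo lo' l hi : chain lo l hi -> lo' <= lo -> chain lo' l hi.
Proof. destruct l as [|[a b] t]; simpl; intros; [lra|repeat split; try tauto; lra]. Qed.

Lemma chain_hi lo l hi hi' : chain lo l hi -> hi <= hi' -> chain lo l hi'.
Proof.
  revert lo; induction l as [|[a b] t IH]; simpl; intros lo H L; [lra|].
  repeat split; try tauto. apply IH; tauto.
Qed.

Lemma AC_cont g : AC_on_I g -> cont_on_I g.
Proof.
  intros H x Hx e He. destruct (H e He) as [d [Hd K]]. exists d; split; [auto|].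
  intros y Hy Hd'. unfold inI in *. destruct (Rle_dec x y) as [L | L].
  - specialize (K [(x, y)]). unfold total_len, total_var in K; simpl in K.
    rewrite Rplus_0_r in K. rewrite Rabs_pos_eq in Hd' by lra.
    rewrite Rplus_0_r in K. apply K; [lra|lra].
  - specialize (K [(y, x)]). unfold total_len, total_var in K; simpl in K.
    rewrite Rplus_0_r in K. rewrite Rabs_left in Hd' by lra.
    rewrite Rplus_0_r in K. rewrite Rabs_minus_sym. apply K; [lra|lra].
Qed.

Section Cover.
Variables (a b : nat -> R).
Hypothesis Hab : forall k, a k <= b k.

(* The part of the [k]-th covering interval to the left of [c], up to a constant. *)
Definition cut (k : nat) (c : R) : R := Rmax (a k) (Rmin c (b k)).

Lemma cut_mono k c z : c <= z -> cut k c <= cut k z.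
Proof. intros; unfold cut. apply Rle_max_compat_l, Rle_min_compat_r; auto. Qed.

Lemma cut_range k c : a k <= cut k c <= b k.
Proof. unfold cut; split; [apply Rmax_l|apply Rmax_lub; [auto|apply Rmin_r]]. Qed.

Lemma cut_in k c : a k <= c <= b k -> cut k c = c.
Proof. intros; unfold cut. rewrite Rmin_left, Rmax_right; lra. Qed.
End Cover.

(* Real induction downwards from [y]: away from the exceptional set the increments are controlled by the derivative,
   on it by absolute continuity. *)
Lemma AC_lipschitz_interior g e x y : 0 < e -> AC_on_I g ->
  null_set (fun x => -1 < x < 1 /\ ~ (exists l, derivable_pt_lim g x l /\ Rabs l <= 1)) ->
  -1 < x -> x < y -> y < 1 -> Rabs (g y - g x) <= (1 + e) * (y - x) + e.
Proof.
  intros He HAC HN Hx Hxy Hy.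
  destruct (HAC e He) as [d [Hd K]]. destruct (HN d Hd) as [a [b [Hab [Hcov Hsum]]]].
  (* [l] lists the intervals jumped over near exceptional points. Their total length is charged to
     the part of the cover between [c] and [y], so it stays below [d] even when covering intervals
     overlap. *)
  set (Reach := fun c => x <= c <= y /\ exists l k, chain c l y /\
    Rabs (g y - g c) <= (1 + e) * (y - c) + total_var g l /\
    total_len l <= sm (fun i => cut a b i y - cut a b i c) k).
  assert (SY : Reach y).
  { split; [lra|]. exists [], 0%nat. simpl. rewrite !Rminus_diag, Rabs_R0. repeat split; lra. }
  assert (STEP : forall c0, x <= c0 <= y -> exists ga, 0 < ga /\ forall c z, Reach c -> c0 <= c < c0 + ga ->
     x <= z <= c0 -> c0 - ga < z -> Reach z).
  { intros c0 Hc0.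
    destruct (classic (exists l, derivable_pt_lim g c0 l /\ Rabs l <= 1)) as [[l [Hl Bl]] | Hbad].
    - destruct (Hl e He) as [[ga Hga] Dl]. simpl in Dl. exists ga; split; [auto|].
      assert (L : forall z, Rabs (z - c0) < ga -> Rabs (g z - g c0) <= (1 + e) * Rabs (z - c0)).
      { intros z Hz. destruct (Req_dec z c0) as [-> | Hn]; [rewrite !Rminus_diag, Rabs_R0; lra|].
        specialize (Dl (z - c0) ltac:(lra) Hz). replace (c0 + (z - c0)) with z in Dl by ring.
        set (qv := (g z - g c0) / (z - c0)) in *.
        replace (g z - g c0) with (qv * (z - c0)) by (unfold qv; field; lra).
        rewrite Rabs_mult. apply Rmult_le_compat_r; [apply Rabs_pos|].
        replace qv with ((qv - l) + l) by ring. eapply Rle_trans; [apply Rabs_triang|]. lra. }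
      intros c z [Hc [li [k [Ch [V T]]]]] Hc1 Hz Hz1. split; [lra|]. exists li, k. repeat split.
      + eapply chain_lo; [apply Ch|lra].
      + assert (L1 := L c ltac:(apply Rabs_def1; lra)). assert (L2 := L z ltac:(apply Rabs_def1; lra)).
        rewrite (Rabs_pos_eq (c - c0)) in L1 by lra. rewrite (Rabs_left1 (z - c0)) in L2 by lra.
        replace (g y - g z) with ((g y - g c) + ((g c - g c0) - (g z - g c0))) by ring.
        eapply Rle_trans; [apply Rabs_triang|].
        assert (Rabs (g c - g c0 - (g z - g c0)) <= (1 + e) * (c - z)).
        { eapply Rle_trans; [apply Rabs_triang|]. rewrite Rabs_Ropp. lra. }
        lra.
      + eapply Rle_trans; [apply T|]. apply sm_le; intros i _.
        assert (M := cut_mono a b i z c ltac:(lra)). lra.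
    - assert (Jc : -1 < c0 < 1) by lra. destruct (Hcov c0 (conj Jc Hbad)) as [k0 Hk0].
      exists (Rmin (c0 - a k0) (b k0 - c0)). assert (M1 := Rmin_l (c0 - a k0) (b k0 - c0)).
      assert (M2 := Rmin_r (c0 - a k0) (b k0 - c0)). split; [apply Rmin_glb_lt; lra|].
      intros c z [Hc [li [k [Ch [V T]]]]] Hc1 Hz Hz1. split; [lra|].
      (* The jump from [c] to [z] stays inside the covering interval number [k0], whose share grows
         by the full length [c - z]; the enlarged index range makes sure that this interval is
         counted. *)
      exists ((z, c) :: li), (k + S k0)%nat. simpl. repeat split; try lra; auto.
      + replace (g y - g z) with ((g y - g c) + (g c - g z)) by ring.
        eapply Rle_trans; [apply Rabs_triang|].
        assert ((1 + e) * (y - c) <= (1 + e) * (y - z)) by (apply Rmult_le_compat_l; lra).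
        unfold total_var in *; simpl. lra.
      + unfold total_len in *; simpl.
        assert (E : sm (fun i => cut a b i y - cut a b i z) (k + S k0) =
          sm (fun i => cut a b i y - cut a b i c) (k + S k0) + sm (fun i => cut a b i c - cut a b i z) (k + S k0)).
        { rewrite <- sm_plus. apply sm_ext; intros; ring. }
        rewrite E. assert (A1 : c - z <= sm (fun i => cut a b i c - cut a b i z) (k + S k0)).
        { replace (c - z) with ((fun i => cut a b i c - cut a b i z) k0) by (cbv beta; rewrite !cut_in by lra; ring).
          apply (sm_term_le (fun i => cut a b i c - cut a b i z)); [|lia]. intros i _. assert (M := cut_mono a b i z c ltac:(lra)). lra. }
        assert (A2 : sm (fun i => cut a b i y - cut a b i c) k <= sm (fun i => cut a b i y - cut a b i c) (k + S k0)).
        { rewrite sm_add. match goal with |- ?p <= ?p + ?q => assert (0 <= q); [|lra] end.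
          apply sm_nonneg; intros i _. assert (M := cut_mono a b (k + i) c y ltac:(lra)). lra. }
        lra. }
  assert (SX : Reach x).
  (* The infimum of the reachable points, taken as a supremum of negatives. [STEP] at the infimum
     reaches beyond it unless it equals [x]. *)
  { destruct (completeness (fun z => Reach (- z))) as [m [Hub Hlub]].
    - exists (- x). intros z [Hz _]; lra.
    - exists (- y). now rewrite Ropp_involutive.
    - set (c0 := - m).
      assert (Hc0 : x <= c0 <= y).
      { unfold c0; split.
        - assert (m <= - x); [|lra]. apply Hlub. intros z [Hz _]; lra.
        - assert (- y <= m); [|lra]. apply Hub. now rewrite Ropp_involutive. }
      destruct (STEP c0 Hc0) as [ga [Hga ST]].
      assert (EX : exists c, Reach c /\ c0 <= c < c0 + ga).
      { apply NNPP. intros Hno. assert (m <= m - ga); [|lra]. apply Hlub. intros z Hz.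
        destruct (Rle_dec z (m - ga)) as [|Hz']; [auto|exfalso]. apply Hno. exists (- z); split; [auto|].
        assert (z <= m) by (now apply Hub). unfold c0; lra. }
      destruct EX as [c [Sc Hc]].
      set (z := Rmax x (c0 - ga / 2)).
      assert (Hz : x <= z <= c0 /\ c0 - ga < z).
      { unfold z; repeat split; [apply Rmax_l|apply Rmax_lub; lra|]. generalize (Rmax_r x (c0 - ga / 2)); lra. }
      assert (Sz : Reach z) by (apply (ST c); tauto).
      destruct (Rle_lt_dec c0 x) as [Hle | Hlt].
      + replace x with z by lra. auto.
      + exfalso. assert (- z <= m) by (apply Hub; now rewrite Ropp_involutive).
        assert (z < c0) by (unfold z; apply Rmax_lub_lt; lra). unfold c0 in *; lra. }
  destruct SX as [_ [l [k [Ch [V T]]]]].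
  assert (total_var g l < e).
  { apply K.
    - eapply chain_lo; [eapply chain_hi; [apply Ch|lra]|lra].
    - eapply Rle_lt_trans; [apply T|]. eapply Rle_lt_trans; [|apply (Hsum k)]. rewrite sm_f_R0.
      cbn [sm]. assert (0 <= b k - a k) by (specialize (Hab k); lra).
      assert (sm (fun i => cut a b i y - cut a b i x) k <= sm (fun i => b i - a i) k); [|lra].
      apply sm_le; intros i _. generalize (cut_range a b Hab i y) (cut_range a b Hab i x); lra. }
  lra.
Qed.

Lemma lipschitz_closure h L : cont_on_I h -> 0 <= L ->
  (forall x y, -1 < x -> x < y -> y < 1 -> Rabs (h y - h x) <= L * (y - x)) ->
  forall x y, inI x -> inI y -> Rabs (h y - h x) <= L * Rabs (y - x).
Proof.
  intros C HL H.
  assert (K : forall x y, inI x -> inI y -> x < y -> Rabs (h y - h x) <= L * (y - x)).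
  { intros x y Hx Hy Hxy. unfold inI in *. apply le_epsilon; intros e He.
    destruct (C x Hx (e / 2) ltac:(lra)) as [d1 [Hd1 K1]].
    destruct (C y Hy (e / 2) ltac:(lra)) as [d2 [Hd2 K2]].
    set (t := Rmin ((y - x) / 4) (Rmin (d1 / 2) (d2 / 2))).
    assert (Ht : 0 < t /\ t <= (y - x) / 4 /\ t <= d1 / 2 /\ t <= d2 / 2).
    { unfold t. assert (A1 := Rmin_l ((y - x) / 4) (Rmin (d1 / 2) (d2 / 2))).
      assert (A2 := Rmin_r ((y - x) / 4) (Rmin (d1 / 2) (d2 / 2))).
      assert (A3 := Rmin_l (d1 / 2) (d2 / 2)). assert (A4 := Rmin_r (d1 / 2) (d2 / 2)).
      repeat split; try lra. apply Rmin_glb_lt; [lra|apply Rmin_glb_lt; lra]. }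
    specialize (K1 (x + t) ltac:(unfold inI; lra)). replace (x + t - x) with t in K1 by ring.
    specialize (K2 (y - t) ltac:(unfold inI; lra)). replace (y - t - y) with (- t) in K2 by ring.
    rewrite Rabs_Ropp in K2. rewrite Rabs_pos_eq in K1, K2 by lra. specialize (K1 ltac:(lra)). specialize (K2 ltac:(lra)).
    specialize (H (x + t) (y - t) ltac:(lra) ltac:(lra) ltac:(lra)).
    assert (L * (y - t - (x + t)) <= L * (y - x)) by (apply Rmult_le_compat_l; lra).
    apply Rabs_def2 in K1, K2. apply Rabs_le_between in H. apply Rabs_le; lra. }
  intros x y Hx Hy. destruct (Rtotal_order x y) as [Hl | [-> | Hg]].
  - rewrite (Rabs_pos_eq (y - x)) by lra. now apply K.
  - rewrite !Rminus_diag, Rabs_R0; lra.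
  - rewrite Rabs_minus_sym, (Rabs_minus_sym y), (Rabs_pos_eq (x - y)) by lra. now apply K.
Qed.

Lemma AC_lipschitz g : AC_on_I g ->
  null_set (fun x => -1 < x < 1 /\ ~ (exists l, derivable_pt_lim g x l /\ Rabs l <= 1)) ->
  forall x y, inI x -> inI y -> Rabs (g y - g x) <= Rabs (y - x).
Proof.
  intros HAC HN x y Hx Hy. rewrite <- (Rmult_1_l (Rabs (y - x))).
  apply lipschitz_closure; auto; [now apply AC_cont|lra|].
  clear x y Hx Hy; intros x y Hx Hxy Hy. apply le_epsilon; intros e He.
  assert (K := AC_lipschitz_interior g (e / 3) x y ltac:(lra) HAC HN Hx Hxy Hy). nra.
Qed.

(** * Bernstein polynomials by de Casteljau's recursion, and approximation of a whole chain of
    derivatives *)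

Fixpoint bern (m : nat) (c : nat -> R) (u : R) : R :=
  match m with
  | O => c O
  | S m' => (1 - u) * bern m' c u + u * bern m' (fun k => c (S k)) u
  end.

Lemma bern_ext m c c' u : (forall k, c k = c' k) -> bern m c u = bern m c' u.
Proof. revert c c'; induction m; intros c c' H; simpl; [auto|]. now rewrite (IHm c c'), (IHm (fun k => c (S k)) (fun k => c' (S k))). Qed.

(** The first two moments of the binomial distribution; one general quadratic makes the induction
    close. *)
Lemma bern_quad m al be ga u : bern m (fun k => al + be * INR k + ga * INR k ^ 2) u =
  al + be * (INR m * u) + ga * (INR m * u + INR m * (INR m - 1) * u ^ 2).
Proof.
  revert al be ga; induction m; intros al be ga; [simpl; ring|].
  cbn [bern]. rewrite IHm.
  rewrite (bern_ext m _ (fun k => (al + be + ga) + (be + 2 * ga) * INR k + ga * INR k ^ 2)).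
  - rewrite IHm, S_INR. ring.
  - intros k. rewrite S_INR. ring.
Qed.

Lemma bern_le m c c' u : 0 <= u <= 1 -> (forall k, (k <= m)%nat -> c k <= c' k) -> bern m c u <= bern m c' u.
Proof.
  intros Hu; revert c c'; induction m; intros c c' H; simpl; [auto|].
  apply Rplus_le_compat; apply Rmult_le_compat_l; try lra; apply IHm; intros; apply H; lia.
Qed.

Lemma bern_minus m c c' u : bern m (fun k => c k - c' k) u = bern m c u - bern m c' u.
Proof. revert c c'; induction m; intros; simpl; [easy|]. rewrite !IHm. ring. Qed.

(** The derivative is an average of difference quotients of the coefficients, so the Lipschitz
    constant is preserved exactly; no loss is permitted in front of [Kr r]. *)
Lemma bern_derive m c u : is_derive (bern (S m) c) u (INR (S m) * bern m (fun k => c (S k) - c k) u).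
Proof.
  revert c; induction m; intros c.
  - simpl. auto_derive; [easy|ring].
  - apply (is_derive_ext (fun u => (1 - u) * bern (S m) c u + u * bern (S m) (fun k => c (S k)) u)); [easy|].
    eapply is_derive_val.
    + apply @is_derive_plus.
      * apply (is_derive_multR (fun u => 1 - u) (bern (S m) c) u (-1)); [auto_derive; [easy|ring]|apply IHm].
      * apply (is_derive_multR (fun u => u) (bern (S m) (fun k => c (S k))) u 1); [auto_derive; [easy|ring]|apply IHm].
    + change (- 1 * bern (S m) c u + (1 - u) * (INR (S m) * bern m (fun k => c (S k) - c k) u) +
        (1 * bern (S m) (fun k => c (S k)) u + u * (INR (S m) * bern m (fun k => c (S (S k)) - c (S k)) u)) =
        INR (S (S m)) * bern (S m) (fun k => c (S k) - c k) u).
      rewrite (S_INR (S m)), Rmult_plus_distr_r, Rmult_1_l.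
      rewrite (bern_minus (S m) (fun k => c (S k)) c) at 2.
      change (bern (S m) (fun k => c (S k) - c k) u) with
        ((1 - u) * bern m (fun k => c (S k) - c k) u + u * bern m (fun k => c (S (S k)) - c (S k)) u).
      ring.
Qed.

Lemma bern_poly m c : poly m (fun x => bern m c ((1 + x) / 2)).
Proof.
  revert c; induction m; intros c; [apply (poly_const 0 (c 0%nat))|].
  assert (P1 : forall al be, poly 1 (fun x => al + be * x)).
  { intros. apply span_plus; [apply poly_const|apply span_scal, poly_id; lia]. }
  apply (span_ext _ (fun x => (/ 2 + - / 2 * x) * bern m c ((1 + x) / 2) + (/ 2 + / 2 * x) * bern m (fun k => c (S k)) ((1 + x) / 2))).
  - apply span_plus; (apply (poly_mult 1 m); [apply P1|apply IHm|lia]).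
  - intros x. cbn [bern]. field.
Qed.

Lemma lipschitz_approx phi e : 0 < e -> (forall x y, inI x -> inI y -> Rabs (phi y - phi x) <= Rabs (y - x)) ->
  exists D P, poly D P /\ (forall x, inI x -> Rabs (Derive P x) <= 1) /\ forall x, inI x -> Rabs (phi x - P x) <= e.
Proof.
  intros He HL. destruct (inv_INR_small (e * e) ltac:(nra)) as [V [HV HVe]].
  set (m := V). assert (M1 : 1 <= INR m) by (apply (le_INR 1); auto).
  set (nd := fun k => 2 * INR k / INR m - 1).
  assert (Hnd : forall k, (k <= m)%nat -> inI (nd k)).
  { intros k Hk. unfold nd, inI. assert (0 <= INR k <= INR m) by (split; [apply pos_INR|now apply le_INR]).
    assert (0 <= 2 * INR k / INR m <= 2); [|lra]. split; [apply Rdiv_le_0_compat; lra|]. apply Rle_div_l; lra. }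
  set (c := fun k => phi (nd k)).
  exists m, (fun x => bern m c ((1 + x) / 2)); split; [apply bern_poly|split].
  - intros x Hx. assert (Em : m = S (m - 1)) by (unfold m; lia). set (m' := (m - 1)%nat) in *.
    assert (Dv : is_derive (fun x => bern m c ((1 + x) / 2)) x (/ 2 * (INR m * bern m' (fun k => c (S k) - c k) ((1 + x) / 2)))).
    { rewrite Em. apply (is_derive_compR (bern (S m') c) (fun x => (1 + x) / 2)); [apply bern_derive|].
      auto_derive; [easy|field]. }
    assert (Dv' : Derive (fun x => bern m c ((1 + x) / 2)) x = / 2 * (INR m * bern m' (fun k => c (S k) - c k) ((1 + x) / 2))).
    { now apply is_derive_unique. }
    rewrite Dv'.
    set (u := (1 + x) / 2). assert (Hu : 0 <= u <= 1) by (unfold u, inI in *; lra).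
    assert (B : forall k, (k <= m')%nat -> Rabs (c (S k) - c k) <= 2 / INR m).
    { intros k Hk. unfold c. eapply Rle_trans; [apply HL; apply Hnd; lia|].
      right. replace (nd (S k) - nd k) with (2 / INR m) by (unfold nd; rewrite S_INR; field; lra).
      apply Rabs_pos_eq, Rdiv_le_0_compat; lra. }
    assert (Q : forall al, bern m' (fun k => al + 0 * INR k + 0 * INR k ^ 2) u = al) by (intros; rewrite bern_quad; ring).
    assert (U1 := bern_le m' (fun k => c (S k) - c k) (fun k => 2 / INR m + 0 * INR k + 0 * INR k ^ 2) u Hu).
    assert (U2 := bern_le m' (fun k => - (2 / INR m) + 0 * INR k + 0 * INR k ^ 2) (fun k => c (S k) - c k) u Hu).
    rewrite Q in U1, U2.
    assert (W1 : bern m' (fun k => c (S k) - c k) u <= 2 / INR m).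
    { apply U1. intros k Hk. specialize (B k Hk). apply Rabs_le_between in B. lra. }
    assert (W2 : - (2 / INR m) <= bern m' (fun k => c (S k) - c k) u).
    { apply U2. intros k Hk. specialize (B k Hk). apply Rabs_le_between in B. lra. }
    assert (E2 : INR m * (2 / INR m) = 2) by (field; lra).
    apply Rabs_le. split; nra.
  - intros x Hx. set (u := (1 + x) / 2). assert (Hu : 0 <= u <= 1) by (unfold u, inI in *; lra).
    (* The inequality [z <= e / 2 + z ^ 2 / (2 e)] majorizes the Lipschitz bound by a quadratic,
       whose Bernstein mean is known. The variance of the nodes is at most [/ INR m], below [e * e]
       by the choice of [V]. *)
    assert (B : forall k, (k <= m)%nat -> Rabs (c k - phi x) <= e / 2 + (nd k - x) ^ 2 / (2 * e)).
    { intros k Hk. unfold c. eapply Rle_trans; [apply HL; [auto|now apply Hnd]|].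
      assert (0 <= (Rabs (nd k - x) - e) ^ 2) by apply pow2_ge_0.
      rewrite <- (pow2_abs (nd k - x)). set (z := Rabs (nd k - x)) in *.
      assert (E : e / 2 + z ^ 2 / (2 * e) - z = (z - e) ^ 2 / (2 * e)) by (field; lra).
      assert (0 <= (z - e) ^ 2 / (2 * e)) by (apply Rdiv_le_0_compat; lra). lra. }
    assert (Q : forall s al, bern m (fun k => al + s * (e / 2 + (nd k - x) ^ 2 / (2 * e))) u =
       al + s * (e / 2 + (4 * (u * (1 - u)) / INR m) / (2 * e))).
    { intros s al.
      transitivity (bern m (fun k => (al + s * (e / 2 + (1 + x) ^ 2 / (2 * e))) + (s * (- (4 * (1 + x) / INR m) / (2 * e))) * INR k
        + (s * (4 / INR m ^ 2 / (2 * e))) * INR k ^ 2) u).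
      - apply bern_ext. intros k. unfold nd. field. split; lra.
      - rewrite bern_quad. unfold u. field. split; lra. }
    assert (U1 := bern_le m c (fun k => phi x + 1 * (e / 2 + (nd k - x) ^ 2 / (2 * e))) u Hu).
    assert (U2 := bern_le m (fun k => phi x + (-1) * (e / 2 + (nd k - x) ^ 2 / (2 * e))) c u Hu).
    rewrite Q in U1, U2.
    assert (Ve : (4 * (u * (1 - u)) / INR m) / (2 * e) <= e / 2).
    { apply (Rle_div_l _ (e / 2) (2 * e)); [lra|].
      assert (u * (1 - u) <= / 4) by (generalize (pow2_ge_0 (u - / 2)); clear; intros; nra).
      assert (/ INR m <= e * e) by (unfold m; lra). assert (0 < / INR m) by (apply Rinv_0_lt_compat; lra).
      unfold Rdiv at 1. assert (0 <= u * (1 - u)) by nra. nra. }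
    assert (W1 : bern m c u <= phi x + e).
    { eapply Rle_trans; [apply U1|lra]. intros k Hk. specialize (B k Hk). apply Rabs_le_between in B. lra. }
    assert (W2 : phi x - e <= bern m c u).
    { eapply Rle_trans; [|apply U2]; [lra|]. intros k Hk. specialize (B k Hk). apply Rabs_le_between in B. lra. }
    apply Rabs_le. lra.
Qed.

Lemma poly_antiderivative n f v : poly n f -> exists g, poly (S n) g /\ (forall x, is_derive g x (f x)) /\ g (-1) = v.
Proof.
  intros H. cut (exists g, poly (S n) g /\ (forall x, is_derive g x (f x))).
  { clear H; intros [g [Pg Dg]]. exists (fun x => g x + (v - g (-1))); split; [|split].
    - apply span_plus; [auto|apply poly_const].
    - intros x. eapply is_derive_val; [apply @is_derive_plus; [apply Dg|apply @is_derive_const]|].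
      unfold plus, zero; simpl; ring.
    - ring. }
  induction H as [u [k [Hk ->]]| |u w Hu [a [Pa Da]] Hv [b [Pb Db]]|c u Hu [a [Pa Da]]|u w Hu [a [Pa Da]] E].
  - assert (N0 : INR (S k) <> 0) by (apply not_0_INR; lia).
    exists (fun x => / INR (S k) * x ^ S k); split; [apply span_scal, poly_pow; lia|].
    intros x. eapply is_derive_val; [apply is_derive_scal, is_derive_pow, @is_derive_id|].
    unfold one; simpl one. change (Init.Nat.pred (S k)) with k. eqR. change (/ INR (S k) * (INR (S k) * 1 * x ^ k) = x ^ k). field; auto.
  - exists (fun _ => 0); split; [apply poly_const|]. intros; apply @is_derive_const.
  - exists (fun x => a x + b x); split; [now apply span_plus|]. intros; apply @is_derive_plus; auto.
  - exists (fun x => c * a x); split; [now apply span_scal|]. intros; apply is_derive_scal; auto.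
  - exists a; split; [auto|]. intros; rewrite <- E; auto.
Qed.

(** The top of the chain is approximated and then integrated back from -1. Each integration, over a
    length at most 2, at most doubles the error and keeps the values at -1 exact, as
    [endpoint_correction] requires. *)
Lemma chain_approx m F e : 0 < e -> Ichain m F ->
  (forall x y, inI x -> inI y -> Rabs (F m y - F m x) <= Rabs (y - x)) ->
  exists D P, poly D P /\ (forall x, inI x -> Rabs (Derive_n P (S m) x) <= 1) /\
  (forall i x, (i <= m)%nat -> inI x -> Rabs (F i x - Derive_n P i x) <= 2 ^ m * e) /\
  forall i, (i < m)%nat -> F i (-1) = Derive_n P i (-1).
Proof.
  intros He. revert F; induction m as [|m IH]; intros F HF HL.
  - destruct (lipschitz_approx (F 0%nat) e He HL) as [D [P [PP [P1 P2]]]].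
    exists D, P; repeat split; auto; [|lia]. intros i x Hi Hx. replace i with 0%nat by lia.
    simpl. rewrite Rmult_1_l; auto.
  - destruct HF as [HC HD].
    destruct (IH (fun i => F (S i))) as [D [P [PP [P1 [P2 P3]]]]]; [|auto|].
    { split; [intros; apply HC; lia|intros; apply HD; [lia|auto]]. }
    destruct (poly_antiderivative D P (F 0%nat (-1)) PP) as [G [PG [DG G1]]].
    assert (DS : forall i x, Derive_n G (S i) x = Derive_n P i x).
    { intros i x. rewrite Derive_n_S. apply Derive_n_ext. intros t; now apply is_derive_unique. }
    assert (A0 : 0 < 2 ^ m) by (apply pow_lt; lra).
    exists (S D), G; repeat split; auto.
    + intros x Hx. rewrite DS. auto.
    + intros i x Hi Hx. destruct i as [|i].
      * assert (HG := Ichain_minus 1 F (Derive_n G)).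
        destruct HG as [GC GD]; [split; [intros; apply HC; lia|intros; apply HD; [lia|auto]]|eapply smooth_Ichain, poly_smooth, PG|].
        destruct (mvt_I _ _ (-1) x (GC 0%nat ltac:(lia)) (fun z Hz => GD 0%nat z ltac:(lia) Hz)) as [xi [Hxi E]];
          [unfold inI; lra|auto|apply Hx|].
        simpl (Derive_n G 0 (-1)) in E. rewrite G1, Rminus_diag, Rminus_0_r in E. cbv beta in E. rewrite E, Rabs_mult, DS.
        assert (Hxi' : inI xi) by (unfold inI in *; lra).
        specialize (P2 0%nat xi ltac:(lia) Hxi'). unfold inI in Hx. rewrite (Rabs_pos_eq (x - -1)) by lra.
        simpl (2 ^ S m). apply Rle_trans with (2 ^ m * e * 2); [|lra].
        apply Rmult_le_compat; [apply Rabs_pos|lra|auto|lra].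
      * rewrite DS. specialize (P2 i x ltac:(lia) Hx). simpl (2 ^ S m). cbv beta in P2. nra.
    + intros i Hi. destruct i; [simpl; now rewrite G1|]. rewrite DS. apply P3; lia.
Qed.

Lemma trigub_upper r : (1 <= r)%nat -> exists c, c > 0 /\ admissible r (Kr r) c.
Proof.
  intros Hr. destruct (poly_case r Hr) as [C [C0 HP]]. destruct (endpoint_correction r Hr) as [C' [C0' HE]].
  exists (C + 1); split; [lra|]. intros f [F [F0 [FC [FD [FAC FN]]]]] n Hn.
  set (N := INR (n + 1)). assert (N1 : 1 <= N) by (apply (le_INR 1); lia).
  assert (Nr1 : 0 < N ^ (r + 1)) by (apply pow_lt; lra).
  assert (A0 : 0 < 2 ^ (r - 1)) by (apply pow_lt; lra).
  (* The replacement polynomial may depend on [n]; this accuracy brings the endpoint correction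
     within the second term with constant 1. *)
  set (e := / ((C' + 1) * 2 ^ (r - 1) * N ^ (r + 1))).
  assert (T0 : 0 < (C' + 1) * 2 ^ (r - 1) * N ^ (r + 1)) by (repeat apply Rmult_lt_0_compat; lra).
  assert (He : 0 < e) by (now apply Rinv_0_lt_compat).
  assert (HF : Ichain (r - 1) F) by (split; auto).
  destruct (chain_approx (r - 1) F e He HF) as [D [P [PP [P1 [P2 P3]]]]].
  { apply AC_lipschitz; auto. }
  replace (S (r - 1)) with r in P1 by lia.
  destruct (HP D P PP P1 n Hn) as [p [Pp Hp]].
  assert (Hr2 : (r / 2 <= r - 1)%nat) by (generalize (Nat.div_lt r 2 ltac:(lia) ltac:(lia)); lia).
  destruct (HE (fun i x => F i x - Derive_n P i x) (2 ^ (r - 1) * e)) as [q [Pq Hq]]; [nra| | | |].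
  - apply (Ichain_mono (r - 1)); [auto|]. apply Ichain_minus; [auto|]. eapply smooth_Ichain, poly_smooth, PP.
  - intros i x Hi Hx. apply P2; [lia|auto].
  - intros i Hi. rewrite P3; [ring|]. assert (r / 2 * 2 <= r)%nat by (rewrite Nat.mul_comm; apply Nat.Div0.mul_div_le). lia.
  - assert (PT : poly n (fun x => p x + q x)).
    { apply span_plus; [auto|eapply poly_mono; [|apply Pq]; lia]. }
    apply poly_eval_poly in PT as [a Ha]. exists a. intros x Hx. rewrite <- Ha, <- F0 by auto.
    specialize (Hp x Hx). specialize (Hq x Hx). simpl (Derive_n P 0 x) in Hq.
    replace (F 0%nat x - (p x + q x)) with ((P x - p x) + (F 0%nat x - P x - q x)) by ring.
    eapply Rle_trans; [apply Rabs_triang|].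
    set (s := sqrt (1 - x ^ 2)) in *. assert (s0 : 0 <= s ^ (r - 1)) by (apply pow_le, sqrt_pos).
    assert (C' * (2 ^ (r - 1) * e) * s ^ (r - 1) <= s ^ (r - 1) / N ^ (r + 1)).
    { unfold Rdiv. rewrite (Rmult_comm (s ^ (r - 1)) (/ _)). apply Rmult_le_compat_r; [auto|].
      assert (E : (C' + 1) * (2 ^ (r - 1) * e) = / N ^ (r + 1)) by (unfold e; field; lra).
      rewrite <- E. apply Rmult_le_compat_r; [nra|lra]. }
    fold N in Hp |- *. unfold Rdiv in *. lra.
Qed.

(** * The lower estimate of the constant *)

Lemma smooth_W r f : (1 <= r)%nat -> smooth f -> (forall x, inI x -> Rabs (Derive_n f r x) <= 1) -> W r f.
Proof.
  intros Hr Sf Hf. exists (Derive_n f). destruct (smooth_Ichain f (r - 1) Sf) as [HC HD].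
  assert (Er : r = S (r - 1)) by lia. repeat split; auto.
  - intros e He. exists e; split; [auto|]. intros l Hl Hlen.
    eapply Rle_lt_trans; [|apply Hlen].
    assert (K : forall lo hi, chain lo l hi -> -1 <= lo -> hi <= 1 -> lo <= hi /\ total_var (Derive_n f (r - 1)) l <= total_len l).
    { clear Hl Hlen. induction l as [|[a b] t IH]; intros lo hi; simpl; [intros; lra|].
      intros [H1 [H2 H3]] Hlo Hhi. destruct (IH b hi H3 ltac:(lra) Hhi) as [K1 K2]. split; [lra|].
      unfold total_var, total_len in *; simpl.
      apply Rplus_le_compat; [|auto].
      destruct (mvt_I _ (Derive_n f r) a b (HC (r - 1)%nat (le_n _))) as [xi [Hxi E]]; try (unfold inI; lra).
      { intros z Hz. rewrite Er at 2. apply is_derive_Reals, Sf. }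
      rewrite E, Rabs_mult, (Rabs_pos_eq (b - a)) by lra.
      specialize (Hf xi ltac:(unfold inI; lra)). nra. }
    apply (K (-1) 1); auto; lra.
  - intros e He. exists (fun _ => 0), (fun _ => 0); split; [intros; lra|split].
    + intros x [Hx Hno]. exfalso. apply Hno. exists (Derive_n f r x); split; [|apply Hf; unfold inI; lra].
      rewrite Er at 2. apply is_derive_Reals, Sf.
    + intros N. rewrite sm_f_R0, sm_zero; [auto|]. intros; ring.
Qed.

Lemma continuity_endpoint u : cont u -> (forall x, -1 < x < 1 -> u x <= 0) -> u 1 <= 0 /\ u (-1) <= 0.
Proof.
  intros C H.
  assert (K : forall x, inI x -> u x <= 0).
  { intros x Hx. apply le_epsilon; intros e He. destruct (cont_I u C x Hx e He) as [d [Hd K]].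
    set (t := Rmin (d / 2) (/ 2)).
    assert (Ht : 0 < t < d /\ t <= / 2).
    { unfold t; generalize (Rmin_l (d / 2) (/ 2)) (Rmin_r (d / 2) (/ 2)); intros. repeat split; try lra. apply Rmin_glb_lt; lra. }
    unfold inI in *. set (y := if Rle_dec 0 x then x - t else x + t).
    assert (Hy : -1 < y < 1 /\ Rabs (y - x) < d).
    { unfold y. destruct (Rle_dec 0 x); (split; [lra|]); apply Rabs_def1; lra. }
    specialize (K y ltac:(lra) ltac:(tauto)). specialize (H y ltac:(tauto)). apply Rabs_def2 in K. lra. }
  split; apply K; unfold inI; lra.
Qed.

Definition monic (d : nat) (q : R -> R) : Prop := exists a, forall x, q x = x ^ d + sm (fun k => a k * x ^ k) d.

Lemma monic_div d q c : monic (S d) q -> q c = 0 -> exists v, monic d v /\ forall x, q x = (x - c) * v x.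
Proof.
  cut (forall d a, exists b e, forall x, x ^ S d + sm (fun k => a k * x ^ k) (S d) =
    (x - c) * (x ^ d + sm (fun k => b k * x ^ k) d) + e).
  { intros K [a Ha] Hc. destruct (K d a) as [b [e Hb]].
    exists (fun x => x ^ d + sm (fun k => b k * x ^ k) d); split; [now exists b|].
    assert (e = 0) by (rewrite Ha, Hb in Hc; lra). intros x. rewrite Ha, Hb; lra. }
  clear d q. induction d as [|d IH]; intros a.
  - exists (fun _ => 0), (c + a 0%nat). intros x. simpl; ring.
  - destruct (IH (fun k => a (S k))) as [b [e Hb]].
    exists (fun k => match k with O => e | S i => b i end), (c * e + a 0%nat). intros x.
    rewrite (sm_shift (fun k => a k * x ^ k)), (sm_shift (fun k => match k with O => e | S i => b i end * x ^ k)). cbv beta iota.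
    rewrite (sm_ext (fun i => a (S i) * x ^ S i) (fun i => x * (a (S i) * x ^ i))) by (intros; simpl; ring).
    rewrite (sm_ext (fun i => b i * x ^ S i) (fun i => x * (b i * x ^ i))) by (intros; simpl; ring).
    rewrite !sm_scal. specialize (Hb x).
    replace (x ^ S (S d)) with (x * x ^ S d) by (simpl; ring). simpl (x ^ 0).
    replace (x * x ^ S d + (a 0%nat * 1 + x * sm (fun i => a (S i) * x ^ i) (S d)))
      with (x * (x ^ S d + sm (fun i => a (S i) * x ^ i) (S d)) + a 0%nat) by ring.
    rewrite Hb. replace (x ^ S d) with (x * x ^ d) by (simpl; ring). ring.
Qed.

Lemma monic_cont d q : monic d q -> cont q.
Proof.
  intros [a Ha] x. apply (continuous_ext (fun x => x ^ d + sm (fun k => a k * x ^ k) d)); [now intros; rewrite Ha|].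
  assert (K : cont (fun x => x ^ d + sm (fun k => a k * x ^ k) d)) by ctac. apply K.
Qed.

Lemma cont_rho : cont (fun x => sqrt (1 - x ^ 2)).
Proof.
  intros x. apply (continuous_comp (fun x => 1 - x ^ 2) sqrt); [|apply continuous_sqrt].
  assert (K : cont (fun x => 1 - x ^ 2)) by ctac. apply K.
Qed.

(* The weight forces [q] to vanish at both endpoints, so one divides by [x^2 - 1] until a factor of degree one or two remains. *)
Lemma monic_weighted_lower e q al be : 0 <= al -> monic (S e) q ->
  (forall x, -1 < x < 1 -> Rabs (q x) <= sqrt (1 - x ^ 2) ^ e * (al * sqrt (1 - x ^ 2) + be)) ->
  (Nat.Even e -> 1 <= be) /\ (Nat.Odd e -> 1 <= al + be).
Proof.
  intros Hal. revert q. induction e as [e IH] using (well_founded_induction lt_wf). intros q Mq H.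
  assert (Cq := monic_cont _ _ Mq). assert (Cr := cont_rho).
  assert (HE := continuity_endpoint (fun x => Rabs (q x) - sqrt (1 - x ^ 2) ^ e * (al * sqrt (1 - x ^ 2) + be))).
  destruct HE as [H1 H2].
  { apply cont_minus; [now apply (cont_abs q)|]. apply cont_mult; [now apply (cont_pow (fun x => sqrt (1 - x ^ 2)))|].
    apply cont_plus; [apply cont_mult; [apply cont_const|auto]|apply cont_const]. }
  { intros x Hx. specialize (H x Hx). lra. }
  replace (1 - 1 ^ 2) with 0 in H1 by ring. replace (1 - (-1) ^ 2) with 0 in H2 by ring. rewrite sqrt_0 in H1, H2.
  destruct e as [|e].
  (* Here [q x = x + a 0], whose values at the two endpoints differ by 2 while the [al] term
     vanishes there; hence [1 <= be]. *)
  - simpl pow in H1, H2. destruct Mq as [a Ha]. rewrite Ha in H1, H2. simpl in H1, H2. split.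
    + intros _. apply Rminus_le in H1, H2. generalize (Rle_abs (1 * 1 + (0 + a 0%nat * 1))).
      generalize (Rabs_maj2 (-1 * 1 + (0 + a 0%nat * 1))). lra.
    + intros [k Hk]; lia.
  - rewrite pow_i in H1, H2 by lia.
    assert (Q1 : q 1 = 0) by (apply Rabs_eq_0; generalize (Rabs_pos (q 1)); lra).
    assert (Q2 : q (-1) = 0) by (apply Rabs_eq_0; generalize (Rabs_pos (q (-1))); lra).
    destruct (monic_div _ _ 1 Mq Q1) as [v [Mv Ev]].
    assert (V1 : v (-1) = 0) by (rewrite Ev in Q2; lra).
    destruct (monic_div _ _ (-1) Mv V1) as [w [Mw Ew]].
    assert (Eq : forall x, q x = (x ^ 2 - 1) * w x) by (intros x; rewrite Ev, Ew; ring).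
    destruct e as [|e].
    (* Here [q x = x ^ 2 - 1] and evaluation at 0 decides; the [al] term contributes in full. *)
    + split; [intros [k Hk]; lia|]. intros _. specialize (H 0 ltac:(lra)). rewrite Eq in H.
      destruct Mw as [a Ha]. rewrite Ha in H. simpl in H.
      replace (1 - 0 * (0 * 1)) with 1 in H by ring. rewrite sqrt_1 in H.
      replace ((0 * (0 * 1) - 1) * (1 + 0)) with (-1) in H by ring. rewrite Rabs_left in H by lra. lra.
    + destruct (IH e ltac:(lia) w Mw) as [K1 K2].
      { intros x Hx. specialize (H x Hx). rewrite Eq in H.
        assert (D : 0 < 1 - x ^ 2) by nra. set (s := sqrt (1 - x ^ 2)) in *.
        assert (Es : s ^ S (S e) = (1 - x ^ 2) * s ^ e).
        { unfold s at 1. simpl. rewrite <- Rmult_assoc, sqrt_sqrt by (simpl in D; lra). reflexivity. }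
        rewrite Es, Rabs_mult, Rabs_left in H by lra.
        apply Rmult_le_reg_l with (1 - x ^ 2); [auto|]. lra. }
      split; intros [k Hk]; [apply K1|apply K2]; exists (k - 1)%nat; lia.
Qed.

(** For even [r] the signs alternate, so the first three terms add up to at most 1; the tail is at
    most [1 / 3] and [PI > 3]. What matters is a bound below 2. *)
Lemma Kr_even_bound r : (1 <= r)%nat -> Nat.Even r -> Kr r <= 16 / 9.
Proof.
  intros Hr [k Hk]. assert (H := Kr_approx r 3 Hr ltac:(lia)).
  assert (T0 := Kr_term_0 r).
  assert (T1 : Kr_term r 1 = - / 3 ^ (r + 1)).
  { unfold Kr_term. replace (1 * (r + 1))%nat with (S (2 * k)) by lia.
    rewrite <- tech_pow_Rmult, pow_m1_even. replace (INR (2 * 1 + 1)) with 3 by (simpl; ring). field. apply pow_nonzero; lra. }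
  assert (T2 : Kr_term r 2 = / 5 ^ (r + 1)).
  { unfold Kr_term. rewrite pow_m1_even. replace (INR (2 * 2 + 1)) with 5 by (simpl; ring). field. apply pow_nonzero; lra. }
  cbn [sm] in H. rewrite T0, T1, T2 in H. replace (INR 3) with 3 in H by (simpl; ring).
  assert (/ 5 ^ (r + 1) <= / 3 ^ (r + 1)).
  { apply Rinv_le_contravar; [apply pow_lt; lra|]. apply pow_incr; lra. }
  apply Rabs_le_between in H. assert (P3 := PI_gt3). nra.
Qed.

(** The quotient of consecutive values is [(1 + / r) ^ (r + 1)], which is at least [exp 1]. *)
Lemma pow_fact_growth r : (1 <= r)%nat -> exp (INR r - 1) <= INR r ^ (r + 1) / INR (fact r) /\
  ((2 <= r)%nat -> 2 <= INR r ^ r / INR (fact r)).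
Proof.
  intros Hr. induction r as [|r IH]; [lia|].
  destruct (Nat.eq_dec r 0) as [-> | Hn].
  - simpl. replace (1 - 1) with 0 by ring. rewrite exp_0. split; [lra|lia].
  - destruct (IH ltac:(lia)) as [IH1 IH2]. clear IH.
    assert (r1 : 1 <= INR r) by (apply (le_INR 1); lia).
    assert (F0 : 0 < INR (fact r)) by apply INR_fact_lt_0.
    assert (R0 : 0 < INR r ^ r) by (apply pow_lt; lra).
    rewrite fact_simpl, mult_INR, S_INR. split.
    + assert (E1 : exp 1 <= (1 + / INR r) ^ (r + 1)).
      { replace 1 with (INR (r + 1) * / (INR r + 1)) at 1 by (rewrite plus_INR; simpl INR; field; lra).
        rewrite <- exp_pow. apply pow_incr. split; [left; apply exp_pos|].
        assert (G := exp_ineq1_le (- / (INR r + 1))). rewrite exp_Ropp in G.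
        assert (X := exp_pos (/ (INR r + 1))).
        replace (1 + - / (INR r + 1)) with (INR r / (INR r + 1)) in G by (field; lra).
        apply Rinv_le_contravar in G; [|apply Rdiv_lt_0_compat; lra]. rewrite Rinv_inv in G.
        replace (/ (INR r / (INR r + 1))) with (1 + / INR r) in G by (field; lra). auto. }
      replace (INR r + 1 - 1) with ((INR r - 1) + 1) by ring. rewrite exp_plus.
      replace ((INR r + 1) ^ (S r + 1) / ((INR r + 1) * INR (fact r)))
        with (INR r ^ (r + 1) / INR (fact r) * (1 + / INR r) ^ (r + 1)).
      * apply Rmult_le_compat; try (left; apply exp_pos); auto.
      * replace (1 + / INR r) with ((INR r + 1) * / INR r) by (field; lra).
        rewrite Rpow_mult_distr, pow_inv. replace (S r + 1)%nat with (S (r + 1)) by lia.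
        rewrite <- (tech_pow_Rmult (INR r + 1) (r + 1)). field. repeat split; try lra; apply pow_nonzero; lra.
    + intros _. replace ((INR r + 1) ^ S r / ((INR r + 1) * INR (fact r))) with ((INR r + 1) ^ r / INR (fact r)).
      2:{ rewrite <- tech_pow_Rmult. field. lra. }
      apply (Rle_div_r _ _ _ F0).
      destruct (Nat.eq_dec r 1) as [-> | Hn1]; [simpl; lra|].
      specialize (IH2 ltac:(lia)). apply (Rle_div_r _ _ _ F0) in IH2.
      eapply Rle_trans; [apply IH2|]. apply pow_incr; lra.
Qed.

Lemma trigub_constant_lower : exists c, c > 0 /\ forall r, (1 <= r)%nat ->
  forall C, admissible r (Kr r) C -> c * exp (INR r) <= C.
Proof.
  (* [exp (-1)] comes from the growth [exp (r - 1)], and [1 / 9] from the even case below. *)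
  exists (exp (-1) / 9). split; [generalize (exp_pos (-1)); lra|]. intros r Hr C Hadm.
  set (f := fun x => / INR (fact r) * x ^ r).
  assert (F0 : 0 < INR (fact r)) by apply INR_fact_lt_0.
  assert (Pf : poly r f) by (apply span_scal, poly_pow; lia).
  assert (Wf : W r f).
  { apply smooth_W; [auto|eapply poly_smooth, Pf|]. intros x _.
    unfold f. rewrite Derive_n_scal_smooth by (eapply poly_smooth, (poly_pow r r (le_n r))).
    rewrite (Derive_n_pow_smalli r r x (le_n r)), Nat.sub_diag. simpl (fact 0). simpl (x ^ 0).
    replace (/ INR (fact r) * (INR (fact r) / INR 1 * 1)) with 1 by (simpl; field; lra). rewrite Rabs_R1; lra. }
  destruct (Hadm f Wf (r - 1)%nat (le_n _)) as [a Ha]. replace (r - 1 + 1)%nat with r in Ha by lia.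
  assert (r1 : 1 <= INR r) by (apply (le_INR 1); auto).
  assert (R0 : 0 < INR r ^ r) by (apply pow_lt; lra).
  assert (R1 : 0 < INR r ^ (r + 1)) by (apply pow_lt; lra).
  destruct (Kr_bounds r Hr) as [K0 _].
  set (al := INR (fact r) * Kr r / INR r ^ r). set (be := INR (fact r) * C / INR r ^ (r + 1)).
  assert (Er : r = S (r - 1)) by lia.
  destruct (monic_weighted_lower (r - 1) (fun x => INR (fact r) * (f x - poly_eval a (r - 1) x)) al be) as [B1 B2].
  - unfold al. apply Rdiv_le_0_compat; nra.
  - rewrite <- Er. exists (fun k => - INR (fact r) * a k). intros x. unfold poly_eval, f. rewrite sm_f_R0, <- Er.
    rewrite (sm_ext (fun k => - INR (fact r) * a k * x ^ k) (fun k => - INR (fact r) * (a k * x ^ k))) by (intros; ring).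
    rewrite sm_scal. field. lra.
  - intros x Hx. rewrite Rabs_mult, Rabs_pos_eq by lra. specialize (Ha x ltac:(unfold inI; lra)).
    set (s := sqrt (1 - x ^ 2)) in *.
    apply Rle_trans with (INR (fact r) * (Kr r * (s / INR r) ^ r + C * s ^ (r - 1) / INR r ^ (r + 1))); [apply Rmult_le_compat_l; lra|].
    right. unfold al, be. replace ((s / INR r) ^ r) with (s * s ^ (r - 1) / INR r ^ r).
    + field. split; apply pow_nonzero; lra.
    + unfold Rdiv. rewrite Rpow_mult_distr, pow_inv. rewrite Er at 4. simpl; ring.
  - destruct (pow_fact_growth r Hr) as [G1 G2].
    set (T := INR r ^ (r + 1) / INR (fact r)) in *.
    assert (CB : C = be * T) by (unfold be, T; field; lra).
    assert (T0 : 0 < T) by (unfold T; apply Rdiv_lt_0_compat; auto).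
    assert (ET : exp (-1) / 9 * exp (INR r) <= T / 9).
    { replace (exp (-1) / 9 * exp (INR r)) with (exp (INR r - 1) / 9); [lra|].
      replace (INR r - 1) with (-1 + INR r) by ring. rewrite exp_plus. field. }
    destruct (Nat.Even_or_Odd (r - 1)) as [He | Ho].
    + specialize (B1 He). nra.
    (* For even [r] the leading term also helps the approximation, but [Kr r <= 16 / 9] and
       [r ^ r / r! >= 2] give [al <= 8 / 9], so at least [1 / 9] is left for [be]. *)
    + specialize (B2 Ho). assert (Hev : Nat.Even r) by (destruct Ho as [k Hk]; exists (S k); lia).
      assert (KB := Kr_even_bound r Hr Hev).
      assert (r2 : (2 <= r)%nat) by (destruct Hev; lia). specialize (G2 r2).
      assert (al <= 8 / 9).
      { unfold al. apply (Rle_div_l _ _ _ R0). apply (Rle_div_r _ _ _ F0) in G2.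
        apply Rle_trans with (INR (fact r) * (16 / 9)); [apply Rmult_le_compat_l; lra|lra]. }
      rewrite CB. nra.
Qed.

(** * Sharpness of the leading constant *)

Lemma sum_cos_period th M : sin (th / 2) <> 0 -> (exists z : Z, INR M * th = 2 * IZR z * PI) ->
  sm (fun k => cos (INR k * th)) M = 0.
Proof.
  intros Hs [z Hz].
  assert (K : forall n, 2 * sin (th / 2) * sm (fun k => cos (INR k * th)) n = sin (INR n * th - th / 2) + sin (th / 2)).
  { induction n; cbn [sm].
    - simpl INR. replace (0 * th - th / 2) with (- (th / 2)) by ring. rewrite sin_neg; ring.
    - rewrite Rmult_plus_distr_l, IHn, S_INR.
      replace ((INR n + 1) * th - th / 2) with (INR n * th + th / 2) by field.
      rewrite sin_plus, sin_minus; ring. }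
  specialize (K M). rewrite Hz in K. rewrite sin_minus in K.
  assert (S0 : sin (2 * IZR z * PI) = 0).
  { apply sin_eq_0_1. exists (2 * z)%Z. rewrite mult_IZR; ring. }
  assert (C0 : cos (2 * IZR z * PI) = 1).
  { replace (2 * IZR z * PI) with (2 * (IZR z * PI)) by ring. rewrite cos_2a_sin.
    assert (Z0 : sin (IZR z * PI) = 0) by (apply sin_eq_0_1; now exists z). rewrite Z0; ring. }
  rewrite S0, C0 in K.
  assert (K' : 2 * sin (th / 2) * sm (fun k => cos (INR k * th)) M = 0) by lra.
  apply Rmult_integral in K' as [K' | K']; [lra|auto].
Qed.

Lemma cos_kPI k : cos (INR k * PI) = (-1) ^ k.
Proof.
  assert (H := cos_minus_kPI 0 k). rewrite cos_0, Rmult_1_r in H.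
  rewrite <- cos_neg. now replace (- (INR k * PI)) with (0 - INR k * PI) by ring.
Qed.

Lemma sin_kPI k : sin (INR k * PI) = 0.
Proof. apply sin_eq_0_1. exists (Z.of_nat k). now rewrite <- INR_IZR_INZ. Qed.

(** At the nodes [(-1) ^ k] is a cosine of frequency [m]. Multiplied by frequency [j < m] it yields
    the frequencies [m - j] and [m + j], strictly between 0 and [2 m], whose sums over the [2 m]
    nodes vanish. *)
Lemma alternating_sum_zero n m g : ctrig n g -> (n < m)%nat ->
  sm (fun k => (-1) ^ k * g (INR k * (PI / INR m))) (2 * m) = 0.
Proof.
  intros H Hm. assert (m0 : 0 < INR m) by (apply lt_0_INR; lia). assert (P3 := PI_gt3).
  induction H as [u [j [Hj ->]]| |u v Hu IHu Hv IHv|c u Hu IHu|u v Hu IHu E].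
  - rewrite (sm_ext _ (fun k => / 2 * (cos (INR k * (INR (m + j) * PI / INR m)) + cos (INR k * (INR (m - j) * PI / INR m))))).
    + rewrite sm_scal, sm_plus.
      assert (Z : forall i, (1 <= i < 2 * m)%nat -> sm (fun k => cos (INR k * (INR i * PI / INR m))) (2 * m) = 0).
      { intros i Hi. apply sum_cos_period.
        - assert (i1 : 1 <= INR i) by (apply (le_INR 1); lia).
          assert (i2 : INR i < INR (2 * m)) by (apply lt_INR; lia). rewrite mult_INR in i2. replace (INR 2) with 2 in i2 by (simpl; ring).
          assert (0 < sin (INR i * PI / INR m / 2)); [|lra]. apply sin_gt_0.
          + apply Rdiv_lt_0_compat; [apply Rdiv_lt_0_compat; nra|lra].
          + replace (INR i * PI / INR m / 2) with (INR i * PI / (2 * INR m)) by (field; lra).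
            apply (Rlt_div_l _ _ (2 * INR m)); [lra|]. nra.
        - exists (Z.of_nat i). rewrite <- INR_IZR_INZ, mult_INR. simpl (INR 2). field. lra. }
      rewrite !Z by lia. ring.
    + intros k _. rewrite plus_INR, minus_INR by lia.
      replace (INR k * ((INR m + INR j) * PI / INR m)) with (INR k * PI + INR j * (INR k * (PI / INR m))) by (field; lra).
      replace (INR k * ((INR m - INR j) * PI / INR m)) with (INR k * PI - INR j * (INR k * (PI / INR m))) by (field; lra).
      rewrite cos_plus, cos_minus, cos_kPI, sin_kPI. field.
  - apply sm_zero; intros; ring.
  - rewrite (sm_ext _ (fun k => (-1) ^ k * u (INR k * (PI / INR m)) + (-1) ^ k * v (INR k * (PI / INR m)))) by (intros; ring).
    rewrite sm_plus, IHu, IHv; ring.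
  - rewrite (sm_ext _ (fun k => c * ((-1) ^ k * u (INR k * (PI / INR m))))) by (intros; ring).
    rewrite sm_scal, IHu; ring.
  - rewrite <- IHu. apply sm_ext; intros; now rewrite E.
Qed.

Lemma pow_le_1 x n : 0 <= x <= 1 -> x ^ n <= 1.
Proof. intros H. rewrite <- (pow1 n). now apply pow_incr. Qed.

Lemma sin_minus_id y : Rabs (sin y - y) <= Rabs y ^ 3.
Proof.
  destruct (MVT_gen (fun y => sin y - y) 0 y (fun y => cos y - 1)) as [c [Hc E]].
  - intros; auto_derive; [easy|ring].
  - intros x _. apply derivable_continuous_pt. exists (cos x - 1). apply is_derive_Reals. auto_derive; [easy|ring].
  - rewrite sin_0, !Rminus_0_r in E. rewrite E, Rabs_mult.
    assert (Hc' : Rabs c <= Rabs y).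
    { unfold Rmin, Rmax in Hc. destruct (Rle_dec 0 y); [rewrite !Rabs_pos_eq; lra|rewrite !Rabs_left1; lra]. }
    assert (B : Rabs (cos c - 1) <= Rabs c ^ 2).
    { replace (cos c - 1) with (- (2 * (sin (c / 2) * sin (c / 2)))).
      - assert (S := sin_lip (c / 2) 0). rewrite sin_0, !Rminus_0_r in S.
        unfold Rdiv in S at 2. rewrite Rabs_mult, (Rabs_pos_eq (/ 2)) in S by lra.
        rewrite Rabs_Ropp, Rabs_mult, (Rabs_pos_eq 2), Rabs_mult by lra.
        generalize (Rabs_pos (sin (c / 2))) (Rabs_pos c); intros. simpl. nra.
      - replace (cos c) with (cos (2 * (c / 2))) by (f_equal; field). rewrite cos_2a_sin; ring. }
    replace (Rabs y ^ 3) with (Rabs y ^ 2 * Rabs y) by ring.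
    apply Rmult_le_compat_r; [apply Rabs_pos|]. eapply Rle_trans; [apply B|].
    apply pow_incr; split; [apply Rabs_pos|auto].
Qed.

Lemma trig_bounded n f : trig n f -> exists B, 0 <= B /\ forall t, Rabs (f t) <= B.
Proof.
  intros H; induction H as [u [k [Hk Hu]]| |u v Hu [a [A0 IHu]] Hv [b [B0 IHv]]|c u Hu [a [A0 IHu]]|u v Hu [a [A0 IHu]] E].
  - exists 1; split; [lra|]. intros t. destruct Hu as [-> | ->]; apply Rabs_le; [apply COS_bound|apply SIN_bound].
  - exists 0; split; [lra|]. intros; rewrite Rabs_R0; lra.
  - exists (a + b); split; [lra|]. intros t. eapply Rle_trans; [apply Rabs_triang|].
    specialize (IHu t). specialize (IHv t). lra.
  - exists (Rabs c * a); split; [apply Rmult_le_pos; [apply Rabs_pos|auto]|]. intros t.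
    rewrite Rabs_mult. apply Rmult_le_compat_l; [apply Rabs_pos|auto].
  - exists a; split; [auto|]. intros; rewrite <- E; auto.
Qed.

(* A trigonometric polynomial in place of the Euler perfect spline. *)
Lemma euler_like r e : (1 <= r)%nat -> 0 < e -> exists n phi ka, trig n phi /\
  (forall x, Rabs (Derive_n phi r x) <= 1) /\ Rabs (Kr r - ka) <= 2 * e /\
  forall l k, phi (INR l * PI - INR k * PI) = (-1) ^ l * (-1) ^ k * ka.
Proof.
  intros Hr He. destruct (sgn_approx e He) as [V [s [_ [HS [_ HK]]]]]. specialize (HK r Hr).
  destruct (phase_cases r) as [al [sg [_ [Hsg [Hcos Hsign]]]]].
  set (a := fun v => 4 / PI * ((-1) ^ v * (s v / INR (2 * v + 1)))).
  destruct (trig_antiderivative r V a (fun v => (2 * v + 1)%nat) (2 * V)) as [G [TG [EG DG]]]; [intros; lia|].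
  assert (SG := trig_smooth _ _ TG). assert (P3 := PI_gt3).
  set (ka := 4 / PI * sm (fun v => Kr_term r v * s v) V).
  assert (Shift : forall i x, Derive_n (fun y => sg * G (y - al)) i x = sg * Derive_n G i (x - al)).
  { apply (chain_Derive_n (fun i x => sg * Derive_n G i (x - al))). intros i x.
    apply is_derive_scal. eapply is_derive_val; [apply (is_derive_compR (Derive_n G i) (fun x => x - al)); [apply SG|]|].
    - auto_derive; [easy|reflexivity].
    - eqR; ring. }
  (* The shift by [al] moves the points with values plus or minus [ka] to the multiples of [PI];
     frequency [2 v + 1] then keeps the phase [- 2 v al], which produces the sign in [Kr_term]. *)
  exists (2 * V)%nat, (fun x => sg * G (x - al)), ka; repeat split.
  - apply span_scal. eapply span_comp; [|apply TG]. intros g [k [Hk [-> | ->]]].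
    + eapply span_ext; [apply (trig_phase (- (INR k * al)) k _ Hk)|]. intros x; simpl; f_equal; ring.
    + eapply span_ext; [apply (trig_phase (- (INR k * al) + - (PI / 2)) k _ Hk)|]. intros x; simpl.
      rewrite sin_as_cos; f_equal; ring.
  - intros x. rewrite Shift, Rabs_mult. assert (S1 : Rabs sg = 1) by (destruct Hsg as [-> | ->]; [apply Rabs_R1|rewrite Rabs_left; lra]).
    rewrite S1, Rmult_1_l, DG. specialize (HS (x - al)).
    replace (sm _ V) with (sgn_trig s V (x - al)); [auto|]. unfold sgn_trig, a. rewrite <- sm_scal.
    apply sm_ext; intros; ring.
  - unfold ka. replace (Kr r - 4 / PI * sm (fun v => Kr_term r v * s v) V)
      with (4 / PI * (Kr r * PI / 4 - sm (fun v => Kr_term r v * s v) V)) by (field; lra).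
    assert (P4 := four_over_PI).
    rewrite Rabs_mult, Rabs_pos_eq by lra.
    generalize (Rabs_pos (Kr r * PI / 4 - sm (fun v => Kr_term r v * s v) V)); nra.
  - intros l k. rewrite EG. unfold ka, a. rewrite <- !sm_scal. apply sm_ext; intros v _.
    rewrite Hcos.
    replace (INR (2 * v + 1) * (INR l * PI - INR k * PI - al) + al) with
      ((- (2 * INR v * al) + INR ((2 * v + 1) * l) * PI) - INR ((2 * v + 1) * k) * PI).
    2:{ rewrite !mult_INR, odd_INR. ring. }
    rewrite cos_minus_kPI, cos_plus, cos_kPI, sin_kPI, cos_neg.
    assert (PO : forall i, (-1) ^ ((2 * v + 1) * i) = (-1) ^ i).
    { intros i. replace ((2 * v + 1) * i)%nat with (2 * (v * i) + i)%nat by lia. rewrite pow_add, pow_m1_even; ring. }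
    rewrite !PO. unfold Kr_term. rewrite <- Hsign, (pow_add _ r 1), pow_1.
    assert (S2 : sg * sg = 1) by (destruct Hsg as [-> | ->]; ring).
    assert (O := odd_ge1 v).
    transitivity ((sg * sg) * (4 / PI * ((-1) ^ v * (s v / INR (2 * v + 1))) / INR (2 * v + 1) ^ r * ((-1) ^ k * (cos (2 * INR v * al) * (-1) ^ l)))).
    + ring.
    + rewrite S2. field. repeat split; try lra; apply pow_nonzero; lra.
Qed.

Lemma scaled_derivs phi m r : smooth phi -> 0 < m ->
  smooth (fun x => / m ^ r * phi (m * x)) /\ forall x, Derive_n (fun x => / m ^ r * phi (m * x)) r x = Derive_n phi r (m * x).
Proof.
  intros Sp Hm. set (F := fun i x => / m ^ r * (m ^ i * Derive_n phi i (m * x))).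
  assert (HF : forall i x, is_derive (F i) x (F (S i) x)).
  { intros i x. unfold F. apply is_derive_scal.
    eapply is_derive_val; [apply is_derive_scal, (is_derive_compR (Derive_n phi i) (fun x => m * x)); [apply Sp|]|].
    - auto_derive; [easy|reflexivity].
    - eqR; simpl (m ^ S i). ring. }
  assert (E : forall x, F 0%nat x = / m ^ r * phi (m * x)) by (intros; unfold F; simpl; ring).
  split.
  - apply (smooth_ext (F 0%nat)); [apply (chain_smooth F HF)|apply E].
  - intros x. rewrite <- (Derive_n_ext (F 0%nat) _ r x E), (chain_Derive_n F HF). unfold F. field. apply pow_nonzero; lra.
Qed.

(* The functional [sum_k (-1)^k (1 - x_k^2)^d F(x_k)] over the Chebyshev nodes annihilates polynomials of degree [< 2 l - 2 d];
   the weight concentrates it near [0], where the nodes are almost equally spaced. *)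
Lemma chebyshev_test r K C phi ka B L l d de : (1 <= r)%nat -> 0 <= K -> 0 <= C -> 0 <= B -> 0 <= L ->
  smooth phi -> (forall x, Rabs (Derive_n phi r x) <= 1) ->
  (forall x, Rabs (phi x) <= B) -> Rabs ka <= B -> (forall x y, Rabs (phi x - phi y) <= L * Rabs (x - y)) ->
  (forall l k, phi (INR l * PI - INR k * PI) = (-1) ^ l * (-1) ^ k * ka) ->
  admissible r K C -> (2 * d + r <= 2 * l)%nat -> 0 < de <= 1 ->
  let m := INR (2 * l) in let N := INR (2 * l - 2 * d) in
  ka - (64 * L * m * de ^ 3 + 4 * m * B * (1 - de ^ 2) ^ d) <= K * (m / N) ^ r + C * (m / N) ^ r / N.
Proof.
  intros Hr HK HC HB HL Sp Hphi Hb Hka Hlip Hval Hadm Hdeg Hde m N.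
  assert (l0 : (0 < l)%nat) by lia. assert (P3 := PI_gt3).
  assert (m1 : 1 <= m) by (apply (le_INR 1); lia).
  assert (N1 : 1 <= N) by (apply (le_INR 1); lia).
  assert (mr : 0 < m ^ r) by (apply pow_lt; lra).
  assert (Nr : 0 < N ^ r) by (apply pow_lt; lra).
  destruct (scaled_derivs phi m r Sp ltac:(lra)) as [Sf Df].
  set (f := fun x => / m ^ r * phi (m * x)) in *.
  assert (Wf : W r f) by (apply smooth_W; [auto|auto|intros; rewrite Df; auto]).
  destruct (Hadm f Wf (2 * l - 2 * d - 1)%nat ltac:(lia)) as [a Ha].
  replace (2 * l - 2 * d - 1 + 1)%nat with (2 * l - 2 * d)%nat in Ha by lia. fold N in Ha.
  set (p := poly_eval a (2 * l - 2 * d - 1)) in *.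
  set (x := fun k => cos (INR k * (PI / m))).
  set (w := fun k => (1 - x k ^ 2) ^ d).
  assert (Hx : forall k, inI (x k)) by (intros; apply COS_bound).
  assert (Hw0 : forall k, 0 <= 1 - x k ^ 2 <= 1).
  { intros k. specialize (Hx k). unfold inI in Hx. nra. }
  assert (Hw : forall k, 0 <= w k) by (intros; apply pow_le, Hw0).
  (* The weight has degree [2 d] and [p] degree [2 l - 2 d - 1], together just below the frequency
     [2 l] of the nodes. *)
  assert (ORTH : sm (fun k => (-1) ^ k * (w k * p (x k))) (2 * (2 * l)) = 0).
  { apply (alternating_sum_zero (2 * d + (2 * l - 2 * d - 1)) (2 * l) (fun t => (1 - cos t ^ 2) ^ d * p (cos t))); [|lia].
    apply (poly_cos_ctrig _ (fun x => (1 - x ^ 2) ^ d * p x)).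
    apply (poly_mult (2 * d) (2 * l - 2 * d - 1)); [|apply poly_eval_poly; now exists a|lia].
    apply (poly_powf 2); [|lia]. apply span_minus; [apply poly_const|apply poly_pow; lia]. }
  set (W0 := sm w (2 * (2 * l))).
  (* One node is 0, with weight 1. Hence [W0 >= 1], and errors not proportional to the weight can be
     charged to [W0]. *)
  assert (xl : x l = 0).
  { unfold x. replace (INR l * (PI / m)) with (PI / 2); [apply cos_PI2|].
    unfold m. rewrite mult_INR. simpl (INR 2). field. apply not_0_INR; lia. }
  assert (W1 : 1 <= W0).
  { unfold W0. replace 1 with (w l); [apply sm_term_le; [auto|lia]|].
    unfold w. rewrite xl. replace (1 - 0 ^ 2) with 1 by ring. apply pow1. }
  set (E0 := K / N ^ r + C / N ^ (r + 1)).
  assert (Nr1 : 0 < N ^ (r + 1)) by (apply pow_lt; lra).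
  assert (UP : Rabs (sm (fun k => (-1) ^ k * (w k * f (x k))) (2 * (2 * l))) <= E0 * W0).
  { rewrite <- (Rminus_0_r (sm _ _)), <- ORTH.
    rewrite <- sm_minus.
    eapply Rle_trans; [apply sm_abs|]. unfold W0. rewrite <- sm_scal. apply sm_le; intros k _.
    replace ((-1) ^ k * (w k * f (x k)) - (-1) ^ k * (w k * p (x k))) with ((-1) ^ k * (w k * (f (x k) - p (x k)))) by ring.
    rewrite !Rabs_mult, abs_pm1, Rmult_1_l, (Rabs_pos_eq (w k)), Rmult_comm by auto.
    apply Rmult_le_compat_r; [auto|]. eapply Rle_trans; [apply Ha, Hx|].
    assert (s1 : 0 <= sqrt (1 - x k ^ 2) <= 1).
    { split; [apply sqrt_pos|]. apply Rle_trans with (sqrt 1); [apply sqrt_le_1_alt, Hw0|rewrite sqrt_1; lra]. }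
    unfold E0. apply Rplus_le_compat.
    - unfold Rdiv at 2. apply Rmult_le_compat_l; [auto|]. rewrite <- pow_inv. apply pow_incr.
      split; [apply Rdiv_le_0_compat; lra|]. unfold Rdiv. assert (0 < / N) by (apply Rinv_0_lt_compat; lra). nra.
    - unfold Rdiv. apply Rmult_le_compat_r; [left; now apply Rinv_0_lt_compat|].
      rewrite <- (Rmult_1_r C) at 2. apply Rmult_le_compat_l; [auto|]. now apply pow_le_1. }
  (* A node is [sin y] with [m * y] a multiple of [PI], where [phi] is known exactly. Replacing [y]
     by [sin y] costs [L m |y| ^ 3], and [|y| <= 4 |sin y|] gives the factor 64. *)
  assert (NODE : forall k, (k < 2 * (2 * l))%nat ->
     Rabs ((-1) ^ l * (-1) ^ k * phi (m * x k) - ka) <= 64 * L * m * Rabs (x k) ^ 3).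
  { assert (HALF : forall k, (k <= 2 * l)%nat -> Rabs ((-1) ^ l * (-1) ^ k * phi (m * x k) - ka) <= 64 * L * m * Rabs (x k) ^ 3).
    { intros k Hk. set (y := PI / 2 - INR k * (PI / m)).
      assert (Ex : x k = sin y) by (unfold x, y; now rewrite sin_shift).
      assert (Em : m * y = INR l * PI - INR k * PI).
      { unfold y. replace m with (2 * INR l) by (unfold m; rewrite mult_INR; simpl; ring). field. apply not_0_INR; lia. }
      assert (Hy : Rabs y <= PI / 2).
      { assert (0 <= INR k * (PI / m) <= PI).
        { assert (INR k <= m) by (apply le_INR; lia). assert (0 <= INR k) by apply pos_INR.
          split; [apply Rmult_le_pos; [lra|apply Rdiv_le_0_compat; lra]|].
          replace (INR k * (PI / m)) with (INR k * PI / m) by (unfold Rdiv; ring). apply Rle_div_l; [lra|]. nra. }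
        apply Rabs_le; unfold y; lra. }
      assert (SQ : ((-1) ^ l * (-1) ^ k) * ((-1) ^ l * (-1) ^ k) = 1).
      { rewrite <- !pow_add. replace (l + k + (l + k))%nat with (2 * (l + k))%nat by lia. apply pow_m1_even. }
      replace ((-1) ^ l * (-1) ^ k * phi (m * x k) - ka) with
        ((-1) ^ l * (-1) ^ k * (phi (m * x k) - phi (INR l * PI - INR k * PI))).
      2:{ rewrite Hval. rewrite Rmult_minus_distr_l, <- (Rmult_assoc _ _ ka), SQ. ring. }
      rewrite !Rabs_mult, !abs_pm1, !Rmult_1_l. eapply Rle_trans; [apply Hlip|].
      rewrite <- Em, Ex, <- Rmult_minus_distr_l, Rabs_mult, (Rabs_pos_eq m) by lra.
      assert (Q := sin_minus_id y). assert (A := abs_sin_ge_quarter y Hy).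
      assert (Rabs y ^ 3 <= (4 * Rabs (sin y)) ^ 3) by (apply pow_incr; split; [apply Rabs_pos|lra]).
      rewrite Rpow_mult_distr in H. replace (4 ^ 3) with 64 in H by ring.
      replace (64 * L * m * Rabs (sin y) ^ 3) with (L * (m * (64 * Rabs (sin y) ^ 3))) by ring.
      apply Rmult_le_compat_l; [auto|]. apply Rmult_le_compat_l; lra. }
    (* The second half of the period repeats the nodes and the signs of the first under
       [k -> 4 l - k]. *)
    intros k Hk. destruct (le_lt_dec k (2 * l)) as [Hle | Hgt]; [auto|].
    specialize (HALF (2 * (2 * l) - k)%nat ltac:(lia)).
    assert (Ex : x (2 * (2 * l) - k)%nat = x k).
    { unfold x. rewrite minus_INR, mult_INR by lia. fold m. simpl (INR 2).
      replace (((1 + 1) * m - INR k) * (PI / m)) with (- (INR k * (PI / m)) + 2 * INR 1 * PI) by (simpl; field; lra).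
      rewrite cos_period. apply cos_neg. }
    assert (Es : (-1) ^ (2 * (2 * l) - k) = (-1) ^ k).
    { assert (Q1 : (-1) ^ (2 * (2 * l) - k) * (-1) ^ k = 1).
      { rewrite <- pow_add. replace (2 * (2 * l) - k + k)%nat with (2 * (2 * l))%nat by lia. apply pow_m1_even. }
      assert (Q2 : (-1) ^ k * (-1) ^ k = 1).
      { rewrite <- pow_add. replace (k + k)%nat with (2 * k)%nat by lia. apply pow_m1_even. }
      apply Rmult_eq_reg_r with ((-1) ^ k); [lra|]. intros Z; rewrite Z in Q2; lra. }
    rewrite Ex, Es in HALF. exact HALF. }
  set (eta := 64 * L * m * de ^ 3 + 4 * m * B * (1 - de ^ 2) ^ d).
  assert (d2 : 0 <= 1 - de ^ 2 <= 1) by nra.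
  assert (dd : 0 <= (1 - de ^ 2) ^ d) by (apply pow_le; lra).
  (* Nodes within [de] of 0 are handled by [NODE]. Each of the other at most [2 m] nodes has weight
     at most [(1 - de ^ 2) ^ d] and deviation at most [2 B]. *)
  assert (ERR : sm (fun k => w k * Rabs ((-1) ^ l * (-1) ^ k * phi (m * x k) - ka)) (2 * (2 * l)) <= eta * W0).
  { apply Rle_trans with (sm (fun k => 64 * L * m * de ^ 3 * w k + 2 * B * (1 - de ^ 2) ^ d) (2 * (2 * l))).
    - apply sm_le; intros k Hk. specialize (NODE k Hk). specialize (Hw k).
      assert (LM : 0 <= 64 * L * m) by nra.
      destruct (Rle_lt_dec (Rabs (x k)) de) as [Hs | Hb'].
      + assert (Rabs (x k) ^ 3 <= de ^ 3) by (apply pow_incr; split; [apply Rabs_pos|auto]).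
        assert (64 * L * m * Rabs (x k) ^ 3 <= 64 * L * m * de ^ 3) by (apply Rmult_le_compat_l; auto).
        assert (0 <= 2 * B * (1 - de ^ 2) ^ d) by nra.
        assert (w k * Rabs ((-1) ^ l * (-1) ^ k * phi (m * x k) - ka) <= w k * (64 * L * m * de ^ 3)) by (apply Rmult_le_compat_l; lra).
        lra.
      + assert (w k <= (1 - de ^ 2) ^ d).
        { unfold w. apply pow_incr. split; [apply Hw0|]. rewrite <- (pow2_abs (x k)). assert (de ^ 2 <= Rabs (x k) ^ 2) by (apply pow_incr; lra). lra. }
        assert (Rabs ((-1) ^ l * (-1) ^ k * phi (m * x k) - ka) <= 2 * B).
        { eapply Rle_trans; [apply Rabs_triang|]. rewrite Rabs_Ropp, !Rabs_mult, !abs_pm1.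
          specialize (Hb (m * x k)). lra. }
        assert (0 <= 64 * L * m * de ^ 3 * w k).
        { apply Rmult_le_pos; [|auto]. apply Rmult_le_pos; [auto|apply pow_le; lra]. }
        assert (w k * Rabs ((-1) ^ l * (-1) ^ k * phi (m * x k) - ka) <= (1 - de ^ 2) ^ d * (2 * B)).
        { apply Rmult_le_compat; [auto|apply Rabs_pos|auto|auto]. }
        lra.
    - rewrite sm_plus, sm_scal, sm_const. fold W0. rewrite (mult_INR 2 (2 * l)). fold m. simpl (INR 2). unfold eta.
      assert (0 <= 4 * m * B * (1 - de ^ 2) ^ d) by (apply Rmult_le_pos; nra).
      assert (4 * m * B * (1 - de ^ 2) ^ d <= 4 * m * B * (1 - de ^ 2) ^ d * W0) by nra.
      lra. }
  assert (LOW : (ka - eta) * W0 <= m ^ r * (E0 * W0)).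
  { apply Rle_trans with (sm (fun k => (-1) ^ l * (m ^ r * ((-1) ^ k * (w k * f (x k))))) (2 * (2 * l))).
    - assert (X : ka * W0 - sm (fun k => (-1) ^ l * (m ^ r * ((-1) ^ k * (w k * f (x k))))) (2 * (2 * l)) <=
        sm (fun k => w k * Rabs ((-1) ^ l * (-1) ^ k * phi (m * x k) - ka)) (2 * (2 * l))).
      { unfold W0. rewrite <- sm_scal.
        rewrite <- sm_minus.
        apply sm_le; intros k _. specialize (Hw k).
        replace (ka * w k - (-1) ^ l * (m ^ r * ((-1) ^ k * (w k * f (x k))))) with
          (w k * - ((-1) ^ l * (-1) ^ k * phi (m * x k) - ka)) by (unfold f; field; lra).
        apply Rmult_le_compat_l; [auto|]. rewrite <- Rabs_Ropp. apply Rle_abs. }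
      lra.
    - rewrite !sm_scal. eapply Rle_trans; [apply Rle_abs|]. rewrite !Rabs_mult, abs_pm1, Rmult_1_l, (Rabs_pos_eq (m ^ r)) by lra.
      apply Rmult_le_compat_l; [lra|auto]. }
  fold eta.
  assert (ka - eta <= m ^ r * E0).
  { apply Rmult_le_reg_r with W0; [lra|]. rewrite Rmult_assoc. auto. }
  eapply Rle_trans; [apply H|]. right. unfold E0, Rdiv. rewrite Rpow_mult_distr, pow_inv, pow_add, pow_1. field. split; lra.
Qed.

Lemma two_pow_ge v : (5 <= v)%nat -> (6 * v <= 2 ^ v)%nat.
Proof. intros H; induction H; simpl; lia. Qed.

(** With [y = u ^ (-4)] and [n = u ^ 4], Bernoulli gives [(1 + y) ^ n >= 2], hence
    [(1 - y) ^ n <= 1 / 2]; then the power [u] is taken. *)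
Lemma concentration_tail u : (1 <= u)%nat -> (1 - (/ INR u ^ 2) ^ 2) ^ (u ^ 5) <= / 2 ^ u.
Proof.
  intros Hu. assert (u1 : 1 <= INR u) by (apply (le_INR 1); auto).
  set (y := (/ INR u ^ 2) ^ 2). set (n := (u ^ 4)%nat).
  assert (Ey : INR n * y = 1). { unfold y, n. rewrite pow_INR. field. lra. }
  assert (n1 : 1 <= INR n) by (unfold n; rewrite pow_INR; now apply pow_R1_Rle).
  assert (Hy : 0 < y <= 1).
  { assert (0 < y) by (unfold y; apply pow_lt, Rinv_0_lt_compat, pow_lt; lra). split; [auto|]. nra. }
  replace (u ^ 5)%nat with (n * u)%nat by (unfold n; simpl; lia).
  rewrite pow_mult, <- pow_inv. apply pow_incr. split; [apply pow_le; lra|].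
  assert (B : 1 + INR n * y <= (1 + y) ^ n) by (apply Rfunctions.poly; lra). rewrite Ey in B.
  assert (Q : (1 - y) ^ n * (1 + y) ^ n <= 1) by (rewrite <- Rpow_mult_distr; apply pow_le_1; nra).
  assert (0 <= (1 - y) ^ n) by (apply pow_le; lra). nra.
Qed.

Lemma Kr_pos r : (1 <= r)%nat -> 0 < Kr r.
Proof.
  intros Hr. assert (H := Kr_approx r 2 Hr ltac:(lia)). cbn [sm] in H.
  assert (T0 := Kr_term_0 r).
  assert (T1 := Kr_term_bound r 1 Hr). replace (INR (2 * 1 + 1)) with 3 in T1 by (simpl; ring).
  replace (INR 2) with 2 in H by (simpl; ring). rewrite T0 in H.
  apply Rabs_le_between in H, T1. assert (P3 := PI_gt3). assert (0 < Kr r * PI) by lra.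
  apply Rmult_lt_reg_r with PI; lra.
Qed.

Lemma admissible_mono r K K' C C' : K <= K' -> C <= C' -> admissible r K C -> admissible r K' C'.
Proof.
  intros HK HC H f Wf n Hn. destruct (H f Wf n Hn) as [a Ha]. exists a. intros x Hx.
  eapply Rle_trans; [apply Ha, Hx|].
  assert (N0 : 0 < INR (n + 1)) by (apply lt_0_INR; lia). assert (s0 := sqrt_pos (1 - x ^ 2)).
  apply Rplus_le_compat.
  - apply Rmult_le_compat_r; [|auto]. apply pow_le, Rdiv_le_0_compat; auto.
  - unfold Rdiv. apply Rmult_le_compat_r; [left; now apply Rinv_0_lt_compat, pow_lt|].
    apply Rmult_le_compat_r; [now apply pow_le|auto].
Qed.

Lemma trigub_sharp r : (1 <= r)%nat -> forall K C, K < Kr r -> ~ admissible r K C.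
Proof.
  intros Hr K0 C0 HK0 Hadm0. assert (KP := Kr_pos r Hr).
  (* The statement allows negative constants; enlarging them to nonnegative ones keeps
     admissibility, and [K < Kr r] since [Kr r] is positive. *)
  set (K := Rmax K0 0). set (C := Rmax C0 0).
  assert (HK : 0 <= K < Kr r) by (unfold K; split; [apply Rmax_r|apply Rmax_lub_lt; lra]).
  assert (HC : 0 <= C) by apply Rmax_r.
  assert (Hadm : admissible r K C) by (eapply admissible_mono; [apply Rmax_l|apply Rmax_l|apply Hadm0]).
  set (G := Kr r - K). assert (HG : 0 < G) by (unfold G; lra).
  (* The gap [G] is spent as [G / 4] on [ka], [G / 4] on the ratio of degrees, [G / 8] on the
     concentration error and [G / 8] on the [C] term, in all less than [G]. *)
  destruct (euler_like r (G / 8) Hr ltac:(lra)) as [n [phi [ka [Tp [Hphi [Hka Hval]]]]]].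
  assert (Sp := trig_smooth _ _ Tp).
  destruct (trig_bounded _ _ Tp) as [B1 [B10 HB1]].
  destruct (trig_bounded _ _ (trig_Derive_n n phi 1 Tp)) as [L [L0 HL]].
  assert (Hlip : forall x y, Rabs (phi x - phi y) <= L * Rabs (x - y)).
  { intros x y. destruct (smooth_MVT phi 0 y x Sp) as [xi [_ E]]. change (Derive_n phi 0 x - Derive_n phi 0 y) with (phi x - phi y) in E.
    rewrite E, Rabs_mult. apply Rmult_le_compat_r; [apply Rabs_pos|apply HL]. }
  set (B := B1 + Rabs ka). assert (HB : 0 <= B) by (unfold B; generalize (Rabs_pos ka); lra).
  assert (p2 : 1 <= 2 ^ r) by (apply pow_R1_Rle; lra).
  assert (D0 : 0 < 2 ^ r * (K + 1)) by nra.
  destruct (inv_INR_small (Rmin 1 (G / 4) / (2 ^ r * (K + 1)))) as [V [HV HVe]].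
  { apply Rdiv_lt_0_compat; [apply Rmin_glb_lt; lra|auto]. }
  apply (Rlt_div_r _ _ _ D0) in HVe.
  assert (V1 : 1 <= INR V) by (apply (le_INR 1); auto).
  assert (IV : 0 < / INR V <= 1) by (apply Rinv_bounds; lra).
  assert (Y : (1 + / INR V) ^ r <= 1 + / INR V * 2 ^ r).
  { eapply Rle_trans; [apply pow_1p_bound; lra|]. nra. }
  assert (M1 := Rmin_l 1 (G / 4)). assert (M2 := Rmin_r 1 (G / 4)).
  assert (Y1 : (1 + / INR V) ^ r <= 2) by nra.
  assert (Y2 : K * (1 + / INR V) ^ r <= K + G / 4).
  { apply Rle_trans with (K * (1 + / INR V * 2 ^ r)); [apply Rmult_le_compat_l; lra|]. nra. }
  set (a := INR (V + 1)). assert (a1 : 1 <= a) by (apply (le_INR 1); lia).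
  set (H := 64 * L * (2 * a) + 4 * B * (2 * a)).
  assert (H0 : 0 <= H) by (unfold H; nra).
  destruct (inv_INR_small (G / (8 * (H + 2 * C + 1)))) as [v0 [Hv0 Hv0e]]; [apply Rdiv_lt_0_compat; lra|].
  (* A power of 2 with [6 v <= u] makes [2 ^ u >= u ^ 6] a comparison of exponents. *)
  set (v := (v0 + 5 + r)%nat). set (u := (2 ^ v)%nat).
  assert (Hu6 : (6 * v <= u)%nat) by (apply two_pow_ge; unfold v; lia).
  assert (u1 : 1 <= INR u) by (apply (le_INR 1); unfold v in Hu6; lia).
  assert (Hu : / INR u <= G / (8 * (H + 2 * C + 1))).
  { left. eapply Rle_lt_trans; [|apply Hv0e]. apply Rinv_le_contravar; [apply lt_0_INR; lia|apply le_INR; unfold v in Hu6; lia]. }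
  apply (Rle_div_r _ _ (8 * (H + 2 * C + 1))) in Hu; [|lra].
  assert (IU : 0 < / INR u <= 1) by (apply Rinv_bounds; lra).
  assert (HuG : H * / INR u <= G / 8 /\ 2 * C * / INR u <= G / 8) by nra.
  set (U5 := INR u ^ 5). assert (U51 : INR u <= U5).
  { unfold U5. rewrite <- (pow_1 (INR u)) at 1. apply Rle_pow; [auto|lia]. }
  (* The ratio [m / N] is then [1 + / V], independent of [u]. With [de = u ^ (-2)] and [m] of order
     [u ^ 5], both [m de ^ 3] and [m / 2 ^ u] are of order at most [/ u]. *)
  set (l := ((V + 1) * u ^ 5)%nat). set (d := (u ^ 5)%nat).
  assert (un : (u <= u ^ 5)%nat) by (apply INR_le; rewrite pow_INR; exact U51).
  assert (Hdeg : (2 * d + r <= 2 * l)%nat) by (unfold d, l, v in *; nia).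
  assert (de0 : 0 < / INR u ^ 2 <= 1).
  { split; [apply Rinv_0_lt_compat, pow_lt; lra|]. rewrite <- Rinv_1. apply Rinv_le_contravar; [lra|]. now apply pow_R1_Rle. }
  assert (T := chebyshev_test r K C phi ka B L l d (/ INR u ^ 2) Hr ltac:(lra) HC HB L0 Sp Hphi
     ltac:(intros; unfold B; generalize (HB1 x) (Rabs_pos ka); lra) ltac:(unfold B; lra) Hlip Hval Hadm Hdeg de0).
  cbv zeta in T.
  assert (Em : INR (2 * l) = 2 * a * U5).
  { unfold l, a, U5. rewrite !mult_INR, pow_INR. replace (INR 2) with 2 by (simpl; ring). ring. }
  assert (EN : INR (2 * l - 2 * d) = 2 * INR V * U5).
  { replace (2 * l - 2 * d)%nat with (2 * V * u ^ 5)%nat by (unfold l, d; lia).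
    rewrite !mult_INR, pow_INR. replace (INR 2) with 2 by (simpl; ring). unfold U5; ring. }
  rewrite Em, EN in T.
  replace (2 * a * U5 / (2 * INR V * U5)) with (1 + / INR V) in T.
  2:{ unfold a. rewrite plus_INR. simpl (INR 1). field. lra. }
  assert (TL := concentration_tail u ltac:(unfold v in Hu6; lia)). fold d in TL.
  assert (PW : / 2 ^ u <= / INR u ^ 6).
  { apply Rinv_le_contravar; [apply pow_lt; lra|].
    replace (INR u) with (2 ^ v) by (unfold u; rewrite pow_INR; simpl; f_equal; ring).
    rewrite <- pow_mult. apply Rle_pow; [lra|lia]. }
  assert (E1 : 64 * L * (2 * a * U5) * (/ INR u ^ 2) ^ 3 = 64 * L * (2 * a) * / INR u) by (unfold U5; field; lra).
  assert (E2 : 4 * (2 * a * U5) * B * (1 - (/ INR u ^ 2) ^ 2) ^ d <= 4 * B * (2 * a) * / INR u).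
  { apply Rle_trans with (4 * (2 * a * U5) * B * / INR u ^ 6).
    - apply Rmult_le_compat_l; [|lra]. apply Rmult_le_pos; nra.
    - right. unfold U5. field. lra. }
  assert (E3 : C * (1 + / INR V) ^ r / (2 * INR V * U5) <= 2 * C * / INR u).
  { unfold Rdiv. assert (/ (2 * INR V * U5) <= / INR u) by (apply Rinv_le_contravar; nra).
    assert (0 < / (2 * INR V * U5)) by (apply Rinv_0_lt_compat; nra).
    apply Rmult_le_compat; [|lra| |auto].
    - apply Rmult_le_pos; [auto|apply pow_le; lra].
    - nra. }
  rewrite E1 in T. apply Rabs_le_between in Hka. unfold H in HuG. unfold G in *. lra.
Qed.

Theorem mainTheorem3 :
  (forall r : nat, (1 <= r)%nat ->
     exists c : R, c > 0 /\ admissible r (Kr r) c) /\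
  (forall r : nat, (1 <= r)%nat ->
     forall K C : R, K < Kr r -> ~ admissible r K C) /\
  (exists c : R, c > 0 /\
     forall r : nat, (1 <= r)%nat ->
       forall C : R, admissible r (Kr r) C -> c * exp (INR r) <= C).
Proof.
  split; [exact trigub_upper|split; [exact trigub_sharp|exact trigub_constant_lower]].
Qed.
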